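(* Let $M$ be a loopless matroid of rank $r$ on a finite ground set $E$, let $\mathcal G$ be a building set of $M$ containing $E$, and let $d=r-1$. For every $\xi\in\mathsf K(M,\mathcal G)$, $$\chi_{M,\mathcal G}(\xi)=(-1)^d\,\chi_{M,\mathcal G}\left(\xi^\vee\otimes\omega_{M,\mathcal G}\right),$$ where $\omega_{M,\mathcal G}=\mathcal O(-c_1(T_{M,\mathcal G}))$.
   Context: $M$ is a loopless matroid on a finite nonempty set $E$ with rank function $\operatorname{rk}$, $r=\operatorname{rk}(E)$, lattice of flats $\mathcal L(M)$ (minimum $\emptyset$, maximum $E$, join $\vee$). A subset $\mathcal G\subseteq\mathcal L(M)\setminus\{\emptyset\}$ is a building set if for every nonempty flat $F$, with $G_1,\dots,G_s$ the maximal elements of $\mathcal G$ contained in $F$, the join map $[\emptyset,G_1]\times\cdots\times[\emptyset,G_s]\to[\emptyset,F]$ is a poset isomorphism. $\mathcal G_{\max}=\mathcal L(M)\setminus\{\emptyset\}$. A subset $\mathcal S\subseteq\mathcal G\setminus\{E\}$ is $\mathcal G$-nested if every collection of $m\ge2$ pairwise incomparable elements of $\mathcal S$ has join not in $\mathcal G$. In $N_E=\mathbb Z^E/\mathbb Z(1,\dots,1)$ let $v_F$ be the image of $\sum_{i\in F}e_i$; the nested-set fan $\Sigma_{M,\mathcal G}$ consists of the cones $\operatorname{cone}(v_F:F\in\mathcal S)$, $\mathcal S$ $\mathcal G$-nested, and $X_{M,\mathcal G}$ is its smooth toric variety. The fan of $\mathcal G_{\max}$ refines that of $\mathcal G$ (same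 support), giving a proper toric morphism $\rho_{\mathcal G_{\max},\mathcal G}:X_{M,\mathcal G_{\max}}\to X_{M,\mathcal G}$. $\mathsf A(M,\mathcal G)$ is the Chow ring of $X_{M,\mathcal G}$, presented as $\mathbb Z[x_F:F\in\mathcal G\setminus\{E\}]$ modulo monomials $x_{F_1}\cdots x_{F_m}$ for non-nested $\{F_1,\dots,F_m\}$ and the linear forms $\sum_{F\ni i}x_F-\sum_{F\ni j}x_F$ ($i,j\in E$, sums over $F\in\mathcal G\setminus\{E\}$). Put $\alpha=\sum_{F\in\mathcal G\setminus\{E\},\,i\in F}x_F$ (independent of $i$). $\int_{M,\mathcal G}:\mathsf A^{d}(M,\mathcal G)\to\mathbb Z$ is the degree isomorphism with $\int\alpha^d=1$, extended by $0$ to other degrees and $\mathbb Q$-linearly. $\mathsf K(M,\mathcal G)=K_0(X_{M,\mathcal G})$; $\mathcal O(D)$ is the line bundle of $D\in\mathsf A^1(M,\mathcal G)$; $\xi\mapsto\xi^\vee$ is duality of vector bundles. With $\theta_F^{\mathcal G}=\alpha-\sum_{H\in\mathcal G,\,F\subseteq H\subsetneq E}x_H$, the tangent class is $T_{M,\mathcal G}:=r[\mathcal O(\alpha)]-[\mathcal O]+\sum_{F\in\mathcal G\setminus\{E\}}\big([\mathcal O(x_F)]-[\mathcal O]+\operatorname{rk}(F)([\mathcal O(\theta_F^{\mathcal G})]-[\mathcal O(\theta_F^{\mathcal G}+x_F)])\big)$. The Euler characteristic is $\chi_{M,\mathcal G}(\xi):=\chi_{M,\mathcal G_{\max}}\big((\rho_{\mathcal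 G_{\max},\mathcal G})^*\xi\big)$, where $\chi_{M,\mathcal G_{\max}}:\mathsf K(M,\mathcal G_{\max})\to\mathbb Z$ is the matroid Euler characteristic of Larson–Li–Payne–Proudfoot, which is known to be given by $\chi_{M,\mathcal G_{\max}}(\eta)=\int_{M,\mathcal G_{\max}}\operatorname{ch}(\eta)\operatorname{td}(T_{M,\mathcal G_{\max}})$ for all $\eta$ ($\operatorname{ch}$ Chern character, $\operatorname{td}$ Todd class); this identity may be taken as its definition. *)

(* Defs.v *)
From HB Require Import structures.
From mathcomp Require Import all_boot all_order all_algebra.
From mathcomp Require Import fraction ring_quotient generic_quotient.
From mathcomp Require Import boolp mxtens.
From mathcomp Require Import freeg mpoly.

Set Implicit Arguments.
Unset Strict Implicit.
Unset Printing Implicit Defensive.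

Import GRing.Theory.
Local Open Scope ring_scope.

Section Lattice.
Variable K : fieldType.

Definition subring (A : K -> Prop) : Prop :=
  [/\ A 1, forall a b, A a -> A b -> A (a - b)
    & forall a b, A a -> A b -> A (a * b)].

(* A-submodules L of K^n that are finitely generated projective over A and
   span K^n: the rows of U and the columns of V form a dual basis. *)
Definition proj_lattice (A : K -> Prop) n (L : 'rV[K]_n -> Prop) : Prop :=
  [/\ L 0, forall a p q, A a -> L p -> L q -> L (a *: p + q)
    & exists N (U : 'M[K]_(N, n)) (V : 'M[K]_(n, N)),
        [/\ V *m U = 1%:M, forall j, L (row j U)
          & forall p, L p -> forall j, A ((p *m V) 0 j)]].

Definition lspan (A : K -> Prop) n (X : 'rV[K]_n -> Prop) (p : 'rV[K]_n) : Prop :=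
  exists s : seq (K * 'rV[K]_n),
    (forall c, c \in s -> A c.1 /\ X c.2) /\ p = \sum_(c <- s) c.1 *: c.2.

Definition dual_lattice (A : K -> Prop) n (L : 'rV[K]_n -> Prop)
    (f : 'rV[K]_n) : Prop :=
  forall p, L p -> A ((p *m f^T) 0 0).

(* The elementary tensor of two row vectors, in the coordinates of mxtens. *)
Definition rvtens m n (p : 'rV[K]_m) (q : 'rV[K]_n) : 'rV[K]_(m * n) :=
  \row_i (p 0 (mxtens_unindex i).1 * q 0 (mxtens_unindex i).2).

Definition pure_tensor m n (L : 'rV[K]_m -> Prop) (L' : 'rV[K]_n -> Prop)
    (t : 'rV[K]_(m * n)) : Prop :=
  exists p q, [/\ L p, L' q & t = rvtens p q].

Definition exact_at n' n n'' (L' : 'rV[K]_n' -> Prop) (L : 'rV[K]_n -> Prop)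
    (L'' : 'rV[K]_n'' -> Prop) (f : 'M[K]_(n', n)) (g : 'M[K]_(n, n'')) : Prop :=
  [/\ forall p, L' p -> L (p *m f),
      forall p, L p -> L'' (p *m g),
      forall p, L' p -> p *m f = 0 -> p = 0,
      forall p, L'' p -> exists2 q, L q & q *m g = p
    & forall p, L p -> (p *m g = 0 <-> exists2 q, L' q & q *m f = p)].

Definition split_at n' n n'' (L' : 'rV[K]_n' -> Prop) (L : 'rV[K]_n -> Prop)
    (L'' : 'rV[K]_n'' -> Prop) (f : 'M[K]_(n', n)) (g : 'M[K]_(n, n''))
    (r : 'M[K]_(n, n')) (s : 'M[K]_(n'', n)) : Prop :=
  [/\ [/\ forall p, L' p -> L (p *m f), forall p, L p -> L'' (p *m g),
      forall p, L p -> L' (p *m r) & forall p, L'' p -> L (p *m s)],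
      f *m r = 1%:M, s *m g = 1%:M & r *m f + g *m s = 1%:M].

Lemma rvtens_mul m n m1 n1 (p : 'rV[K]_m) (q : 'rV[K]_n)
    (f : 'M[K]_(m, m1)) (g : 'M[K]_(n, n1)) :
  rvtens p q *m (f *t g) = rvtens (p *m f) (q *m g).
Proof.
apply/rowP => j; case: (mxtens_indexP j) => j1 j2.
rewrite !mxE !mxtens_indexK mulr_sum; apply: eq_bigr => k _.
by rewrite !mxE !mxtens_indexK mulrACA.
Qed.

Lemma pair_row m n (p : 'rV[K]_n) (V : 'M[K]_(n, m)) j :
  (p *m (row j V^T)^T) 0 0 = (p *m V) 0 j.
Proof. by rewrite !mxE; apply: eq_bigr => i _; rewrite !mxE. Qed.

Lemma pair_rowC m n (p : 'rV[K]_n) (U : 'M[K]_(m, n)) j :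
  (row j U *m p^T) 0 0 = (p *m U^T) 0 j.
Proof. by rewrite !mxE; apply: eq_bigr => i _; rewrite !mxE mulrC. Qed.

Section Theory.
Variables (A : K -> Prop) (hA : subring A).

Lemma subring0 : A 0.
Proof. by case: hA => h1 hB _; rewrite -(subrr 1); apply: hB. Qed.

Lemma subringN a : A a -> A (- a).
Proof. by case: hA => h1 hB _ ha; rewrite -sub0r; apply: hB => //; apply: subring0. Qed.

Lemma subringD a b : A a -> A b -> A (a + b).
Proof.
case: (hA) => h1 hB _ ha hb; rewrite -(opprK b); apply: hB => //.
exact: subringN.
Qed.

Lemma subringM a b : A a -> A b -> A (a * b).
Proof. by case: hA => _ _ h; apply: h. Qed.

Lemma subring_sum (I : Type) (s : seq I) (F : I -> K) :
  (forall i, A (F i)) -> A (\sum_(i <- s) F i).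
Proof. by move=> h; elim/big_ind: _ => //; [apply: subring0 | apply: subringD]. Qed.

Section Closed.
Variables (n : nat) (L : 'rV[K]_n -> Prop).
Hypotheses (L0 : L 0)
  (Lc : forall a p q, A a -> L p -> L q -> L (a *: p + q)).

Lemma latD p q : L p -> L q -> L (p + q).
Proof. by move=> hp hq; rewrite -[p]scale1r; apply: Lc => //; case: hA. Qed.

Lemma latZ a p : A a -> L p -> L (a *: p).
Proof. by move=> ha hp; rewrite -[_ *: _]addr0; apply: Lc. Qed.

Lemma latB p q : L p -> L q -> L (p - q).
Proof.
move=> hp hq; apply: latD => //; rewrite -scaleN1r; apply: latZ => //.
by apply: subringN; case: hA.
Qed.

Lemma lat_sum (I : eqType) (s : seq I) (F : I -> 'rV[K]_n) :
  (forall i, i \in s -> L (F i)) -> L (\sum_(i <- s) F i).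
Proof.
elim: s => [|i s IH] h; first by rewrite big_nil.
rewrite big_cons; apply: latD; first by apply: h; rewrite mem_head.
by apply: IH => j hj; apply: h; rewrite inE hj orbT.
Qed.

Lemma lspan_min (X : 'rV[K]_n -> Prop) :
  (forall p, X p -> L p) -> forall p, lspan A X p -> L p.
Proof.
move=> hX p [s [hs ->]]; apply: lat_sum => c /hs[ha hx].
by apply: latZ => //; apply: hX.
Qed.

Lemma lat_mulmx N (a : 'rV[K]_N) (U : 'M[K]_(N, n)) :
  (forall j, A (a 0 j)) -> (forall j, L (row j U)) -> L (a *m U).
Proof.
move=> ha hU; rewrite mulmx_sum_row; apply: lat_sum => j _.
by apply: latZ.
Qed.
End Closed.

Section Span.
Variables (n : nat) (X : 'rV[K]_n -> Prop).

Lemma lspan0 : lspan A X 0.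
Proof. by exists [::]; rewrite big_nil. Qed.

Lemma lspan_lin a p q : A a -> lspan A X p -> lspan A X q -> lspan A X (a *: p + q).
Proof.
move=> ha [s [hs ->]] [t [ht ->]].
exists ([seq (a * c.1, c.2) | c <- s] ++ t); split.
  move=> c; rewrite mem_cat => /orP[/mapP[d /hs[hd hx] ->]|/ht//] /=.
  by split=> //; apply: subringM.
rewrite big_cat big_map scaler_sumr /=; congr (_ + _).
by apply: eq_bigr => c _; rewrite scalerA.
Qed.

Lemma lspan_sub p : X p -> lspan A X p.
Proof.
move=> hp; exists [:: (1, p)]; split; last by rewrite big_seq1 scale1r.
by move=> c; rewrite inE => /eqP ->; split=> //; case: hA.
Qed.
End Span.

Lemma lspan_id n (L : 'rV[K]_n -> Prop) :
  L 0 -> (forall a p q, A a -> L p -> L q -> L (a *: p + q)) ->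
  forall p, lspan A L p <-> L p.
Proof.
move=> L0 Lc p; split; last exact: lspan_sub.
by apply: lspan_min.
Qed.

Lemma lspan_map m n (X : 'rV[K]_m -> Prop) (Y : 'rV[K]_n -> Prop) (f : 'M[K]_(m, n)) :
  (forall p, X p -> Y (p *m f)) -> forall p, lspan A X p -> lspan A Y (p *m f).
Proof.
move=> h p [s [hs ->]]; exists [seq (c.1, c.2 *m f) | c <- s]; split.
  by move=> c /mapP[d /hs[ha hx] ->]; split=> //; apply: h.
rewrite big_map mulmx_suml; apply: eq_bigr => c _ /=.
by rewrite scalemxAl.
Qed.

Lemma proj_eq0 n (L : 'rV[K]_n -> Prop) m (f : 'M[K]_(n, m)) :
  proj_lattice A L -> (forall p, L p -> p *m f = 0) -> f = 0.
Proof.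
case=> _ _ [N [U [V [VU hU _]]]] h.
rewrite -[f]mul1mx -VU -mulmxA.
suff -> : U *m f = 0 by rewrite mulmx0.
by apply/row_matrixP => j; rewrite row_mul h // row0.
Qed.

Lemma exact_splitP n' n n'' (L' : 'rV[K]_n' -> Prop) (L : 'rV[K]_n -> Prop)
    (L'' : 'rV[K]_n'' -> Prop) (f : 'M[K]_(n', n)) (g : 'M[K]_(n, n'')) :
  proj_lattice A L' -> proj_lattice A L -> proj_lattice A L'' ->
  exact_at L' L L'' f g <-> exists r s, split_at L' L L'' f g r s.
Proof.
move=> pL' pL pL''.
have [L'0 L'c [N' [U' [V' [VU' hU' hV']]]]] := pL'.
have [L0 Lc [N [U [V [VU hU hV]]]]] := pL.
have [L''0 L''c [N'' [U'' [V'' [VU'' hU'' hV'']]]]] := pL''.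
split=> [[hf hg finj gsurj ex]|[r [s [[hf hg hr hs] fr sg rfgs]]]].
- have fg : f *m g = 0.
    apply: (proj_eq0 pL') => p hp; rewrite mulmxA.
    by apply/(ex _ (hf _ hp)); exists p.
  have [Ut hUt Utg] : exists2 Ut : 'M[K]_(N'', n),
      (forall j, L (row j Ut)) & Ut *m g = U''.
    have /choice[u hu] : forall j, exists q, L q /\ q *m g = row j U''.
      by move=> j; have [q] := gsurj _ (hU'' j); exists q.
    exists (\matrix_j u j) => [j|]; first by rewrite rowK; case: (hu j).
    by apply/row_matrixP => j; rewrite row_mul rowK; case: (hu j).
  pose s := V'' *m Ut.
  have sg : s *m g = 1%:M by rewrite -mulmxA Utg.
  have hs p : L'' p -> L (p *m s).
    by move=> hp; rewrite mulmxA; apply: lat_mulmx => // j; apply: hV''.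
  pose e := 1%:M - g *m s.
  have eg : e *m g = 0 by rewrite mulmxBl mul1mx -mulmxA sg mulmx1 subrr.
  have he p : L p -> L (p *m e).
    move=> hp; rewrite mulmxBr mulmx1 mulmxA; apply: latB => //.
    by apply: hs; apply: hg.
  have [R hR Rf] : exists2 R : 'M[K]_(N, n'),
      (forall j, L' (row j R)) & R *m f = U *m e.
    have /choice[u hu] : forall j, exists q, L' q /\ q *m f = row j (U *m e).
      move=> j; rewrite row_mul.
      have [ker_im _] := ex _ (he _ (hU j)).
      have [|q hq qf] := ker_im; first by rewrite -mulmxA eg mulmx0.
      by exists q.
    exists (\matrix_j u j) => [j|]; first by rewrite rowK; case: (hu j).
    by apply/row_matrixP => j; rewrite row_mul rowK; case: (hu j).
  pose r := V *m R.
  have rf : r *m f = e by rewrite -mulmxA Rf mulmxA VU mul1mx.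
  have hr p : L p -> L' (p *m r).
    by move=> hp; rewrite mulmxA; apply: lat_mulmx => // j; apply: hV.
  have fr : f *m r = 1%:M.
    apply/eqP; rewrite -subr_eq0; apply/eqP; apply: (proj_eq0 pL') => p hp.
    apply: finj.
      rewrite mulmxBr mulmx1 mulmxA; apply: latB => //.
      by apply: hr; apply: hf.
    have fe : f *m e = f by rewrite mulmxBr mulmx1 mulmxA fg mul0mx subr0.
    by rewrite -mulmxA mulmxBl mul1mx -(mulmxA f) rf fe subrr mulmx0.
  exists r, s; split=> //.
  by rewrite rf /e subrK.
- have fgs : f *m (g *m s) = 0.
    have : f *m (r *m f + g *m s) = f by rewrite rfgs mulmx1.
    by rewrite mulmxDr mulmxA fr mul1mx => /(canRL (addKr _)); rewrite addNr.
  have fg : f *m g = 0.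
    have := congr1 (mulmx^~ g) fgs.
    by rewrite -2!mulmxA sg mulmx1 mul0mx.
  split=> //.
  + by move=> p hp h; rewrite -[p]mulmx1 -fr mulmxA h mul0mx.
  + by move=> p hp; exists (p *m s); [apply: hs | rewrite -mulmxA sg mulmx1].
  + move=> p hp; split=> [h|[q hq <-]]; last by rewrite -mulmxA fg mulmx0.
    exists (p *m r); first exact: hr.
    by rewrite -[RHS]mulmx1 -rfgs mulmxDr !mulmxA h mul0mx addr0.
Qed.

Lemma dual_proj n (L : 'rV[K]_n -> Prop) :
  proj_lattice A L -> proj_lattice A (dual_lattice A L).
Proof.
case=> L0 Lc [N [U [V [VU hU hV]]]]; split.
- by move=> p _; rewrite trmx0 mulmx0 mxE; apply: subring0.
- move=> a f g ha hf hg p hp; rewrite linearD linearZ /= mulmxDr -scalemxAr.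
  rewrite mxE [X in X + _]mxE; apply: subringD; last exact: hg.
  by apply: subringM => //; apply: hf.
- exists N, V^T, U^T; split.
  + by rewrite -trmx_mul VU trmx1.
  + by move=> j p hp; rewrite pair_row; apply: hV.
  + by move=> f hf j; rewrite -pair_rowC; apply: hf.
Qed.

Lemma tens_proj m n (L : 'rV[K]_m -> Prop) (L' : 'rV[K]_n -> Prop) :
  proj_lattice A L -> proj_lattice A L' ->
  proj_lattice A (lspan A (pure_tensor L L')).
Proof.
case=> L0 Lc [N [U [V [VU hU hV]]]] [L'0 L'c [N' [U' [V' [VU' hU' hV']]]]].
split; [exact: lspan0 | exact: lspan_lin |].
have rowt j : row j (U *t U')
    = rvtens (row (mxtens_unindex j).1 U) (row (mxtens_unindex j).2 U').
  by apply/rowP => i; rewrite !mxE.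
exists (N * N')%N, (U *t U'), (V *t V'); split.
- rewrite tensmx_mul VU VU'; apply/matrixP => i j.
  case: (mxtens_indexP i) => i1 i2; case: (mxtens_indexP j) => j1 j2.
  rewrite tensmxE !mxE (can_eq (@mxtens_indexK _ _)) xpair_eqE.
  by case: (i1 == j1); rewrite ?mul1r ?mul0r.
- by move=> j; apply: lspan_sub; rewrite rowt; exists (row (mxtens_unindex j).1 U),
    (row (mxtens_unindex j).2 U').
- move=> t [s [hs ->]] j; rewrite mulmx_suml summxE big_seq.
  elim/big_ind: _ => [||c /hs[ha [p [q [hp hq ->]]]]].
  + exact: subring0.
  + exact: subringD.
  rewrite -scalemxAl mxE; apply: subringM => //.
  by rewrite rvtens_mul mxE; apply: subringM; auto.
Qed.

End Theory.

Section Extension.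
Variables (A B : K -> Prop).
Hypotheses (hA : subring A) (hB : subring B) (AB : forall a, A a -> B a).

Lemma ext_proj n (L : 'rV[K]_n -> Prop) :
  proj_lattice A L -> proj_lattice B (lspan B L).
Proof.
case=> L0 Lc [N [U [V [VU hU hV]]]].
split; [exact: lspan0 | exact: lspan_lin |].
exists N, U, V; split=> // [j|p [s [hs ->]] j]; first exact: lspan_sub.
rewrite mulmx_suml summxE big_seq.
elim/big_ind: _ => [||c /hs[ha hp]].
- exact: subring0.
- exact: subringD.
by rewrite -scalemxAl mxE; apply: subringM => //; apply: AB; apply: hV.
Qed.

Lemma lspan_lspan n (X : 'rV[K]_n -> Prop) p :
  lspan B (lspan A X) p <-> lspan B X p.
Proof.
split=> [|h].
  apply: (lspan_min hB) => //; [exact: lspan0 | exact: lspan_lin |].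
  move=> q [s [hs ->]]; exists s; split=> // c /hs[ha hx].
  by split=> //; apply: AB.
rewrite -[p]mulmx1; apply: (lspan_map (X := X)) => // q hq; rewrite mulmx1.
exact: lspan_sub.
Qed.

Lemma ext_dual n (L L1 : 'rV[K]_n -> Prop) :
  proj_lattice A L -> (forall p, L1 p <-> lspan B L p) ->
  forall f, dual_lattice B L1 f <-> lspan B (dual_lattice A L) f.
Proof.
move=> pL hL1 f; have [L0 Lc [N [U [V [VU hU hV]]]]] := pL.
have [D0 Dc _] := dual_proj hA pL.
split=> [hf|[s [hs ->]] p /hL1 hp].
- have -> : f = (f *m U^T) *m V^T by rewrite -mulmxA -trmx_mul VU trmx1 mulmx1.
  apply: (lat_mulmx hB) => //; [exact: lspan0 | exact: lspan_lin | |].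
  + move=> j; have /hf := (hL1 _).2 (lspan_sub hB (hU j)).
    by rewrite pair_rowC.
  + move=> j; apply: lspan_sub => // p hp.
    by rewrite pair_row; apply: hV.
- case: hp => t [ht ->].
  rewrite mulmx_suml summxE big_seq; elim/big_ind: _ => [||c /ht[hc hp]].
  + exact: subring0.
  + exact: subringD.
  rewrite -scalemxAl mxE; apply: subringM => //.
  rewrite linear_sum mulmx_sumr summxE big_seq; elim/big_ind: _ => [||d /hs[hd hq]].
  + exact: subring0.
  + exact: subringD.
  by rewrite linearZ -scalemxAr mxE; apply: subringM => //; apply: AB; apply: hq.
Qed.

Lemma ext_tens m n (L L1 : 'rV[K]_m -> Prop) (L' L1' : 'rV[K]_n -> Prop) :
  (forall p, L1 p <-> lspan B L p) -> (forall p, L1' p <-> lspan B L' p) ->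
  forall t, lspan B (pure_tensor L1 L1') t <-> lspan B (lspan A (pure_tensor L L')) t.
Proof.
move=> h h' t; rewrite lspan_lspan; split.
- apply: (lspan_min hB) => //; [exact: lspan0 | exact: lspan_lin |].
  move=> _ [_ [_ [/h[s [hs ->]] /h'[s' [hs' ->]] ->]]].
  have -> : rvtens (\sum_(c <- s) c.1 *: c.2) (\sum_(c <- s') c.1 *: c.2)
     = \sum_(c <- s) \sum_(c' <- s') (c.1 * c'.1) *: rvtens c.2 c'.2.
    apply/rowP => i; rewrite !mxE !summxE mulr_suml; apply: eq_bigr => c _.
    rewrite summxE mulr_sumr; apply: eq_bigr => c' _.
    by rewrite !mxE mulrACA.
  apply: (lat_sum hB) => //; [exact: lspan0 | exact: lspan_lin |].
  move=> c /hs[hc hp]; apply: (lat_sum hB) => //; [exact: lspan0 | exact: lspan_lin |].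
  move=> c' /hs'[hc' hq]; apply: (latZ (A := B)) => //; [exact: lspan0 | exact: lspan_lin | |].
    exact: subringM.
  by apply: lspan_sub => //; exists c.2, c'.2.
- apply: (lspan_min hB) => //; [exact: lspan0 | exact: lspan_lin |].
  move=> _ [p [q [hp hq ->]]]; apply: lspan_sub => //; exists p, q; split=> //.
    by apply/h; apply: lspan_sub.
  by apply/h'; apply: lspan_sub.
Qed.

End Extension.

Section SplitOps.
Variables (A : K -> Prop) (hA : subring A).
Variables (n' n n'' : nat) (L' : 'rV[K]_n' -> Prop) (L : 'rV[K]_n -> Prop)
  (L'' : 'rV[K]_n'' -> Prop) (f : 'M[K]_(n', n)) (g : 'M[K]_(n, n''))
  (r : 'M[K]_(n, n')) (s : 'M[K]_(n'', n)).
Hypothesis hsplit : split_at L' L L'' f g r s.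

Lemma split_dual :
  split_at (dual_lattice A L'') (dual_lattice A L) (dual_lattice A L')
    g^T f^T s^T r^T.
Proof.
case: hsplit => [[hf hg hr hs] fr sg rfgs].
have tr m1 m2 (X : 'rV[K]_m1 -> Prop) (Y : 'rV[K]_m2 -> Prop) (h : 'M[K]_(m1, m2)) :
    (forall p, X p -> Y (p *m h)) ->
    forall q, dual_lattice A Y q -> dual_lattice A X (q *m h^T).
  by move=> H q hq p hp; rewrite trmx_mul trmxK mulmxA; apply: hq; apply: H.
split; first by split; apply: tr.
- by rewrite -trmx_mul sg trmx1.
- by rewrite -trmx_mul fr trmx1.
- by rewrite -!trmx_mul -linearD /= addrC rfgs trmx1.
Qed.

Lemma split_ext (B : K -> Prop) :
  split_at (lspan B L') (lspan B L) (lspan B L'') f g r s.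
Proof.
case: hsplit => [[hf hg hr hs] fr sg rfgs].
by split=> //; split; apply: lspan_map.
Qed.

Lemma tens11 m1 m2 : (1%:M : 'M[K]_m1) *t (1%:M : 'M[K]_m2) = 1%:M.
Proof.
apply/matrixP => i j.
case: (mxtens_indexP i) => i1 i2; case: (mxtens_indexP j) => j1 j2.
rewrite tensmxE !mxE (can_eq (@mxtens_indexK _ _)) xpair_eqE.
by case: (i1 == j1); rewrite ?mul1r ?mul0r.
Qed.

Lemma split_tensl m (L1 : 'rV[K]_m -> Prop) :
  split_at (lspan A (pure_tensor L' L1)) (lspan A (pure_tensor L L1))
    (lspan A (pure_tensor L'' L1))
    (f *t 1%:M) (g *t 1%:M) (r *t 1%:M) (s *t 1%:M).
Proof.
case: hsplit => [[hf hg hr hs] fr sg rfgs].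
have tr m1 m2 (X : 'rV[K]_m1 -> Prop) (Y : 'rV[K]_m2 -> Prop) (h : 'M[K]_(m1, m2)) :
    (forall p, X p -> Y (p *m h)) -> forall t, lspan A (pure_tensor X L1) t ->
    lspan A (pure_tensor Y L1) (t *m (h *t 1%:M)).
  move=> H; apply: lspan_map => _ [p [q [hp hq ->]]].
  by exists (p *m h), q; rewrite rvtens_mul mulmx1; split=> //; apply: H.
split; first by split; apply: tr.
- by rewrite tensmx_mul fr mulmx1 tens11.
- by rewrite tensmx_mul sg mulmx1 tens11.
- rewrite !tensmx_mul mulmx1 -tens11 -rfgs; apply/matrixP => i j.
  by rewrite !mxE mulrDl.
Qed.

Lemma split_tensr m (L1 : 'rV[K]_m -> Prop) :
  split_at (lspan A (pure_tensor L1 L')) (lspan A (pure_tensor L1 L))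
    (lspan A (pure_tensor L1 L''))
    (1%:M *t f) (1%:M *t g) (1%:M *t r) (1%:M *t s).
Proof.
case: hsplit => [[hf hg hr hs] fr sg rfgs].
have tr m1 m2 (X : 'rV[K]_m1 -> Prop) (Y : 'rV[K]_m2 -> Prop) (h : 'M[K]_(m1, m2)) :
    (forall p, X p -> Y (p *m h)) -> forall t, lspan A (pure_tensor L1 X) t ->
    lspan A (pure_tensor L1 Y) (t *m (1%:M *t h)).
  move=> H; apply: lspan_map => _ [p [q [hp hq ->]]].
  by exists p, (q *m h); rewrite rvtens_mul mulmx1; split=> //; apply: H.
split; first by split; apply: tr.
- by rewrite tensmx_mul fr mulmx1 tens11.
- by rewrite tensmx_mul sg mulmx1 tens11.
- rewrite !tensmx_mul mulmx1 -tens11 -rfgs; apply/matrixP => i j.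
  by rewrite !mxE mulrDr.
Qed.

End SplitOps.
End Lattice.

Record loopless_matroid (E : finType) := LooplessMatroid {
  rk : {set E} -> nat;
  rk_le_card : forall A, (rk A <= #|A|)%N;
  rk_mono : forall A B : {set E}, A \subset B -> (rk A <= rk B)%N;
  rk_submod : forall A B, (rk (A :|: B) + rk (A :&: B) <= rk A + rk B)%N;
  rk_loopless : forall e, rk [set e] = 1%N;
  ground_nonempty : (0 < #|E|)%N }.

Section Matroid.
Variables (E : finType) (M : loopless_matroid E).
Implicit Types (A B F H X : {set E}) (G S T : {set {set E}}).

Definition closure A : {set E} := [set e | rk M (e |: A) == rk M A].

Definition flat F : bool := closure F == F.

Definition factors G F : {set {set E}} :=
  [set H in G | (H \subset F) &&
     [forall H' in G, (H \subset H') && (H' \subset F) ==> (H' == H)]].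

(* The elements of the product of the intervals [0, H], H in factors G F; only
   the values on factors G F matter. *)
Definition in_product G F (a : {set E} -> {set E}) : Prop :=
  forall H, H \in factors G F -> flat (a H) /\ a H \subset H.

Definition product_join G F (a : {set E} -> {set E}) : {set E} :=
  closure (\bigcup_(H in factors G F) a H).

(* For a nonempty flat F, the join map is an order embedding and is onto
   [0, F], that is, it is an isomorphism of posets. *)
Definition is_building_set G : Prop :=
  (forall F, F \in G -> flat F /\ F != set0) /\
  forall F, flat F -> F != set0 ->
    (forall a b, in_product G F a -> in_product G F b ->
       (product_join G F a \subset product_join G F b) <->
       (forall H, H \in factors G F -> a H \subset b H)) /\
    (forall X, flat X -> X \subset F ->
       exists2 a, in_product G F a & product_join G F a = X).

Definition antichain T : bool :=
  [forall A in T, forall B in T, (A \subset B) ==> (A == B)].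

Definition nested G S : bool :=
  (S \subset G :\ [set: E]) &&
  [forall T : {set {set E}},
     [&& T \subset S, (1 < #|T|)%N & antichain T] ==> (closure (cover T) \notin G)].

Record building_set := BuildingSet {
  bset :> {set {set E}};
  bset_building : is_building_set bset;
  bset_full : [set: E] \in bset }.

Lemma subset_closure A : A \subset closure A.
Proof.
by apply/subsetP => e eA; rewrite inE (setUidPr _) // sub1set.
Qed.

Lemma rkU1 A B e : A \subset B -> rk M (e |: A) = rk M A -> rk M (e |: B) = rk M B.
Proof.
move=> AB eA; apply/eqP; rewrite eqn_leq [X in _ && X]rk_mono ?subsetUr // andbT.
have := rk_submod M (e |: A) B.
rewrite -setUA (setUidPr AB) eA => h.
have h2 : (rk M A <= rk M ((e |: A) :&: B))%N.
  by apply: rk_mono; rewrite subsetI subsetUr.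
by rewrite -(leq_add2r (rk M A)) (leq_trans _ (leq_trans h _)) ?leq_add2l // addnC.
Qed.

Lemma rk_closureU A (s : seq E) :
  {subset s <= closure A} -> rk M (A :|: [set x in s]) = rk M A.
Proof.
elim: s => [|x s IH] hs.
  by congr rk; apply/setP => y; rewrite !inE orbF.
rewrite set_cons setUCA (rkU1 (subsetUl A _)) ?IH //.
  by move=> y ys; apply: hs; rewrite inE ys orbT.
by have /(_ x) := hs; rewrite mem_head inE => /(_ isT)/eqP.
Qed.

Lemma rk_closure A : rk M (closure A) = rk M A.
Proof.
rewrite -[in RHS](rk_closureU (s := enum (closure A))); last first.
  by move=> x; rewrite mem_enum.
congr rk; apply/setP => x; rewrite !inE mem_enum inE.
have [xA|//] := boolP (x \in A).
by rewrite (setUidPr _) ?eqxx // sub1set.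
Qed.

Lemma closureS A B : A \subset B -> closure A \subset closure B.
Proof.
by move=> AB; apply/subsetP => e; rewrite !inE => /eqP/(rkU1 AB)/eqP.
Qed.

Lemma flat_closure A : flat (closure A).
Proof.
rewrite /flat eqEsubset subset_closure andbT; apply/subsetP => e; rewrite !inE.
rewrite rk_closure => /eqP h; rewrite eqn_leq (rk_mono _ (subsetUr _ _)) andbT.
by rewrite -[X in (_ <= X)%N]h rk_mono // setUS // subset_closure.
Qed.

Lemma closure_min A F : flat F -> A \subset F -> closure A \subset F.
Proof. by move=> /eqP {2}<-; apply: closureS. Qed.

Lemma rk0 : rk M set0 = 0%N.
Proof. by apply/eqP; rewrite -leqn0 -(@cards0 E) rk_le_card. Qed.

Lemma flat0 : flat set0.
Proof.
by apply/eqP/setP => e; rewrite !inE setU0 rk_loopless rk0.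
Qed.

Lemma flatT : flat [set: E].
Proof. by rewrite /flat eqEsubset subsetT subset_closure. Qed.

Lemma setT_neq0 : [set: E] != set0.
Proof. by rewrite -card_gt0 cardsT ground_nonempty. Qed.

Lemma closure1_sym e f : e \in closure [set f] -> f \in closure [set e].
Proof. by rewrite !inE setUC !rk_loopless. Qed.

Lemma factorsP G F H : reflect [/\ H \in G, H \subset F
    & forall H', H' \in G -> H \subset H' -> H' \subset F -> H' = H]
  (H \in factors G F).
Proof.
rewrite inE; apply: (iffP and3P) => [[h1 h2 /forall_inP h3]|[h1 h2 h3]]; split=> //.
  by move=> H' hG a b; have /implyP/(_ _)/eqP -> := h3 _ hG; rewrite ?a ?b.
by apply/forall_inP => H' hG; apply/implyP => /andP[a b]; rewrite (h3 H').
Qed.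

Lemma factorsT G F : F \in G -> factors G F = [set F].
Proof.
move=> FG; apply/setP => H; rewrite in_set1; apply/factorsP/eqP => [[_ HF h]|->].
  by rewrite [RHS]h.
by split=> // H' _ h1 h2; apply/eqP; rewrite eqEsubset h1 h2.
Qed.

Lemma factors_ex G F H : H \in G -> H \subset F ->
  exists2 H', H' \in factors G F & H \subset H'.
Proof.
move=> HG HF.
have [H' /maxsetP[/andP[h1 h2] h3] HH'] :
    {H' : {set E} | maxset (fun X => (X \in G) && (X \subset F)) H' & H \subset H'}.
  by apply: maxset_exists; rewrite HG.
exists H' => //; apply/factorsP; split=> // X XG a b.
by apply: h3 => //; rewrite XG b.
Qed.

Section Building.
Variable G : building_set.

Lemma bset_flat F : F \in bset G -> flat F.
Proof. by move=> /(proj1 (bset_building G))[]. Qed.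

Lemma bset_neq0 F : F \in bset G -> F != set0.
Proof. by move=> /(proj1 (bset_building G))[]. Qed.

Lemma factors_disjoint F H1 H2 e : flat F ->
  H1 \in factors G F -> H2 \in factors G F -> e \in H1 -> e \in H2 -> H1 = H2.
Proof.
move=> fF h1 h2 e1 e2; apply/eqP/negPn/negP => ne.
have [H1G H1F _] := factorsP _ _ _ h1; have [H2G H2F _] := factorsP _ _ _ h2.
have F0 : F != set0 by apply/set0Pn; exists e; apply: (subsetP H1F).
have [emb _] := proj2 (bset_building G) F fF F0.
have cl H : H \in bset G -> e \in H -> closure [set e] \subset H.
  by move=> HG eH; apply: closure_min; rewrite ?bset_flat ?sub1set.
pose a H0 H := if H == H0 then closure [set e] else set0 : {set E}.
have ha H0 : H0 \in bset G -> e \in H0 -> in_product G F (a H0).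
  move=> H0G eH0 H _; rewrite /a; case: eqP => [->|_].
    by rewrite flat_closure cl.
  by rewrite flat0 sub0set.
have ja H0 : H0 \in factors G F -> \bigcup_(H in factors G F) a H0 H = closure [set e].
  move=> h0; rewrite (bigD1 H0) //= /a eqxx big1 ?setU0 // => H /andP[_ /negPf ->].
  by [].
have [/(_ _)/(_ H1 h1) + _] := emb _ _ (ha _ H1G e1) (ha _ H2G e2).
rewrite /product_join !ja // subxx => /(_ isT).
rewrite /a eqxx (negPf ne) subset0 => /eqP h.
by have := subset_closure [set e]; rewrite h sub1set inE.
Qed.

Lemma factors_cover F e : flat F -> e \in F -> exists2 H, H \in factors G F & e \in H.
Proof.
move=> fF eF.
have F0 : F != set0 by apply/set0Pn; exists e.
have [_ onto] := proj2 (bset_building G) F fF F0.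
have [|a ha ja] := onto _ (flat_closure [set e]).
  by apply: closure_min; rewrite ?sub1set.
have [/exists_inP[H hH /set0Pn[f fa]]|no] :=
    boolP [exists H in factors G F, a H != set0].
  exists H => //; have [flaH aH] := ha _ hH.
  have : f \in closure [set e].
    rewrite -ja; apply: (subsetP (subset_closure _)).
    by apply/bigcupP; exists H.
  move/closure1_sym => h; apply: (subsetP aH).
  by apply: (subsetP (closure_min flaH _)) h; rewrite sub1set.
have : e \in closure [set e] by apply: (subsetP (subset_closure _)); rewrite set11.
rewrite -ja /product_join big1 => [|H hH]; first by rewrite (eqP flat0) inE.
by apply/eqP; move: no; rewrite negb_exists_in => /forall_inP/(_ H hH)/negPn.
Qed.

Lemma nestedP S : reflect
  [/\ {subset S <= bset G}, [set: E] \notin S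
    & forall T : {set {set E}}, T \subset S -> (1 < #|T|)%N -> antichain T ->
        closure (cover T) \notin bset G]
  (nested G S).
Proof.
apply: (iffP andP) => [[/subsetP h1 /forallP h2]|[h1 h2 h3]]; split.
- by move=> F /h1; rewrite !inE => /andP[].
- by apply/negP => /h1; rewrite !inE eqxx.
- by move=> T a b c; have /implyP := h2 T; apply; rewrite a b c.
- apply/subsetP => F FS; rewrite !inE h1 // andbT.
  by apply: contraNneq h2 => <-.
- by apply/forallP => T; apply/implyP => /and3P[]; apply: h3.
Qed.

Lemma nestedS S T : nested G S -> T \subset S -> nested G T.
Proof.
move=> /nestedP[h1 h2 h3] TS; apply/nestedP; split.
- by move=> F /(subsetP TS); apply: h1.
- by apply: contra h2; apply: (subsetP TS).
- by move=> U UT; apply: h3; apply: subset_trans TS.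
Qed.

Lemma nested0 : nested G set0.
Proof.
apply/nestedP; split=> [F||T]; rewrite ?inE // subset0 => /eqP ->.
by rewrite cards0.
Qed.

Lemma nested_disjoint S H1 H2 e : nested G S -> H1 \in S -> H2 \in S ->
  e \in H1 -> e \in H2 -> (H1 \subset H2) || (H2 \subset H1).
Proof.
move=> /nestedP[SG _ hS] h1 h2 e1 e2; apply/negPn/negP; rewrite negb_or => /andP[n12 n21].
pose T : {set {set E}} := [set H1; H2].
have F12 : closure (cover T) \notin bset G.
  apply: hS.
  - by apply/subsetP => H; rewrite !inE => /orP[] /eqP ->.
  - by rewrite cards2; case: eqP n12 => // ->; rewrite subxx.
  - apply/forall_inP => A; rewrite !inE => /orP[] /eqP -> ;
      apply/forall_inP => B; rewrite !inE => /orP[] /eqP -> ;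
      by rewrite ?eqxx ?implybT // ?(negPf n12) ?(negPf n21).
set F := closure (cover T) in F12.
have sub H : H \in T -> H \subset F.
  by move=> hT; apply: subset_trans (subset_closure _); apply: bigcup_sup.
have [|H1' hH1' s1] := factors_ex (SG _ h1) (sub H1 _); first by rewrite !inE eqxx.
have [|H2' hH2' s2] := factors_ex (SG _ h2) (sub H2 _); first by rewrite !inE eqxx orbT.
have eq12 := factors_disjoint (flat_closure _) hH1' hH2' (subsetP s1 _ e1) (subsetP s2 _ e2).
have [H1G H1F _] := factorsP _ _ _ hH1'.
move/negP: F12; apply; suff -> : F = H1' by [].
apply/eqP; rewrite eqEsubset H1F andbT; apply: closure_min; first exact: bset_flat.
by apply/bigcupsP => H; rewrite !inE => /orP[] /eqP -> //; rewrite eq12.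
Qed.

(* An element of F lying in no member of S strictly below F. *)
Lemma nested_private S F : nested G S -> F \in bset G ->
  exists2 e, e \in F & forall H, H \in S -> H \proper F -> e \notin H.
Proof.
move=> nS FG; have [SG _ hS] := nestedP _ nS.
pose Q := [set H in S | H \proper F].
pose T := [set H in Q | [forall H' in Q, (H \subset H') ==> (H == H')]].
have up H : H \in Q -> exists2 H', H' \in T & H \subset H'.
  move=> hQ; have [H' /maxsetP[h1 h3] HH'] :
      {H' : {set E} | maxset (fun X => X \in Q) H' & H \subset H'}.
    by apply: maxset_exists.
  exists H' => //; rewrite inE h1; apply/forall_inP => X XQ; apply/implyP => s.
  by rewrite (h3 X).
have TS : T \subset S by apply/subsetP => H; rewrite !inE => /andP[/andP[]].
have TF H : H \in T -> H \proper F by rewrite !inE => /andP[/andP[]].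
suff: cover T \proper F.
  case/properP => _ [e eF eT]; exists e => // H HS HF; apply: contra eT => eH.
  have [|H' H'T HH'] := up H; first by rewrite inE HS.
  by apply/bigcupP; exists H' => //; apply: (subsetP HH').
have cF : closure (cover T) \subset F.
  apply: closure_min; first exact: bset_flat.
  by apply/bigcupsP => H /TF/proper_sub.
rewrite properEneq (subset_trans (subset_closure _) cF) andbT; apply/eqP => eF.
have [|le1] := ltnP 1 #|T|.
  move=> /(hS _ TS); rewrite eF (eqP (bset_flat FG)) FG => /(_ _)/negP; apply => //.
  apply/forall_inP => A AT; apply/forall_inP => B BT.
  by move: AT; rewrite inE => /andP[_ /forall_inP]; apply; move: BT; rewrite inE => /andP[].
have [/cards0_eq T0|/eqP/cards1P[H TH]] : #|T| = 0%N \/ #|T| = 1%N.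
- by case: #|T| le1 => [|[]] //; [left|right].
- by have := bset_neq0 FG; rewrite -eF /cover T0 big_set0 eqxx.
- have : H \in T by rewrite TH set11.
  by move/TF; rewrite -eF TH /cover big_set1 properxx.
Qed.

End Building.

Definition gmax_set : {set {set E}} := [set F | flat F & F != set0].

Lemma gmax_building : is_building_set gmax_set.
Proof.
split=> [F|F fF F0]; first by rewrite inE => /andP[].
have FG : F \in gmax_set by rewrite inE fF.
rewrite /product_join /in_product (factorsT FG).
split=> [a b ha hb|X fX XF].
- rewrite !big_set1.
  have [fa _] := ha F (set11 _); have [fb _] := hb F (set11 _).
  rewrite (eqP fa) (eqP fb); split=> [h H|->//]; last exact: set11.
  by rewrite in_set1 => /eqP ->.
- exists (fun=> X) => [H|]; first by rewrite in_set1 => /eqP ->.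
  by rewrite big_set1 (eqP fX).
Qed.

Lemma gmax_full : [set: E] \in gmax_set.
Proof. by rewrite inE flatT setT_neq0. Qed.

Definition gmax : building_set := BuildingSet gmax_building gmax_full.

(* The smallest cone of the fan of G containing the cone of the flag S. *)
Definition carrier G S : {set {set E}} := \bigcup_(F in S) factors G F.

Lemma carrierS G S T : S \subset T -> carrier G S \subset carrier G T.
Proof. by move=> ST; apply/bigcupsP => F FS; apply: bigcup_sup; apply: (subsetP ST). Qed.

Lemma gmax_chain S F F' : nested gmax S -> F \in S -> F' \in S ->
  (F \subset F') || (F' \subset F).
Proof.
move=> /nestedP[SG _ hS] FS F'S; apply/negPn/negP; rewrite negb_or => /andP[n12 n21].
pose T : {set {set E}} := [set F; F'].
have /negP[] : closure (cover T) \notin gmax_set.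
  apply: hS.
  - by apply/subsetP => H; rewrite !inE => /orP[] /eqP ->.
  - by rewrite cards2; case: eqP n12 => // ->; rewrite subxx.
  - apply/forall_inP => A; rewrite !inE => /orP[] /eqP -> ;
      apply/forall_inP => B; rewrite !inE => /orP[] /eqP -> ;
      by rewrite ?eqxx ?implybT // ?(negPf n12) ?(negPf n21).
rewrite inE flat_closure /=; have := bset_neq0 (SG _ FS).
case/set0Pn => e eF; apply/set0Pn; exists e.
apply: (subsetP (subset_closure _)); apply/bigcupP; exists F => //.
by rewrite !inE eqxx.
Qed.

Lemma carrier_nested (G : building_set) S : nested gmax S -> nested G (carrier G S).
Proof.
move=> nS; have [SG TS _] := nestedP _ _ nS; apply/nestedP; split.
- by move=> H /bigcupP[F _ /factorsP[]].
- apply/negP => /bigcupP[F FS /factorsP[_ h _]]; move/negP: TS; apply.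
  by suff <- : F = setT by []; apply/eqP; rewrite eqEsubset subsetT.
move=> T TC T2 aT; apply/negP => cG.
have T0 : (0 < #|T|)%N by apply: ltn_trans T2.
pose idx H F := (F \in S) && (H \in factors G F).
have ex H : H \in T -> exists F, idx H F.
  by move=> /(subsetP TC)/bigcupP[F FS h]; exists F; rewrite /idx FS.
pose Q := [set F in S | [exists H in T, H \in factors G F]].
have [F0 F0Q] : exists F, F \in Q.
  have /card_gt0P[H HT] := T0; have [F /andP[FS h]] := ex H HT.
  by exists F; rewrite inE FS; apply/exists_inP; exists H.
pose F := [arg max_(X > F0 in Q) #|X|].
have [FQ Fmax] : F \in Q /\ forall X, X \in Q -> (#|X| <= #|F|)%N.
  by rewrite /F; case: arg_maxnP.
have FS : F \in S by move: FQ; rewrite inE => /andP[].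
have below H : H \in T -> H \subset F.
  move=> HT; have [X /andP[XS hX]] := ex H HT.
  have XQ : X \in Q by rewrite inE XS; apply/exists_inP; exists H.
  have [_ HX _] := factorsP _ _ _ hX; apply: subset_trans HX _.
  have /orP[//|FX] := gmax_chain nS XS FS.
  have /eqP -> // : F == X by rewrite eqEcard FX Fmax.
have fF : flat F by have := SG _ FS; rewrite inE => /andP[].
have cF : closure (cover T) \subset F.
  by apply: closure_min => //; apply/bigcupsP => H /below.
have [H HT hH] : exists2 H, H \in T & H \in factors G F.
  by move: FQ; rewrite inE => /andP[_ /exists_inP].
have [_ _ Hmax] := factorsP _ _ _ hH.
have Hc : H \subset closure (cover T).
  by apply: subset_trans (subset_closure _); apply: bigcup_sup.
have cH := Hmax _ cG Hc cF.
suff TH : T = [set H] by rewrite TH cards1 in T2.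
apply/setP => X; rewrite in_set1; apply/idP/eqP => [XT|->//].
have /forall_inP/(_ X XT)/forall_inP/(_ H HT)/implyP := aT.
move=> /(_ _)/eqP; apply; rewrite -cH.
by apply: subset_trans (subset_closure _); apply: bigcup_sup.
Qed.

End Matroid.

Section Toric.
Variables (k : fieldType) (E : finType) (M : loopless_matroid E).

(* The function field of the torus of N_E is the subfield of fractions of degree
   0 of the following field; all the rings and modules below live in it. *)
Definition ffield : fieldType := {fraction {mpoly k[#|E|]}}.

Definition coord (i : E) : ffield := tofrac 'X_(enum_rank i).

Definition monom (u : {ffun E -> int}) : ffield := \prod_i coord i ^ u i.

Definition pairing (u : {ffun E -> int}) (F : {set E}) : int := \sum_(i in F) u i.

(* Finite k-linear combinations of the monomials x^u, where u satisfies Q and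
   lies in the dual { u | sum of the u_i = 0 } of N_E. *)
Definition mspan (Q : {ffun E -> int} -> Prop) (f : ffield) : Prop :=
  exists s : seq (k * {ffun E -> int}),
    (forall c, c \in s -> pairing c.2 [set: E] = 0 /\ Q c.2) /\
    f = \sum_(c <- s) tofrac (c.1)%:MP * monom c.2.

(* The coordinate ring of the affine toric variety of cone(v_F : F in S). *)
Definition regular (S : {set {set E}}) : ffield -> Prop :=
  mspan (fun u => forall F, F \in S -> 0 <= pairing u F).

Lemma coord_neq0 i : coord i != 0.
Proof.
rewrite tofrac_eq0; apply/eqP => /(congr1 (mcoeff U_(enum_rank i))).
by rewrite mcoeffXU eqxx mcoeff0 => /eqP; rewrite oner_eq0.
Qed.

Lemma monomD u v : monom (u + v) = monom u * monom v.
Proof.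
rewrite /monom -big_split; apply: eq_bigr => i _ /=.
by rewrite ffunE expfzDr // coord_neq0.
Qed.

Lemma monom0 : monom 0 = 1.
Proof. by rewrite /monom big1 // => i _; rewrite ffunE expr0z. Qed.

Lemma pairingD u v F : pairing (u + v) F = pairing u F + pairing v F.
Proof. by rewrite /pairing -big_split; apply: eq_bigr => i _; rewrite ffunE. Qed.

Lemma pairingN u F : pairing (- u) F = - pairing u F.
Proof. by rewrite /pairing -sumrN; apply: eq_bigr => i _; rewrite ffunE. Qed.

Lemma pairing0 F : pairing 0 F = 0.
Proof. by rewrite /pairing big1 // => i _; rewrite ffunE. Qed.

Section Mspan.
Variable Q : {ffun E -> int} -> Prop.

Lemma mspan0 : mspan Q 0.
Proof. by exists [::]; rewrite big_nil. Qed.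

Lemma mspanD f g : mspan Q f -> mspan Q g -> mspan Q (f + g).
Proof.
move=> [s [hs ->]] [t [ht ->]]; exists (s ++ t); rewrite big_cat; split=> // c.
by rewrite mem_cat => /orP[/hs|/ht].
Qed.

Lemma mspanN f : mspan Q f -> mspan Q (- f).
Proof.
move=> [s [hs ->]]; exists [seq (- c.1, c.2) | c <- s]; split.
  by move=> c /mapP[d /hs h ->].
rewrite big_map -sumrN; apply: eq_bigr => c _ /=.
by rewrite mpolyCN tofracN mulNr.
Qed.

Lemma mspan_monom u : pairing u [set: E] = 0 -> Q u -> mspan Q (monom u).
Proof.
move=> u0 Qu; exists [:: (1, u)]; rewrite big_seq1 /= mpolyC1 tofrac1 mul1r.
by split=> // c; rewrite inE => /eqP ->.
Qed.

Lemma mspan_ind (P : ffield -> Prop) : P 0 -> (forall f g, P f -> P g -> P (f + g)) ->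
  (forall c u, pairing u [set: E] = 0 -> Q u -> P (tofrac c%:MP * monom u)) ->
  forall f, mspan Q f -> P f.
Proof.
move=> P0 PD PM f [s [hs ->]]; rewrite big_seq; elim/big_ind: _ => // c /hs[].
exact: PM.
Qed.
End Mspan.

Lemma mspanZ (Q : {ffun E -> int} -> Prop) c f : mspan Q f -> mspan Q (tofrac c%:MP * f).
Proof.
move=> [s [hs ->]]; exists [seq (c * d.1, d.2) | d <- s]; split.
  by move=> d /mapP[d' /hs h ->].
rewrite big_map mulr_sumr; apply: eq_bigr => d _ /=.
by rewrite mpolyCM tofracM mulrA.
Qed.

Lemma mspanM (Q Q' Q'' : {ffun E -> int} -> Prop) :
  (forall u v, Q u -> Q' v -> Q'' (u + v)) ->
  forall f g, mspan Q f -> mspan Q' g -> mspan Q'' (f * g).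
Proof.
move=> h f g hf hg; elim/mspan_ind: hf => [|f1 f2 h1 h2|c u u0 Qu].
- by rewrite mul0r; apply: mspan0.
- by rewrite mulrDl; apply: mspanD.
rewrite -mulrA; apply: mspanZ; elim/mspan_ind: hg => [|f1 f2 h1 h2|d v v0 Qv].
- by rewrite mulr0; apply: mspan0.
- by rewrite mulrDr; apply: mspanD.
rewrite mulrCA; apply: mspanZ; rewrite -monomD; apply: mspan_monom; last exact: h.
by rewrite pairingD u0 v0.
Qed.

Lemma mspan_sub (Q Q' : {ffun E -> int} -> Prop) :
  (forall u, Q u -> Q' u) -> forall f, mspan Q f -> mspan Q' f.
Proof. by move=> h f [s [hs ->]]; exists s; split=> // c /hs[a /h]. Qed.

Lemma regular_subring S : subring (regular S).
Proof.
split.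
- by rewrite -monom0; apply: mspan_monom => [|F _]; rewrite pairing0.
- by move=> a b ha hb; apply: mspanD => //; apply: mspanN.
- move=> a b; apply: mspanM => u v hu hv F FS; rewrite pairingD.
  by rewrite Num.Theory.addr_ge0 ?hu ?hv.
Qed.

Lemma regularS (S S' : {set {set E}}) : S' \subset S -> forall f, regular S f -> regular S' f.
Proof. by move=> h; apply: mspan_sub => u hu F /(subsetP h); apply: hu. Qed.

Lemma regular_carrier (G : building_set M) S : nested M (gmax M) S ->
  forall f, regular (carrier G S) f -> regular S f.
Proof.
move=> nS; apply: mspan_sub => u hu F FS.
have [SG _ _] := nestedP _ _ nS.
have fF : flat M F by have := SG _ FS; rewrite inE => /andP[].
have -> : pairing u F = \sum_(H in factors G F) pairing u H.
  rewrite /pairing (exchange_big_dep (mem F)) /=; last first.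
    by move=> H i /factorsP[_ /subsetP HF _]; apply: HF.
  apply: eq_bigr => i iF; have [H hH iH] := factors_cover G fF iF.
  rewrite (bigD1 H) /=; last by rewrite hH.
  rewrite big1 ?addr0 // => H' /andP[/andP[hH' iH'] /eqP[]].
  exact: (factors_disjoint fF hH' hH iH' iH).
apply: Num.Theory.sumr_ge0 => H hH; apply: hu.
by apply/bigcupP; exists F.
Qed.

Section Bundles.
Variable G : building_set M.

(* A vector bundle of rank n on X_{M,G}: on the affine chart of each cone, a
   finitely generated projective module, with localizations to the faces as
   gluing maps. As X_{M,G} is integral, the modules of sections are realized
   inside the n-dimensional generic fiber. *)
Record vbundle := VBundle {
  vrank : nat;
  sections : {set {set E}} -> 'rV[ffield]_vrank -> Prop;
  sections_proj : forall S, nested M G S -> proj_lattice (regular S) (sections S);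
  sections_loc : forall S S' : {set {set E}}, nested M G S -> S' \subset S ->
    forall p, sections S' p <-> lspan (regular S') (sections S) p }.

Arguments sections : clear implicits.

HB.instance Definition _ := gen_eqMixin vbundle.
HB.instance Definition _ := gen_choiceMixin vbundle.

Definition short_exact (V' V V'' : vbundle) : Prop :=
  exists f g, forall S, nested M G S ->
    exact_at (sections V' S) (sections V S) (sections V'' S) f g.

Lemma dual_bundle_proj (V : vbundle) S : nested M G S ->
  proj_lattice (regular S) (dual_lattice (regular S) (sections V S)).
Proof.
move=> nS; apply: dual_proj; [exact: regular_subring | exact: sections_proj].
Qed.

Lemma dual_bundle_loc (V : vbundle) (S S' : {set {set E}}) :
  nested M G S -> S' \subset S -> forall p,
  dual_lattice (regular S') (sections V S') p <->
  lspan (regular S') (dual_lattice (regular S) (sections V S)) p.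
Proof.
move=> nS S'S p; apply: ext_dual; try exact: regular_subring.
- exact: regularS.
- exact: sections_proj.
- exact: sections_loc.
Qed.

Definition dual_bundle (V : vbundle) : vbundle :=
  VBundle (@dual_bundle_proj V) (@dual_bundle_loc V).

Lemma tensor_bundle_proj (V W : vbundle) S : nested M G S ->
  proj_lattice (regular S)
    (lspan (regular S) (pure_tensor (sections V S) (sections W S))).
Proof.
move=> nS; apply: tens_proj; [exact: regular_subring | |]; exact: sections_proj.
Qed.

Lemma tensor_bundle_loc (V W : vbundle) (S S' : {set {set E}}) :
  nested M G S -> S' \subset S -> forall p,
  lspan (regular S') (pure_tensor (sections V S') (sections W S')) p <->
  lspan (regular S')
    (lspan (regular S) (pure_tensor (sections V S) (sections W S))) p.
Proof.
move=> nS S'S p; apply: ext_tens; try exact: regular_subring.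
- exact: regularS.
- exact: sections_loc.
- exact: sections_loc.
Qed.

Definition tensor_bundle (V W : vbundle) : vbundle :=
  VBundle (@tensor_bundle_proj V W) (@tensor_bundle_loc V W).

(* The rays of the fan are indexed by the elements of G other than E. *)
Definition nrays : nat := #|bset G :\ [set: E]|.
Definition ray (j : 'I_nrays) : {set E} := enum_val j.
Definition divisor := {ffun 'I_nrays -> int}.

(* Sections of O(sum_j D_j x_j) on the chart of S. *)
Definition line_sections (D : divisor) (S : {set {set E}}) (p : 'rV[ffield]_1) : Prop :=
  mspan (fun u => forall j, ray j \in S -> - D j <= pairing u (ray j)) (p 0 0).

Lemma nested_unimodular S (a : {set E} -> int) : nested M G S ->
  exists u, pairing u [set: E] = 0 /\ forall F, F \in S -> pairing u F = a F.
Proof.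
have [n] := ubnP #|S|; elim: n S => // n IH S; rewrite ltnS => leSn nS.
have [->|[F0 F0S]] := set_0Vmem S.
  by exists 0; rewrite pairing0; split=> // F; rewrite inE.
pose F := [arg max_(X > F0 in S) #|X|].
have [FS Fmax] : F \in S /\ forall X, X \in S -> (#|X| <= #|F|)%N.
  by rewrite /F; case: arg_maxnP.
have [SG TS _] := nestedP _ _ nS.
have [e1 e1F e1H] := nested_private nS (SG _ FS).
have [e0 _ e0H] := nested_private nS (bset_full G).
have {}e0H H : H \in S -> e0 \notin H.
  move=> HS; apply: e0H => //; rewrite properT.
  by apply: contraNneq TS => <-.
have {}e1H H : H \in S -> H != F -> e1 \notin H.
  move=> HS HF; apply/negP => e1H'.
  have /orP[HsF|FsH] := nested_disjoint nS HS FS e1H' e1F.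
    have pHF : H \proper F by rewrite properEneq HF.
    by move: (e1H _ HS pHF); rewrite e1H'.
  by move: HF; rewrite eq_sym eqEcard FsH Fmax.
have [||u [u0 hu]] := IH (S :\ F).
- by rewrite (leq_trans _ leSn) // [in X in (_ < X)%N](cardsD1 F) FS.
- by apply: nestedS nS _; apply: subsetDl.
pose d (e : E) c : {ffun E -> int} := [ffun i => (i == e)%:R * c].
have dE e X c : pairing (d e c) X = (e \in X)%:R * c.
  rewrite /pairing; under eq_bigr do rewrite ffunE.
  rewrite -mulr_suml; congr (_ * _).
  have [eX|eX] := boolP (e \in X).
    by rewrite (bigD1 e) //= eqxx big1 ?addr0 // => i /andP[_ /negPf ->].
  by rewrite big1 // => i iX; case: eqP => // ie; rewrite -ie iX in eX.
pose c := a F - pairing u F.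
exists (u + d e1 c - d e0 c); split.
  by rewrite !pairingD pairingN !dE !inE u0 !mul1r add0r subrr.
move=> H HS; rewrite !pairingD pairingN !dE (negPf (e0H _ HS)) mul0r subr0.
have [->|HF] := eqVneq H F; first by rewrite e1F mul1r /c addrC subrK.
by rewrite (negPf (e1H _ HS HF)) mul0r addr0 hu // !inE HF.
Qed.

Lemma line_local (D : divisor) S : nested M G S -> exists u,
  [/\ pairing u [set: E] = 0,
      forall S' : {set {set E}}, S' \subset S -> line_sections D S' (const_mx (monom u))
    & forall S' : {set {set E}}, S' \subset S -> forall p, line_sections D S' p ->
        regular S' (p 0 0 * monom (- u))].
Proof.
move=> nS.
pose a F := \sum_(j | ray j == F) - D j.
have ray_inj : injective ray := enum_val_inj.
have aE j : a (ray j) = - D j.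
  by rewrite /a (big_pred1 j) // => j'; rewrite (inj_eq ray_inj).
have [u [u0 hu]] := nested_unimodular a nS.
exists u; split=> // S' S'S.
- rewrite /line_sections mxE; apply: mspan_monom => // j jS.
  by rewrite hu ?aE //; apply: (subsetP S'S).
- move=> p hp; apply: (mspanM (Q' := fun v => v = - u)) hp _; last first.
    by apply: mspan_monom; rewrite ?pairingN ?u0 ?oppr0.
  move=> v _ hv -> F FS'; rewrite pairingD pairingN hu ?(subsetP S'S) //.
  have [SG TS _] := nestedP _ _ nS.
  have FS := subsetP S'S _ FS'.
  have FG : F \in bset G :\ [set: E].
    by rewrite !inE SG // andbT; apply: contraNneq TS => <-.
  have FE : ray (enum_rank_in FG F) = F by rewrite /ray enum_rankK_in.
  by rewrite -FE aE opprK -Num.Theory.lerBlDr sub0r hv // FE.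
Qed.

Lemma rV1E (p : 'rV[ffield]_1) u : p = (p 0 0 * monom (- u)) *: const_mx (monom u).
Proof.
apply/rowP => j; rewrite ord1 !mxE -mulrA -monomD addrC subrr monom0.
by rewrite mulr1.
Qed.

Lemma line_lin (D : divisor) S a p q : regular S a -> line_sections D S p ->
  line_sections D S q -> line_sections D S (a *: p + q).
Proof.
rewrite /line_sections !mxE => ha hp hq; apply: mspanD => //.
apply: mspanM ha hp => u v hu hv j jS; rewrite pairingD -[- D j]add0r.
by apply: Num.Theory.lerD; [apply: hu | apply: hv].
Qed.

Lemma line_bundle_proj (D : divisor) S : nested M G S ->
  proj_lattice (regular S) (line_sections D S).
Proof.
move=> nS; split.
- by rewrite /line_sections mxE; apply: mspan0.
- exact: line_lin.
have [u [u0 hu hp]] := line_local D nS.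
exists 1%N, (const_mx (monom u)), (const_mx (monom (- u))); split.
- apply/matrixP => i j; rewrite !mxE big_ord1 !mxE !ord1 -monomD addNr.
  by rewrite monom0.
- by move=> j; rewrite row_const; apply: hu.
- by move=> p lp j; rewrite !mxE big_ord1 !mxE; apply: hp.
Qed.

Lemma line_bundle_loc (D : divisor) (S S' : {set {set E}}) :
  nested M G S -> S' \subset S -> forall p,
  line_sections D S' p <-> lspan (regular S') (line_sections D S) p.
Proof.
move=> nS S'S p; have [u [u0 hu hp]] := line_local D nS.
split=> [lp|].
- rewrite [p](rV1E p u) -[X in lspan _ _ X]addr0; apply: lspan_lin.
  + exact: regular_subring.
  + exact: hp.
  + by apply: lspan_sub; [exact: regular_subring | exact: hu].
  + exact: lspan0.
- apply: lspan_min.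
  + exact: regular_subring.
  + by rewrite /line_sections mxE; apply: mspan0.
  + exact: line_lin.
  move=> q; apply: mspan_sub => v hv j jS'; apply: hv.
  exact: (subsetP S'S).
Qed.

Definition line_bundle (D : divisor) : vbundle :=
  VBundle (@line_bundle_proj D) (@line_bundle_loc D).

Inductive exact_relations : {freeg vbundle} -> Prop :=
| ExactRelation V' V V'' of short_exact V' V V'' :
    exact_relations (<< V >> - << V' >> - << V'' >>)
| ExactRelation0 : exact_relations 0
| ExactRelationB x y of exact_relations x & exact_relations y :
    exact_relations (x - y).

Definition exact_relation_pred : {pred {freeg vbundle}} :=
  fun x => `[< exact_relations x >].

Lemma exact_relation_closed : zmod_closed exact_relation_pred.
Proof.
split=> [|x y]; first by apply/asboolP; apply: ExactRelation0.
by move=> /asboolP hx /asboolP hy; apply/asboolP; apply: ExactRelationB.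
Qed.
HB.instance Definition _ := GRing.isZmodClosed.Build {freeg vbundle}
  exact_relation_pred exact_relation_closed.

Definition kgroup : zmodType := Quotient.quot exact_relation_pred.
Definition kclass (x : {freeg vbundle}) : kgroup :=
  \pi_(Quotient.quot exact_relation_pred)%qT x.

Lemma kclass_eqP x y : reflect (kclass x = kclass y) (`[< exact_relations (x - y) >]).
Proof.
have -> : `[< exact_relations (x - y) >] = (x - y \in exact_relation_pred) by [].
by rewrite Quotient.idealrBE; apply: eqP.
Qed.

Lemma kclass_repr (a : kgroup) : kclass (repr a) = a.
Proof. exact: reprK. Qed.

Lemma short_exact_split (V' V V'' : vbundle) :
  short_exact V' V V'' <-> exists f g, forall S, nested M G S ->
    exists r s, split_at (sections V' S) (sections V S) (sections V'' S) f g r s.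
Proof.
split=> -[f [g h]]; exists f, g => S nS;
  apply/(exact_splitP (regular_subring S)); try exact: sections_proj; exact: h.
Qed.

End Bundles.
Arguments sections {G} v S p : rename.

Section Pullback.
Variable G : building_set M.

(* On the chart of a flag S of flats, the pullback along
   X_{M,Gmax} -> X_{M,G} is the extension of scalars of the module of the
   chart of carrier G S. *)
Definition pull_sections (V : vbundle G) (S : {set {set E}}) :=
  lspan (regular S) (sections V (carrier G S)).
Arguments pull_sections : clear implicits.

Lemma pull_bundle_proj (V : vbundle G) S : nested M (gmax M) S ->
  proj_lattice (regular S) (pull_sections V S).
Proof.
move=> nS; apply: (ext_proj (A := regular (carrier G S))).
- exact: regular_subring.
- exact: regular_carrier.
- by apply: sections_proj; apply: carrier_nested.
Qed.

Lemma pull_bundle_loc (V : vbundle G) (S S' : {set {set E}}) :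
  nested M (gmax M) S -> S' \subset S -> forall p,
  pull_sections V S' p <-> lspan (regular S') (pull_sections V S) p.
Proof.
move=> nS S'S p; have nS' := nestedS nS S'S.
rewrite (lspan_lspan (regular_subring S) (regular_subring S') (regularS S'S)).
rewrite -(lspan_lspan (regular_subring (carrier G S')) (regular_subring S')
  (regular_carrier nS')).
have -> // : lspan (regular (carrier G S')) (sections V (carrier G S))
   = sections V (carrier G S').
apply: funext => q; apply: propext; symmetry; apply: sections_loc.
  exact: carrier_nested.
exact: carrierS.
Qed.

Definition pull_bundle (V : vbundle G) : vbundle (gmax M) :=
  VBundle (@pull_bundle_proj V) (@pull_bundle_loc V).

End Pullback.

Section Operations.
Variable G : building_set M.
Local Notation free G := {freeg (vbundle G)}.

Definition free_dual (x : free G) : free G :=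
  fglift (fun V => << dual_bundle V >>) x.
Definition free_tensor (x y : free G) : free G :=
  fglift (fun V => fglift (fun W => << tensor_bundle V W >>) y) x.
Definition free_pull (x : free G) : free (gmax M) :=
  fglift (fun V => << pull_bundle V >>) x.

(* Computed on representatives; see kdualE, ktensorE and kpullE for the
   independence of the choice. *)
Definition kdual (a : kgroup G) : kgroup G := kclass (free_dual (repr a)).
Definition ktensor (a b : kgroup G) : kgroup G :=
  kclass (free_tensor (repr a) (repr b)).
Definition kpull (a : kgroup G) : kgroup (gmax M) := kclass (free_pull (repr a)).

Definition kline (D : divisor G) : kgroup G := kclass << line_bundle D >>.

Lemma exact_relationsN (H : building_set M) (x : free H) :
  exact_relations x -> exact_relations (- x).
Proof. by rewrite -sub0r; apply: ExactRelationB; apply: ExactRelation0. Qed.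

Lemma exact_relationsD (H : building_set M) (x y : free H) :
  exact_relations x -> exact_relations y -> exact_relations (x + y).
Proof. by move=> hx hy; rewrite -[y]opprK; apply: ExactRelationB => //; apply: exact_relationsN. Qed.

Lemma exact_relationsZ (H : building_set M) (c : int) (x : free H) :
  exact_relations x -> exact_relations (c *: x).
Proof.
move=> hx; rewrite -[c]intz scaler_int.
have pos n : exact_relations (x *+ n).
  elim: n => [|n IH]; first exact: ExactRelation0.
  by rewrite mulrS; apply: exact_relationsD.
by case: c => n; rewrite ?NegzE ?mulrNz -pmulrn //; apply: exact_relationsN.
Qed.

Lemma fgliftB (H : building_set M) (op : vbundle G -> free H) x y :
  fglift op (x - y) = fglift op x - fglift op y.
Proof. exact: lift_is_additive. Qed.

Lemma fglift0 (H : building_set M) (op : vbundle G -> free H) : fglift op 0 = 0.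
Proof. by rewrite -(subrr 0) fgliftB subrr. Qed.

Lemma fgliftD (H : building_set M) (op : vbundle G -> free H) x y :
  fglift op (x + y) = fglift op x + fglift op y.
Proof. by rewrite -{1}[y]opprK -[- y]sub0r !fgliftB fglift0 sub0r opprK. Qed.

Lemma fgliftE (H : building_set M) (op : vbundle G -> free H) x :
  fglift op x = \sum_(V <- dom x) coeff V x *: op V.
Proof.
rewrite -{1}(freeg_sumE x); elim: (dom x) => [|V s IH].
  by rewrite !big_nil fglift0.
by rewrite !big_cons -IH fgliftD liftU.
Qed.

Lemma exact_relations_sum (H : building_set M) (s : seq (vbundle G))
    (F : vbundle G -> free H) :
  (forall V, exact_relations (F V)) -> exact_relations (\sum_(V <- s) F V).
Proof.
move=> h; elim/big_ind: _ => // [|x y]; first exact: ExactRelation0.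
exact: exact_relationsD.
Qed.

Lemma lift_relations (H : building_set M) (op : vbundle G -> free H) :
  (forall V' V V'', short_exact V' V V'' ->
     exact_relations (op V - op V' - op V'')) ->
  forall x, exact_relations x -> exact_relations (fglift op x).
Proof.
move=> h x; elim=> [V' V V'' ex||y z _ hy _ hz].
- by rewrite !fgliftB !liftU !scale1r; apply: h.
- by rewrite fglift0; apply: ExactRelation0.
- by rewrite fgliftB; apply: ExactRelationB.
Qed.

Lemma exact_dual (V' V V'' : vbundle G) : short_exact V' V V'' ->
  short_exact (dual_bundle V'') (dual_bundle V) (dual_bundle V').
Proof.
move=> /short_exact_split[f [g h]]; apply/short_exact_split.
exists g^T, f^T => S /h[r [s hs]]; exists s^T, r^T; exact: split_dual.
Qed.

Lemma exact_tensorl (V' V V'' W : vbundle G) : short_exact V' V V'' ->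
  short_exact (tensor_bundle V' W) (tensor_bundle V W) (tensor_bundle V'' W).
Proof.
move=> /short_exact_split[f [g h]]; apply/short_exact_split.
exists (f *t 1%:M), (g *t 1%:M) => S /h[r [s hs]].
exists (r *t 1%:M), (s *t 1%:M); exact: split_tensl.
Qed.

Lemma exact_tensorr (V' V V'' W : vbundle G) : short_exact V' V V'' ->
  short_exact (tensor_bundle W V') (tensor_bundle W V) (tensor_bundle W V'').
Proof.
move=> /short_exact_split[f [g h]]; apply/short_exact_split.
exists (1%:M *t f), (1%:M *t g) => S /h[r [s hs]].
exists (1%:M *t r), (1%:M *t s); exact: split_tensr.
Qed.

Lemma exact_pull (V' V V'' : vbundle G) : short_exact V' V V'' ->
  short_exact (pull_bundle V') (pull_bundle V) (pull_bundle V'').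
Proof.
move=> /short_exact_split[f [g h]]; apply/short_exact_split.
exists f, g => S nS; have [r [s hs]] := h _ (carrier_nested G nS).
exists r, s; exact: split_ext.
Qed.

Lemma kdualE x : kdual (kclass x) = kclass (free_dual x).
Proof.
apply/kclass_eqP/asboolP; rewrite -fgliftB; apply: lift_relations.
  by move=> V' V V'' /exact_dual/ExactRelation; rewrite addrAC.
by apply/asboolP/kclass_eqP; rewrite kclass_repr.
Qed.

Lemma repr_kclass (H : building_set M) (z : free H) :
  exact_relations (repr (kclass z) - z).
Proof. by apply/asboolP/kclass_eqP; rewrite kclass_repr. Qed.

Lemma ktensorE x y : ktensor (kclass x) (kclass y) = kclass (free_tensor x y).
Proof.
apply/kclass_eqP/asboolP.
set x' := repr (kclass x); set y' := repr (kclass y).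
suff : exact_relations ((free_tensor x' y' - free_tensor x y')
                        + (free_tensor x y' - free_tensor x y)).
  by rewrite addrA subrK.
apply: exact_relationsD.
- rewrite /free_tensor -fgliftB; apply: lift_relations; last exact: repr_kclass.
  move=> V' V V'' ex; rewrite !fgliftE -!sumrB; apply: exact_relations_sum => W.
  rewrite -!scalerBr; apply: exact_relationsZ; apply: ExactRelation.
  exact: exact_tensorl.
- rewrite /free_tensor !fgliftE -sumrB; apply: exact_relations_sum => V.
  rewrite -scalerBr -fgliftB; apply: exact_relationsZ; apply: lift_relations.
    by move=> W' W W'' ex; apply: ExactRelation; apply: exact_tensorr.
  exact: repr_kclass.
Qed.

Lemma kpullE x : kpull (kclass x) = kclass (free_pull x).
Proof.
apply/kclass_eqP/asboolP; rewrite -fgliftB; apply: lift_relations.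
  by move=> V' V V'' ex; apply: ExactRelation; apply: exact_pull.
exact: repr_kclass.
Qed.

End Operations.
End Toric.
Arguments sections {k E M G} v S p : rename.
Arguments pull_sections {k E M G} V S p : rename.

Section Chow.
Variables (R : comNzRingType) (E : finType) (M : loopless_matroid E).

Section Ring.
Variable G : building_set M.
Local Notation poly := {mpoly R[nrays G]}.

Inductive chow_generator : poly -> Prop :=
| NonNestedMonomial (J : {set 'I_(nrays G)}) of ~~ nested M G [set ray j | j in J] :
    chow_generator (\prod_(j in J) 'X_j)
| LinearForm (i i' : E) :
    chow_generator (\sum_(j | i \in ray j) 'X_j - \sum_(j | i' \in ray j) 'X_j).

Definition chow_ideal (p : poly) : Prop :=
  exists s : seq (poly * poly),
    (forall c, c \in s -> chow_generator c.2) /\ p = \sum_(c <- s) c.1 * c.2.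

Definition chow_ideal_pred : {pred poly} := fun p => `[< chow_ideal p >].

Lemma chow_ideal0 : chow_ideal 0.
Proof. by exists [::]; rewrite big_nil. Qed.

Lemma chow_idealMD (a p q : poly) : chow_ideal p -> chow_ideal q -> chow_ideal (a * p + q).
Proof.
move=> [s [hs ->]] [t [ht ->]]; exists ([seq (a * c.1, c.2) | c <- s] ++ t); split.
  by move=> c; rewrite mem_cat => /orP[/mapP[d /hs h ->]|/ht].
rewrite big_cat big_map mulr_sumr; congr (_ + _).
by apply: eq_bigr => c _; rewrite mulrA.
Qed.

Lemma chow_idealD (p q : poly) : chow_ideal p -> chow_ideal q -> chow_ideal (p + q).
Proof. by move=> hp hq; rewrite -[p]mul1r; apply: chow_idealMD. Qed.

Lemma chow_idealM (a p : poly) : chow_ideal p -> chow_ideal (a * p).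
Proof. by move=> hp; rewrite -[_ * _]addr0; apply: chow_idealMD => //; apply: chow_ideal0. Qed.

Lemma chow_ideal_gen (p : poly) : chow_generator p -> chow_ideal p.
Proof.
move=> hp; exists [:: (1, p)]; rewrite big_seq1 mul1r; split=> // c.
by rewrite inE => /eqP ->.
Qed.

Lemma chow_ideal_ind (P : poly -> Prop) : P 0 -> (forall p q, P p -> P q -> P (p + q)) ->
  (forall a p, P p -> P (a * p)) -> (forall p, chow_generator p -> P p) ->
  forall p, chow_ideal p -> P p.
Proof.
move=> P0 PD PM PG p [s [hs ->]]; rewrite big_seq; elim/big_ind: _ => // c /hs h.
by apply: PM; apply: PG.
Qed.

Lemma chow_ideal1 : ~ chow_ideal 1.
Proof.
move=> h; suff : (1 : poly).@[fun=> 0] = 0 by rewrite rmorph1 => /eqP; rewrite oner_eq0.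
elim/chow_ideal_ind: h => [|p q hp hq|a p hp|_ [J nJ|i i']].
- by rewrite rmorph0.
- by rewrite rmorphD /= hp hq addr0.
- by rewrite rmorphM /= hp mulr0.
- have /set0Pn[j jJ] : J != set0.
    by apply: contraNneq nJ => ->; rewrite imset0 nested0.
  by rewrite rmorph_prod (bigD1 j) //= mevalXU mul0r.
- by rewrite rmorphB !rmorph_sum !big1 ?subrr // => j _; exact: mevalXU.
Qed.

Lemma chow_ideal_closed : idealr_closed chow_ideal_pred.
Proof.
split; first by apply/asboolP; apply: chow_ideal0.
  by apply/asboolP; apply: chow_ideal1.
by move=> a p q /asboolP hp /asboolP hq; apply/asboolP; apply: chow_idealMD.
Qed.
HB.instance Definition _ := isIdealr.Build poly chow_ideal_pred chow_ideal_closed.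

Definition chow : comNzRingType := {ideal_quot chow_ideal_pred}.
Definition chow_class (p : poly) : chow := \pi_({ideal_quot chow_ideal_pred})%qT p.

Lemma chow_class_eqP p q : reflect (chow_class p = chow_class q) (`[< chow_ideal (p - q) >]).
Proof.
have -> : `[< chow_ideal (p - q) >] = (p - q \in chow_ideal_pred) by [].
by rewrite Quotient.idealrBE; apply: eqP.
Qed.

Lemma chow_class_repr (a : chow) : chow_class (repr a) = a.
Proof. exact: reprK. Qed.

Lemma chow_class_is_zmod_morphism : zmod_morphism chow_class.
Proof. exact: raddfB. Qed.

Lemma chow_class_is_monoid_morphism : monoid_morphism chow_class.
Proof. by split; [exact: rmorph1 | exact: rmorphM]. Qed.

HB.instance Definition _ := GRing.isZmodMorphism.Build poly chow chow_class
  chow_class_is_zmod_morphism.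
HB.instance Definition _ := GRing.isMonoidMorphism.Build poly chow chow_class
  chow_class_is_monoid_morphism.

(* The graded piece of degree d. *)
Definition chow_degree (d : nat) (a : chow) : Prop :=
  exists2 p : poly, p \is d.-homog & chow_class p = a.

Definition div_poly (D : divisor G) : poly := \sum_j (D j)%:~R *: 'X_j.
Definition div_class (D : divisor G) : chow := chow_class (div_poly D).

(* Multiplication by (-1)^d in degree d, computed on representatives. *)
Definition chow_dual (a : chow) : chow :=
  chow_class (repr a \mPo [tuple - 'X_j | j < nrays G]).

Lemma chow_dualE p : chow_dual (chow_class p) = chow_class (p \mPo [tuple - 'X_j | j < nrays G]).
Proof.
apply/chow_class_eqP/asboolP; rewrite -rmorphB /=.
have : chow_ideal (repr (chow_class p) - p).
  by apply/asboolP/chow_class_eqP; rewrite chow_class_repr.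
move: (_ - p) => z; elim/chow_ideal_ind=> [|q r hq hr|a q hq|_ [J nJ|i i']].
- by rewrite rmorph0; apply: chow_ideal0.
- by rewrite rmorphD; apply: chow_idealD.
- by rewrite rmorphM; apply: chow_idealM.
- rewrite rmorph_prod /=.
  under eq_bigr => j _ do rewrite comp_mpolyXU -tnth_nth tnth_mktuple.
  by rewrite prodrN; apply: chow_idealM; apply: chow_ideal_gen; constructor.
- rewrite rmorphB !rmorph_sum /=.
  have e i0 : \sum_(j | i0 \in ray j) ('X_j \mPo [tuple - 'X_j | j < nrays G])
     = - \sum_(j : 'I_(nrays G) | i0 \in ray j) ('X_j : poly).
    rewrite -sumrN; apply: eq_bigr => j _.
    by rewrite comp_mpolyXU -tnth_nth tnth_mktuple.
  rewrite !e -opprD -mulN1r; apply: chow_idealM.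
  by apply: chow_ideal_gen; constructor.
Qed.

End Ring.

Section ChowPullback.
Variable G : building_set M.

(* The divisor x_H is the piecewise linear function with value 1 on v_H and 0 on
   the other rays, and v_F is the sum of the v_H for H in factors G F. *)
Definition pull_tuple : (nrays G).-tuple {mpoly R[nrays (gmax M)]} :=
  [tuple \sum_(f | ray j \in factors G (ray f)) 'X_f | j < nrays G].

Definition chow_pull (a : chow G) : chow (gmax M) :=
  chow_class (repr a \mPo pull_tuple).

Lemma rayP (H : building_set M) (j : 'I_(nrays H)) : ray j \in bset H /\ ray j != [set: E].
Proof. by have := enum_valP j; rewrite !inE => /andP[]. Qed.

Lemma chow_pullE p : chow_pull (chow_class p) = chow_class (p \mPo pull_tuple).
Proof.
apply/chow_class_eqP/asboolP; rewrite -rmorphB /=.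
have : chow_ideal (repr (chow_class p) - p).
  by apply/asboolP/chow_class_eqP; rewrite chow_class_repr.
have tE j : 'X_j \mPo pull_tuple = \sum_(f | ray j \in factors G (ray f)) 'X_f.
  by rewrite comp_mpolyXU -tnth_nth tnth_mktuple.
move: (_ - p) => z; elim/chow_ideal_ind=> [|q r hq hr|a q hq|_ [J nJ|i i']].
- by rewrite rmorph0; apply: chow_ideal0.
- by rewrite rmorphD; apply: chow_idealD.
- by rewrite rmorphM; apply: chow_idealM.
- rewrite rmorph_prod /=; under eq_bigr do rewrite tE.
  have /set0Pn[j1 j1J] : J != set0.
    by apply: contraNneq nJ => ->; rewrite imset0 nested0.
  have f1 : ray j1 \in bset (gmax M) :\ [set: E].
    have [h1 h2] := rayP j1.
    by rewrite !inE h2 (bset_flat h1) (bset_neq0 h1).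
  pose f0 : 'I_(nrays (gmax M)) := enum_rank_in f1 (ray j1).
  rewrite (big_distr_big_dep f0) /=.
  elim/big_ind: _ => [||phi /pfamilyP[_ hphi]]; first exact: chow_ideal0.
    exact: chow_idealD.
  pose T := [set phi j | j in J].
  have nT : ~~ nested M (gmax M) [set ray f | f in T].
    apply: contra nJ => /(carrier_nested G) h; apply: nestedS h _.
    apply/subsetP => _ /imsetP[j jJ ->]; apply/bigcupP; exists (ray (phi j)).
      by apply: imset_f; apply: imset_f.
    exact: hphi.
  rewrite (partition_big_imset phi) /=.
  have -> : \prod_(t in T) \prod_(j in J | phi j == t) 'X_(phi j)
     = (\prod_(t in T) ('X_t : {mpoly R[_]}) ^+ (#|[pred j in J | phi j == t]|).-1)
       * \prod_(t in T) 'X_t.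
    rewrite -big_split; apply: eq_bigr => t tT /=.
    rewrite -exprSr prednK; last first.
      apply/card_gt0P; have /imsetP[j jJ ->] := tT.
      by exists j; rewrite inE jJ /=.
    rewrite -prodr_const; apply: eq_big => j; first by rewrite inE.
    by move=> /andP[_ /eqP ->].
  by apply: chow_idealM; apply: chow_ideal_gen; constructor.
- rewrite rmorphB !rmorph_sum /=.
  have e i0 : \sum_(j | i0 \in ray j) ('X_j \mPo pull_tuple)
     = \sum_(f : 'I_(nrays (gmax M)) | i0 \in ray f) ('X_f : {mpoly R[_]}).
    under eq_bigr do rewrite tE.
    rewrite (exchange_big_dep (fun f => i0 \in ray f)) /=; last first.
      by move=> j f ij /factorsP[_ /subsetP h _]; apply: h.
    apply: eq_bigr => f if0.
    have [fG fT] := rayP f.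
    have ff : flat M (ray f) by rewrite inE in fG; case/andP: fG.
    have [H hH iH] := factors_cover G ff if0.
    have HG : H \in bset G :\ [set: E].
      have [h1 h2 _] := factorsP _ _ _ hH.
      rewrite !inE h1 andbT; apply: contraNneq fT => HT.
      by rewrite eqEsubset subsetT -HT.
    have HE : ray (enum_rank_in HG H) = H by rewrite /ray enum_rankK_in.
    rewrite (big_pred1 (enum_rank_in HG H)) // => j /=.
    apply/andP/eqP => [[ij hj]|->]; last by rewrite HE.
    apply: enum_val_inj; rewrite -[RHS]/(ray _) HE.
    exact: (factors_disjoint ff hj hH ij iH).
  by rewrite !e; apply: chow_ideal_gen; constructor.
Qed.

End ChowPullback.
End Chow.

Arguments chow R {E M} G.

Section Classes.
Variables (E : finType) (M : loopless_matroid E).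
Local Notation r := (rk M [set: E]).

Section Divisors.
Variable G : building_set M.

Definition xdiv (j : 'I_(nrays G)) : divisor G := [ffun j' => (j' == j)%:R].

(* Representatives of alpha and theta_F for each choice of i in E. *)
Definition alpha (i : E) : divisor G := [ffun j => (i \in ray j)%:R].
Definition theta (i : E) (j : 'I_(nrays G)) : divisor G :=
  alpha i - \sum_(h | ray j \subset ray h) xdiv h.

(* T_{M,G}, where << D >> stands for the class of O(D). *)
Definition tangent (i : E) : {freeg divisor G} :=
  r%:Z *: << alpha i >> - << 0 >>
  + \sum_j (<< xdiv j >> - << 0 >>
            + (rk M (ray j))%:Z *: (<< theta i j >> - << theta i j + xdiv j >>)).

Definition c1 (T : {freeg divisor G}) : divisor G :=
  \sum_(D <- dom T) D *~ coeff D T.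

(* The Chow ring vanishes in degrees >= r, so the power series below are
   truncated at degree r. *)
Definition chern_line (D : divisor G) : chow rat G :=
  chow_class (\sum_(m < r) m`!%:R^-1 *: div_poly rat D ^+ m).

(* The inverse (1 - exp(-D)) / D of the Todd class of O(D). *)
Definition inv_todd_line (D : divisor G) : chow rat G :=
  chow_class (\sum_(m < r) ((-1) ^+ m / m.+1`!%:R) *: div_poly rat D ^+ m).

(* The inverse of an element a with a - 1 nilpotent of order r. *)
Definition unipotent_inv (a : chow rat G) : chow rat G := \sum_(m < r) (1 - a) ^+ m.

Definition todd_line (D : divisor G) : chow rat G := unipotent_inv (inv_todd_line D).

(* The Todd class is multiplicative on virtual sums of line bundles. *)
Definition todd (T : {freeg divisor G}) : chow rat G :=
  \prod_(D <- dom T)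
    if 0 <= coeff D T then todd_line D ^+ `|coeff D T|%N
    else inv_todd_line D ^+ `|coeff D T|%N.

(* deg is the rational extension of an isomorphism degZ from the integral Chow
   group of degree r - 1 to the integers. *)
Definition is_degree_map (i : E) (deg : chow rat G -> rat) : Prop :=
  [/\ forall a b, deg (a + b) = deg a + deg b,
      forall (q : rat) a, deg (chow_class q%:MP * a) = q * deg a,
      forall m a, m <> r.-1 -> chow_degree m a -> deg a = 0,
      deg (div_class rat (alpha i) ^+ r.-1) = 1
    & exists degZ : chow int G -> int,
        [/\ forall p : {mpoly int[nrays G]}, p \is r.-1.-homog ->
              deg (chow_class (map_mpoly intr p)) = (degZ (chow_class p))%:~R,
            forall a b, chow_degree r.-1 a -> chow_degree r.-1 b ->
              degZ a = degZ b -> a = b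
          & forall m, exists2 a, chow_degree r.-1 a & degZ a = m]].

End Divisors.

Section ChernCharacter.
Variable k : fieldType.

(* The Chern characters of the varieties X_{M,G}, given by their standard
   properties. The line bundles generate the Grothendieck groups, so that these
   properties determine ch. *)
Definition is_chern_character
    (ch : forall G : building_set M, kgroup k G -> chow rat G) : Prop :=
  [/\ forall G a b, ch G (a + b) = ch G a + ch G b,
      forall G a b, ch G (ktensor a b) = ch G a * ch G b,
      forall G a, ch G (kdual a) = chow_dual (ch G a),
      forall G a, ch (gmax M) (kpull a) = chow_pull (ch G a)
    & forall G D, ch G (kline k D) = chern_line D].

Variable ch : forall G : building_set M, kgroup k G -> chow rat G.
Variables (i : E) (deg : chow rat (gmax M) -> rat).

Definition euler_gmax (b : kgroup k (gmax M)) : rat :=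
  deg (ch b * todd (tangent (gmax M) i)).

Definition euler (G : building_set M) (a : kgroup k G) : rat := euler_gmax (kpull a).

Definition omega (G : building_set M) : kgroup k G := kline k (- c1 (tangent G i)).

End ChernCharacter.
End Classes.

(* Main.v *)
From HB Require Import structures.
From mathcomp Require Import all_boot all_order all_algebra.
From mathcomp Require Import ring generic_quotient boolp freeg mpoly.
Require Import Defs.

Set Implicit Arguments.
Unset Strict Implicit.
Unset Printing Implicit Defensive.

Import GRing.Theory.
Local Open Scope ring_scope.

(* By Serre duality for line bundles, td(T)^vee = td(T) exp(-c_1(T)), the theorem
   follows once the Euler characteristic is given by the Todd class of T_{M,G}
   itself, that is, once
     deg (rho^* y . td(T_{M,Gmax})) = deg (rho^* y . rho^* td(T_{M,G})).
   All of this is an identity in the Chow ring of X_{M,Gmax}.  The flats missing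
   from G are adjoined one at a time, the largest first.  Adjoining F, with
   factors H_1, ..., H_s in G, is a blowup with center D_{H_1} ... D_{H_s}; with
   a = theta_F, b = theta_F + x_F and h_j = theta_{H_j}, it multiplies the Todd
   class exactly by td(b - a) prod_j td(a - h_j) / td(b - h_j), while
   (a - b) prod_j (a - h_j) = 0.  A residue computation with generic roots shows
   that this factor minus 1 is (b - a) times a polynomial of degree < s - 1 in a
   whose coefficients are pulled back from the center.  Such terms have degree 0
   because the center has dimension d - s.  *)

(** * Truncated power series modulo an element *)

(** Dualizing on X_{M,Gmax} directly would produce its own canonical class, which in general is not
    the pullback of [omega k i G]; this is why td(T_{M,Gmax}) must be traded for a pulled-back Todd
    class before dualizing. The two Todd classes differ in general and agree only in degree, against
    classes pulled back from X_{M,G}, so each comparison carries a multiplier whose restriction to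
    the exceptional divisor comes from the center ([base]). The residue computation cancels
    differences of Chern roots, which are nilpotent in the Chow ring. It is therefore made over
    Q[x_0, ..., x_s], a domain in which the roots are distinct variables, and then specialized. A
    further variable t, by which every root is scaled, separates the homogeneous parts. Cancelling a
    difference of two exponentials costs one factor t; hence series are truncated at r + 1, one
    degree further than the vanishing of the Chow ring asks for. *)

Section TruncatedSeries.
Variables (R : comNzRingType) (io : {rmorphism rat -> R}) (N : nat).
Implicit Types (g : nat -> rat) (x y z u v : R).

Definition pser g z : R := \sum_(m < N) io (g m) * z ^+ m.

(* The coefficients of exp(x), of (1 - exp(-x)) / x and of its inverse. *)
Definition expc (m : nat) : rat := m`!%:R^-1.
Definition itoddc (m : nat) : rat := (-1) ^+ m / m.+1`!%:R.

(** Each coefficient of the inverse power series depends on all the earlier ones, so their list is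
    carried along. The constant term of g is meant to be 1. *)
Fixpoint convinv_seq g (n : nat) : seq rat :=
  if n is n'.+1 then
    let s := convinv_seq g n' in
    rcons s ((n' == 0%N)%:R - \sum_(j < n') s`_j * g (n' - j)%N)
  else [::].
Definition convinv g (n : nat) : rat := (convinv_seq g n.+1)`_n.

Lemma size_convinv_seq g n : size (convinv_seq g n) = n.
Proof. by elim: n => //= n IH; rewrite size_rcons IH. Qed.

Lemma nth_convinv_seq g n j : (j < n)%N -> (convinv_seq g n)`_j = convinv g j.
Proof.
elim: n => // n IH; rewrite ltnS leq_eqVlt => /orP[/eqP -> //|jn].
by rewrite /= nth_rcons size_convinv_seq jn IH.
Qed.

Lemma convinvP g n : g 0%N = 1 ->
  \sum_(j < n.+1) convinv g j * g (n - j)%N = (n == 0%N)%:R.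
Proof.
move=> g0; rewrite big_ord_recr /= subnn g0 mulr1 {2}/convinv /=.
rewrite nth_rcons size_convinv_seq ltnn eqxx addrC.
under eq_bigr => j _ do rewrite nth_convinv_seq //.
by rewrite subrK.
Qed.

Definition toddc : nat -> rat := convinv itoddc.

Definition sexp := pser expc.
Definition stodd := pser toddc.
Definition sitodd := pser itoddc.

Variable th : R.
(* Congruence modulo th: 0 in the Chow ring, t^N for power series in t. *)
Definition eqm x y := exists c, x = y + th * c.

Lemma eqm_refl x : eqm x x.
Proof. by exists 0; rewrite mulr0 addr0. Qed.

Lemma eqm_sym x y : eqm x y -> eqm y x.
Proof. by move=> [c ->]; exists (- c); ring. Qed.

Lemma eqm_trans y x z : eqm x y -> eqm y z -> eqm x z.
Proof. by move=> [c ->] [d ->]; exists (c + d); ring. Qed.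

Lemma eqmD x x' y y' : eqm x x' -> eqm y y' -> eqm (x + y) (x' + y').
Proof. by move=> [c ->] [d ->]; exists (c + d); ring. Qed.

Lemma eqmN x y : eqm x y -> eqm (- x) (- y).
Proof. by move=> [c ->]; exists (- c); ring. Qed.

Lemma eqmB x x' y y' : eqm x x' -> eqm y y' -> eqm (x - y) (x' - y').
Proof. by move=> h h'; apply: eqmD => //; apply: eqmN. Qed.

Lemma eqmM x x' y y' : eqm x x' -> eqm y y' -> eqm (x * y) (x' * y').
Proof. by move=> [c ->] [d ->]; exists (c * y' + x' * d + th * c * d); ring. Qed.

Lemma eqmMl z x y : eqm x y -> eqm (z * x) (z * y).
Proof. by apply: eqmM; apply: eqm_refl. Qed.

Lemma eqm_sum0 (I : Type) (s : seq I) (P : pred I) (F : I -> R) :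
  (forall i, P i -> eqm (F i) 0) -> eqm (\sum_(i <- s | P i) F i) 0.
Proof.
move=> h; elim/big_rec: _ => [|i x Pi hx]; first exact: eqm_refl.
by rewrite -[0]addr0; apply: eqmD => //; apply: h.
Qed.

Lemma eqm_exp0 z m : eqm (z ^+ N) 0 -> (N <= m)%N -> eqm (z ^+ m) 0.
Proof.
move=> h /subnK <-; rewrite exprD -[0](mulr0 (z ^+ (m - N))).
exact: eqmMl.
Qed.

Lemma sum_ord_shift n i (F : nat -> R) :
  \sum_(m < n | (i <= m)%N) F (m - i)%N = \sum_(j < n | (i + j < n)%N) F j.
Proof.
rewrite -(big_mkord (fun m => (i <= m)%N) (fun m => F (m - i)%N)).
rewrite -(big_mkord (fun j => (i + j < n)%N) F).
have -> : \sum_(0 <= j < n | (i + j < n)%N) F j = \sum_(0 <= j < n - i) F j.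
  rewrite [RHS](big_nat_widen _ _ n) ?leq_subr //.
  by apply: eq_bigl => j; rewrite /= ltn_subRL.
have [h|h] := leqP n i.
  rewrite [RHS]big_geq ?(eqP h) // big_nat_cond big_pred0 // => m.
  by case: (ltnP m n) => //= mn; rewrite leqNgt (leq_trans mn h).
rewrite (@big_cat_nat _ _ _ i) ?(ltnW h) //= big_nat_cond big_pred0 ?add0r; last first.
  by move=> m; rewrite [(i <= m)%N]leqNgt /=; case: (m < i)%N.
rewrite -{1}[i]add0n big_addn.
by apply: eq_big => [m|m _]; rewrite ?leq_addl ?addnK.
Qed.

Lemma pser_mul2 g g' z z' :
  (forall i j, (N <= i + j)%N -> eqm (z ^+ i * z' ^+ j) 0) ->
  eqm (pser g z * pser g' z')
    (\sum_(m < N) \sum_(j < m.+1) io (g j * g' (m - j)%N) * (z ^+ j * z' ^+ (m - j))).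
Proof.
move=> hz; pose T i j := io (g i * g' j) * (z ^+ i * z' ^+ j).
have -> : pser g z * pser g' z' = \sum_(i < N) \sum_(j < N) T i j.
  rewrite /pser mulr_suml; apply: eq_bigr => i _; rewrite mulr_sumr.
  by apply: eq_bigr => j _; rewrite /T rmorphM /=; ring.
have -> : \sum_(i < N) \sum_(j < N) T i j =
    \sum_(i < N) \sum_(j < N | (i + j < N)%N) T i j +
    \sum_(i < N) \sum_(j < N | ~~ (i + j < N)%N) T i j.
  by rewrite -big_split; apply: eq_bigr => i _; rewrite (bigID (fun j : 'I_N => (i + j < N)%N)).
have -> : \sum_(m < N) \sum_(j < m.+1) io (g j * g' (m - j)%N) * (z ^+ j * z' ^+ (m - j))
   = \sum_(i < N) \sum_(j < N | (i + j < N)%N) T i j.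
  rewrite -/(T _ _).
  transitivity (\sum_(m < N) \sum_(i < N | (i <= m)%N) T i (m - i)%N).
    apply: eq_bigr => m _; rewrite (big_ord_widen _ (fun i => T i (m - i)%N) (ltn_ord m)).
    by apply: eq_bigl => i; rewrite ltnS.
  rewrite (exchange_big_dep xpredT) //=; apply: eq_bigr => i _.
  exact: (sum_ord_shift N i (T i)).
rewrite -[X in eqm _ X]addr0; apply: eqmD; first exact: eqm_refl.
apply: eqm_sum0 => i _; apply: eqm_sum0 => j; rewrite -leqNgt => h.
by rewrite /T -[0](mulr0 (io (g i * g' j))); apply: eqmMl; apply: hz.
Qed.

Lemma pser_mul g g' z : eqm (z ^+ N) 0 ->
  eqm (pser g z * pser g' z)
    (pser (fun m => \sum_(j < m.+1) g j * g' (m - j)%N) z).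
Proof.
move=> hz; apply: eqm_trans (pser_mul2 _ _ _) _.
  by move=> i j ij; rewrite -exprD; apply: eqm_exp0.
set x := (X in eqm X _); suff -> : x = pser (fun m => \sum_(j < m.+1) g j * g' (m - j)%N) z.
  exact: eqm_refl.
apply: eq_bigr => m _; rewrite rmorph_sum mulr_suml; apply: eq_bigr => j _.
by rewrite -exprD subnKC // -ltnS.
Qed.

Lemma pser_delta c z : (0 < N)%N -> pser (fun m => (m == 0%N)%:R * c) z = io c.
Proof.
rewrite /pser; case: N => // n _; rewrite big_ord_recl /= mul1r expr0 mulr1.
by rewrite big1 ?addr0 // => i _; rewrite mul0r rmorph0 mul0r.
Qed.

Lemma stodd_itodd z : (0 < N)%N -> eqm (z ^+ N) 0 -> eqm (stodd z * sitodd z) 1.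
Proof.
move=> N0 hz; apply: eqm_trans (pser_mul _ _ hz) _.
suff -> : pser (fun m => \sum_(j < m.+1) toddc j * itoddc (m - j)%N) z = 1.
  exact: eqm_refl.
rewrite -(rmorph1 io) -(pser_delta 1 z N0); apply: eq_bigr => m _.
by rewrite convinvP ?mulr1 // /itoddc expr0 mul1r fact0 invr1.
Qed.

Lemma fact_unit m : (m`!%:R : rat) != 0.
Proof. by rewrite Num.Theory.pnatr_eq0 -lt0n fact_gt0. Qed.

Lemma sexpD z z' :
  (forall i j, (N <= i + j)%N -> eqm (z ^+ i * z' ^+ j) 0) ->
  eqm (sexp z * sexp z') (sexp (z + z')).
Proof.
move=> hz; apply: eqm_trans (pser_mul2 _ _ hz) _.
suff -> : sexp (z + z') = \sum_(m < N) \sum_(j < m.+1)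
    io (expc j * expc (m - j)%N) * (z ^+ j * z' ^+ (m - j)) by exact: eqm_refl.
apply: eq_bigr => m _; rewrite [z + z']addrC exprDn mulr_sumr; apply: eq_bigr => j _.
rewrite -[X in _ * X]mulr_natr.
have jm : (j <= m)%N by rewrite -ltnS.
have -> : expc j * expc (m - j) = expc m * 'C(m, j)%:R.
  rewrite /expc -(bin_fact jm) !natrM; have := fact_unit j; have := fact_unit (m - j).
  have : ('C(m, j)%:R : rat) != 0 by rewrite Num.Theory.pnatr_eq0 -lt0n bin_gt0.
  by move=> h1 h2 h3; field; rewrite h1 h2 h3.
by rewrite rmorphM /= rmorph_nat; ring.
Qed.

(** Coefficientwise form of exp(x) (1 - exp(-x)) / x = (1 - exp(x)) / (-x). With factorials cleared
    it is the expansion of (1 - 1)^(m+1) = 0 without its first term. *)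
Lemma expc_itoddc m : \sum_(j < m.+1) itoddc j * expc (m - j)%N = (-1) ^+ m * itoddc m.
Proof.
rewrite /itoddc mulrA -exprMn mulrNN mulr1 expr1n mul1r.
have h : \sum_(j < m.+1) (-1) ^+ j * ('C(m.+1, j.+1)%:R : rat) = 1.
  have := @exprDn rat 1 (-1) m.+1; rewrite subrr expr0n /= big_ord_recl /=.
  rewrite expr1n mul1r bin0 expr0 mulr1n => /eqP; rewrite eq_sym addrC addr_eq0 => /eqP h.
  rewrite -[RHS]opprK -[X in _ = - X]h -sumrN; apply: eq_bigr => j _.
  by rewrite mulr_natr expr1n mul1r exprS mulN1r mulNrn opprK.
rewrite -[RHS]mul1r -[X in _ = X * _]h mulr_suml; apply: eq_bigr => j _.
have jm : (j < m.+1)%N by [].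
have := congr1 (fun n => n%:R : rat) (bin_fact jm); rewrite 2!natrM subSS /expc => <-.
have := fact_unit j.+1; have := fact_unit (m - j).
have : ('C(m.+1, j.+1)%:R : rat) != 0 by rewrite Num.Theory.pnatr_eq0 -lt0n bin_gt0.
move: (j.+1`!%:R : rat) ((m - j)`!%:R : rat) ((binomial _ _)%:R : rat) => a b c h1 h2 h3.
by field; rewrite h1 h2 h3.
Qed.

Lemma sitoddN z : eqm (z ^+ N) 0 -> eqm (sitodd (- z)) (sitodd z * sexp z).
Proof.
move=> hz; apply: eqm_sym; apply: eqm_trans (pser_mul _ _ hz) _.
set x := (X in eqm X _); suff -> : x = sitodd (- z) by exact: eqm_refl.
apply: eq_bigr => m _; rewrite expc_itoddc [in RHS]exprNn rmorphM /= rmorph_sign.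
by rewrite mulrCA mulrA.
Qed.

Lemma sexp0 : (0 < N)%N -> sexp 0 = 1.
Proof.
rewrite /sexp /pser; case: N => // n _; rewrite big_ord_recl /= expr0 mulr1 big1.
  by rewrite addr0 /expc fact0 invr1 rmorph1.
by move=> i _; rewrite expr0n mulr0.
Qed.

Lemma stodd0 : (0 < N)%N -> stodd 0 = 1.
Proof.
rewrite /stodd /pser; case: N => // n _; rewrite big_ord_recl /= expr0 mulr1 big1.
  by rewrite addr0 /toddc /convinv /= big_ord0 subr0 rmorph1.
by move=> i _; rewrite expr0n mulr0.
Qed.

Lemma sexpNV z : (0 < N)%N -> eqm (z ^+ N) 0 -> eqm (sexp z * sexp (- z)) 1.
Proof.
move=> N0 hz; rewrite -(sexp0 N0) -(subrr z); apply: sexpD => i j ij.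
rewrite exprNn mulrCA -exprD -[0](mulr0 ((-1) ^+ j)); apply: eqmMl.
exact: eqm_exp0.
Qed.

Lemma stoddN z : (0 < N)%N -> eqm (z ^+ N) 0 -> eqm (stodd (- z)) (stodd z * sexp (- z)).
Proof.
move=> N0 hz.
have hNz : eqm ((- z) ^+ N) 0.
  by rewrite exprNn -[0](mulr0 ((-1) ^+ N)); apply: eqmMl.
have h1 := stodd_itodd N0 hz; have h2 := stodd_itodd N0 hNz.
have h3 := sitoddN hz; have h4 := sexpNV N0 hz.
have /eqm_sym e : eqm (stodd (- z) * (stodd z * sitodd z) * (sexp z * sexp (- z))) (stodd (- z)).
  rewrite -[X in eqm _ X]mulr1 -[X in eqm _ (X * _)]mulr1.
  by apply: eqmM h4; apply: eqmMl.
apply: eqm_trans e _.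
have -> : stodd (- z) * (stodd z * sitodd z) * (sexp z * sexp (- z)) =
   stodd z * sexp (- z) * (stodd (- z) * (sitodd z * sexp z)) by ring.
rewrite -[X in eqm _ X]mulr1; apply: eqmMl; apply: eqm_trans h2.
by apply: eqmMl; apply: eqm_sym.
Qed.

Lemma sexp_itodd z : eqm (z ^+ N) 0 -> eqm (1 - sexp (- z)) (z * sitodd z).
Proof.
(* For N = 0 the hypothesis makes 1 a multiple of [th], so every congruence holds. Otherwise the two
   sides differ only by a term in z^N. *)
move=> hz; case: (posnP N) => [N0|N0].
  move: hz; rewrite N0 expr0 => -[c]; rewrite add0r => hc.
  by exists (c * (1 - sexp (- z) - z * sitodd z)); rewrite mulrA -hc mul1r; ring.
have e : z * sitodd z = \sum_(m < N) io (itoddc m) * z ^+ m.+1.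
  by rewrite mulr_sumr; apply: eq_bigr => m _; rewrite exprS mulrCA.
rewrite e /sexp /pser -(prednK N0) big_ord_recl [X in eqm _ X]big_ord_recr /=.
rewrite expr0 mulr1 /expc fact0 invr1 rmorph1 opprD addrA subrr add0r -sumrN.
apply: eqm_trans (eqm_refl _) _; rewrite -[X in eqm X _]addr0; apply: eqmD.
  set x := (X in eqm X _); set y := (Y in eqm _ Y); suff -> : x = y by exact: eqm_refl.
  apply: eq_bigr => m _; rewrite [in LHS]exprNn /itoddc rmorphM /= rmorph_sign /=.
  by rewrite [(-1) ^+ _.+1]exprS mulN1r; move: ((-1) ^+ m) => s; ring.
rewrite (prednK N0) -[X in eqm X _](mulr0 (io (itoddc N.-1))); apply: eqmMl.
exact: eqm_sym.
Qed.

(** td(-z) = td(z) exp(-z) and td(z) (1 - exp(-z)) = z. Reversing the sign of a root thus costs a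
    linear term, on which [divdiff_cons] can act. *)
Lemma stoddNB z : (0 < N)%N -> eqm (z ^+ N) 0 -> eqm (stodd (- z)) (stodd z - z).
Proof.
move=> N0 hz; apply: eqm_trans (stoddN N0 hz) _.
have -> : stodd z * sexp (- z) = stodd z - stodd z * (1 - sexp (- z)) by ring.
apply: eqmB; first exact: eqm_refl.
apply: (@eqm_trans (stodd z * (z * sitodd z))); first by apply: eqmMl; apply: sexp_itodd.
by rewrite mulrCA -[X in eqm _ X]mulr1; apply: eqmMl; apply: stodd_itodd.
Qed.

End TruncatedSeries.

(** * Divided differences and the Todd class of a projective bundle *)

Section DividedDifference.
Import Pdiv.CommonRing Pdiv.RingMonic.
Variable L : comNzRingType.
Implicit Types (l : seq L) (v w : {poly L}).

Definition rootpoly l : {poly L} := \prod_(h <- l) ('X - h%:P).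

(* The remainder interpolates v at the points of l. *)
Definition divdiff l v : L := (rmodp v (rootpoly l))`_(size l).-1.

Lemma rootpoly_monic l : rootpoly l \is monic.
Proof. by apply: monic_prod => h _; apply: monicXsubC. Qed.

Lemma size_rootpoly l : size (rootpoly l) = (size l).+1.
Proof. exact: size_prod_XsubC. Qed.

Lemma divdiffD l v w : divdiff l (v + w) = divdiff l v + divdiff l w.
Proof. by rewrite /divdiff rmodpD ?rootpoly_monic // coefD. Qed.

Lemma divdiffZ l c v : divdiff l (c%:P * v) = c * divdiff l v.
Proof. by rewrite /divdiff mul_polyC rmodpZ ?rootpoly_monic // coefZ. Qed.

Lemma divdiffN l v : divdiff l (- v) = - divdiff l v.
Proof. by rewrite /divdiff rmodpN ?rootpoly_monic // coefN. Qed.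

Lemma divdiff_perm l l' v : perm_eq l l' -> divdiff l v = divdiff l' v.
Proof. by move=> p; rewrite /divdiff /rootpoly (perm_big _ p) (perm_size p). Qed.

(** The remainder of (X - h) v by (X - h) p is X - h times the remainder of v by p, and the two have
    the same top coefficient. *)
Lemma divdiff_cons h h' l v :
  divdiff (h :: h' :: l) (('X - h%:P) * v) = divdiff (h' :: l) v.
Proof.
set l' := h' :: l; set p := rootpoly l'.
have mp : p \is monic := rootpoly_monic l'.
have sp : size p = (size l).+2 by rewrite size_rootpoly.
have sr : (size (rmodp v p) < size p)%N.
  by rewrite ltn_rmodpN0 // monic_neq0.
rewrite /divdiff; have -> : rootpoly (h :: l') = ('X - h%:P) * p by rewrite /rootpoly big_cons.
rewrite {1}(rdivp_eq mp v) mulrDr mulrCA.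
rewrite rmodp_addl_mul_small; last 2 first.
- by rewrite monicMl // monicXsubC.
- have -> : size (('X - h%:P) * p) = (size p).+1.
    by rewrite size_Mmonic ?polyXsubC_eq0 ?size_XsubC.
  by rewrite ltnS (leq_trans (size_polyMleq _ _)) // size_XsubC.
rewrite mulrBl coefB coefXM coefCM /=.
by rewrite [X in h * X]nth_default ?mulr0 ?subr0 // -ltnS -sp.
Qed.

Lemma divdiff1 h v : divdiff [:: h] v = v.[h].
Proof.
rewrite /divdiff /= /rootpoly big_seq1.
have := rdivp_eq (monicXsubC h) v; set r := rmodp _ _.
have sr : (size r <= 1)%N.
  by rewrite -ltnS -[X in (_ < X)%N](size_XsubC h) ltn_rmodpN0 ?monic_neq0 ?monicXsubC.
move=> ->; rewrite hornerD hornerM_comm ?/comm_poly 1?mulrC // hornerXsubC subrr mul0r add0r.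
by rewrite (size1_polyC sr) hornerC coefC.
Qed.

Lemma divdiff_eqm th l v w : eqm th%:P v w -> eqm th (divdiff l v) (divdiff l w).
Proof. by move=> [c ->]; exists (divdiff l c); rewrite divdiffD divdiffZ. Qed.

End DividedDifference.

(** * Residues with generic Chern roots *)

Section Universal.
Variables (S : idomainType) (io : {rmorphism rat -> S}) (N : nat).
Hypothesis N2 : (1 < N)%N.
Local Notation L := {poly S}.
Implicit Types (h : S) (l : seq S).

Let io1 : {rmorphism rat -> L} := polyC \o io.
Let io2 : {rmorphism rat -> {poly L}} := polyC \o io1.

(** The variable of [L] is the grading variable t, that of [{poly L}] is the interpolation variable
    u: this is t (u - h). *)
Definition tdiff h : {poly L} := ('X : L)%:P * ('X - h%:P%:P).
Definition toddprod l : {poly L} := \prod_(h <- l) stodd io2 N (tdiff h).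
Definition ptsC l : seq L := [seq h%:P | h <- l].

Local Notation thL := ('X^N : L).
Local Notation th2 := (thL%:P : {poly L}).

Lemma tdiff_nil h : eqm th2 (tdiff h ^+ N) 0.
Proof. by exists (('X - h%:P%:P) ^+ N); rewrite exprMn -rmorphXn add0r. Qed.

(** The difference of the two exponentials is t (c1 - c2) plus higher terms, and [S] is a domain:
    the coefficient of t^(m+1) reads (c1 - c2) y_m = 0 once the earlier coefficients of y are known
    to vanish. One power of t is lost. *)
Lemma cancel_exp (c1 c2 : S) (y : L) : c1 != c2 ->
  eqm thL (sexp io1 N ('X * c1%:P) * y) (sexp io1 N ('X * c2%:P) * y) ->
  eqm ('X^(N.-1)) y 0.
Proof.
move=> c12 [w hw].
have coefE c m : (sexp io1 N ('X * c%:P))`_m = if (m < N)%N then io (expc m) * c ^+ m else 0.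
  have -> : sexp io1 N ('X * c%:P) = \poly_(j < N) (io (expc j) * c ^+ j).
    rewrite poly_def; apply: eq_bigr => j _ /=.
    by rewrite exprMn -polyC_exp mulrCA -polyCM mulrC mul_polyC.
  by rewrite coef_poly.
have y0 m : (m < N.-1)%N -> y`_m = 0.
  elim/ltn_ind: m => m IH hm.
  have := congr1 (fun p : L => p`_m.+1) hw.
  rewrite coefD coefXnM; have -> : (m.+1 < N)%N by rewrite -ltn_predRL.
  rewrite addr0 !coefM !big_ord_recl /= !coefE.
  have z c : \sum_(i < m) (sexp io1 N ('X * c%:P))`_(bump 0 (bump 0 i)) *
      y`_(m.+1 - bump 0 (bump 0 i)) = 0.
    apply: big1 => i _; rewrite /bump /= !add1n subSS IH ?mulr0 //.
      by rewrite ltn_subrL (leq_trans _ (ltn_ord i)).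
    by rewrite (leq_ltn_trans (leq_subr _ _) hm).
  rewrite !z !addr0 /bump /= (ltnW N2) N2 subSS subn0 /expc !invr1 rmorph1 !mul1r !expr1.
  move=> /addrI/eqP; rewrite -subr_eq0 -mulrBl mulf_eq0 subr_eq0 (negPf c12).
  by rewrite subn0 => /eqP.
exists (drop_poly N.-1 y); rewrite add0r mulrC -[LHS](poly_take_drop N.-1).
suff -> : take_poly N.-1 y = 0 by rewrite add0r.
by apply/polyP => m; rewrite coef_take_poly coef0; case: ifP => // /y0.
Qed.

Lemma toddprod_cons h l : toddprod (h :: l) = stodd io2 N (tdiff h) * toddprod l.
Proof. by rewrite /toddprod big_cons. Qed.

(* The two assertions say that the Todd genus of a projective space is 1 and
   that the line bundle O(-1) has vanishing Euler characteristic, in the form of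
   residues along the fibres of a projective bundle with generic Chern roots. *)
Lemma divdiff_todd h l : uniq (h :: l) ->
  eqm 'X^(N.-1) (divdiff (ptsC (h :: l)) (toddprod (h :: l))) 'X^(size l) /\
  (l != [::] ->
   eqm 'X^(N.-1) (divdiff (ptsC (h :: l)) (stodd io2 N (- tdiff h) * toddprod l)) 0).
Proof.
have N0 : (0 < N)%N := ltnW N2.
have [n] := ubnP (size l); elim: n h l => // n IH h [|h' l]; rewrite ltnS.
  move=> _ _; split=> //; rewrite divdiff1 /toddprod big_seq1 /= expr0.
  suff -> : (stodd io2 N (tdiff h)).[h%:P] = 1 by exact: eqm_refl.
  rewrite -(stodd0 io1 N0) /stodd /pser horner_sum; apply: eq_bigr => m _.
  by rewrite hornerM horner_exp hornerM hornerXsubC subrr mulr0 hornerC.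
move=> hn u.
have hh' : h != h' by move: u => /= /andP[]; rewrite inE negb_or => /andP[].
have ul : uniq (h' :: l) by move: u => /andP[].
have ul' : uniq (h :: l).
  by move: u => /= /and3P[]; rewrite inE negb_or => /andP[_ ->] _ ->.
have pc : perm_eq [:: h', h & l] [:: h, h' & l].
  by apply/permPl; exact: (perm_catCA [:: h'] [:: h] l).
pose Z := divdiff (ptsC [:: h, h' & l]) (toddprod [:: h, h' & l]) - 'X^((size l).+1).
pose G x l' := stodd io2 N (- tdiff x) * toddprod l'.
(* By td(-z) = td(z) - z and [divdiff_cons], reversing the sign of one root subtracts t times the
   divided difference on one point fewer, known by induction. The result [Z] does not depend on
   which of the roots h and h' is reversed. *)
have GZ x y : perm_eq [:: x, y & l] [:: h, h' & l] -> uniq (y :: l) ->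
    eqm thL (divdiff (ptsC [:: h, h' & l]) (G x (y :: l))) Z.
  move=> pxy uy.
  apply: (@eqm_trans _ _ (divdiff (ptsC [:: h, h' & l])
      (toddprod [:: x, y & l] - tdiff x * toddprod (y :: l)))).
    apply: divdiff_eqm; rewrite toddprod_cons -mulrBl; apply: eqmM; last exact: eqm_refl.
    by apply: stoddNB => //; apply: tdiff_nil.
  rewrite divdiffD divdiffN; apply: eqmB.
    by rewrite /toddprod (perm_big _ pxy); apply: eqm_refl.
  rewrite -(divdiff_perm _ (perm_map _ pxy)) /tdiff -mulrA divdiffZ divdiff_cons exprS.
  have [[c ->] _] := IH y l hn uy.
  exists c; have -> : thL = 'X * 'X^(N.-1) by rewrite -exprS prednK.
  by rewrite mulrDr mulrA.
(* Multiplied by exp(-t x), [G x] becomes exp(-t u) times the full Todd product, which is symmetric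
   in the roots. *)
have Gh : eqm th2 (sexp io2 N (('X * (- h)%:P)%:P) * G h (h' :: l))
    (sexp io2 N (('X * (- h')%:P)%:P) * G h' (h :: l)).
  have ex x y : perm_eq [:: x, y & l] [:: h, h' & l] ->
      eqm th2 (sexp io2 N (('X * (- x)%:P)%:P) * G x (y :: l))
        (sexp io2 N (- (('X : L)%:P * 'X)) * toddprod [:: h, h' & l]).
    move=> pxy; rewrite /G mulrA.
    have -> : toddprod [:: h, h' & l] = toddprod [:: x, y & l].
      by apply: perm_big; rewrite perm_sym.
    rewrite [toddprod (x :: _)]toddprod_cons mulrA; apply: eqmM; last exact: eqm_refl.
    apply: (@eqm_trans _ _ (sexp io2 N (('X * (- x)%:P)%:P) *
        (stodd io2 N (tdiff x) * sexp io2 N (- tdiff x)))).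
      by apply: eqmMl; apply: stoddN => //; apply: tdiff_nil.
    rewrite mulrCA mulrC; apply: eqmM; last exact: eqm_refl.
    have -> : - (('X : L)%:P * 'X) = ('X * (- x)%:P)%:P + - tdiff x.
      by rewrite /tdiff polyCM !polyCN; ring.
    apply: sexpD => i j ij.
    have -> : (('X * (- x)%:P)%:P : {poly L}) = 'X%:P * (- x)%:P%:P by rewrite polyCM.
    rewrite /tdiff -mulrN !exprMn mulrACA -exprD -(subnKC ij) exprD.
    exists ('X%:P ^+ (i + j - N) * ((- x)%:P%:P ^+ i * (- ('X - x%:P%:P)) ^+ j)).
    by rewrite add0r rmorphXn /= !mulrA.
  apply: eqm_trans (ex h h' (perm_refl _)) _; apply: eqm_sym; apply: ex.
  exact: pc.
(* Hence exp(-t h) Z and exp(-t h') Z agree modulo t^N, which forces Z to vanish modulo t^(N-1). *)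
have Z0 : eqm 'X^(N.-1) Z 0.
  apply: (@cancel_exp (- h) (- h')); first by rewrite eqr_opp.
  have expC x : sexp io2 N (('X * (- x)%:P)%:P) = (sexp io1 N ('X * (- x)%:P))%:P.
    rewrite /sexp /pser rmorph_sum; apply: eq_bigr => m _.
    by rewrite [RHS]rmorphM /= polyC_exp.
  have Gd x y : perm_eq [:: x, y & l] [:: h, h' & l] -> uniq (y :: l) ->
      eqm thL (sexp io1 N ('X * (- x)%:P) * Z)
        (divdiff (ptsC [:: h, h' & l]) (sexp io2 N (('X * (- x)%:P)%:P) * G x (y :: l))).
    move=> pxy uy; rewrite expC divdiffZ; apply: eqmMl; apply: eqm_sym; exact: GZ.
  apply: eqm_trans (Gd h h' (perm_refl _) ul) _.
  apply: eqm_trans (divdiff_eqm _ Gh) _; apply: eqm_sym; apply: Gd => //.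
split=> [|_].
  by move: Z0 => [c /eqP]; rewrite add0r subr_eq addrC => /eqP ->; exists c.
apply: (@eqm_trans _ _ Z) => //.
have [c ->] := GZ h h' (perm_refl _) ul.
exists (c * 'X); have -> : thL = 'X * 'X^(N.-1) by rewrite -exprS prednK.
by congr (_ + _); ring.
Qed.
End Universal.

Lemma rmorph_pser (R R' : comNzRingType) (io : {rmorphism rat -> R})
    (io' : {rmorphism rat -> R'}) (phi : {rmorphism R -> R'}) N g z :
  (forall q, phi (io q) = io' q) -> phi (pser io N g z) = pser io' N g (phi z).
Proof.
move=> h; rewrite rmorph_sum; apply: eq_bigr => m _.
by rewrite rmorphM rmorphXn h.
Qed.

(** * Specialization of the generic residue identity *)

Section Specialize.
Import Pdiv.CommonRing Pdiv.RingMonic.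
Variables (R : comNzRingType) (io : {rmorphism rat -> R}) (N : nat).
Hypothesis N2 : (1 < N)%N.
Variables (a b : R) (l : seq R).
Hypothesis l0 : (0 < size l)%N.
Hypothesis root_a : (a - b) * \prod_(h <- l) (a - h) = 0.
Let io' : {rmorphism rat -> {poly R}} := polyC \o io.

Variables (C Q : R -> Prop).
Hypotheses (C_io : forall q, C (io q)) (CD : forall x y, C x -> C y -> C (x + y))
  (CM : forall x y, C x -> C y -> C (x * y)) (Cb : C b) (Cl : forall h, h \in l -> C h).
Hypotheses (Q0 : Q 0) (QD : forall x y, Q x -> Q y -> Q (x + y))
  (Qa : forall k c, (k < (size l).-1)%N -> C c -> Q ((a - b) * a ^+ k * c)).

(** Both products are values of one polynomial [G0], at a and at b (where td(0) = 1). Both points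
    are roots of the specialized [p], so [G0] may be replaced by its remainder modulo [p]. Its top
    coefficient is a divided difference that vanishes, which leaves multiples of a^k - b^k with k <
    size l. [C] will be the classes coming from the center, [Q] those of degree 0 against them. *)
Lemma todd_specialize m : (m < N.-1)%N ->
  Q (stodd io' N ('X * (b - a)%:P) * \prod_(h <- l) stodd io' N ('X * (a - h)%:P)
     - \prod_(h <- l) stodd io' N ('X * (b - h)%:P))`_m.
Proof.
move=> mN; pose n := size l.
(* One variable for b and one for each position in [l], so that the roots are distinct even where
   the entries of [l] coincide. *)
pose S : idomainType := {mpoly rat[n.+1]}.
pose ioS : {rmorphism rat -> S} := @mpolyC n.+1 rat.
pose pt (i : 'I_n.+1) : R := nth 0 (b :: l) i.
pose sg : {rmorphism S -> R} := mmap io pt.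
pose x0 : S := 'X_ord0.
pose xs : seq S := [seq 'X_(fintype.lift ord0 i) | i <- enum 'I_n].
have sgX (i : 'I_n.+1) : sg 'X_i = pt i by rewrite /sg /= mmapX mmap1U.
have sgio q : sg (ioS q) = io q by rewrite /sg /= mmapC.
have sxs : size xs = n by rewrite size_map size_enum_ord.
have uxs : uniq (x0 :: xs).
  have -> : x0 :: xs = [seq 'X_i | i <- enum 'I_n.+1] by rewrite enum_ordSl /= -map_comp.
  rewrite map_inj_uniq ?enum_uniq // => i j /(congr1 (mcoeff U_(j))).
  by rewrite !mcoeffXU eqxx; case: eqP => // _ /eqP; rewrite eq_sym oner_eq0.
have sgxs : [seq sg x | x <- xs] = l.
  rewrite -map_comp -[RHS](mkseq_nth 0) /mkseq -val_enum_ord -map_comp.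
  by apply: eq_map => i /=; rewrite [LHS]sgX.
have Csg c : C (sg c).
  have Cp i : C (pt i).
    rewrite /pt; have /mem_nth : (i < size (b :: l))%N by [].
    by move=> /(_ 0); rewrite inE => /orP[/eqP ->|/Cl].
  have C0 : C 0 by rewrite -(rmorph0 io).
  have C1 : C 1 by rewrite -(rmorph1 io).
  have CX x k : C x -> C (x ^+ k).
    by move=> h; elim: k => [|k IH]; rewrite ?expr0 // exprS; apply: CM.
  rewrite /sg /= /mmap; elim/big_ind: _ => // mo _; apply: CM => //.
  rewrite /mmap1; elim/big_ind: _ => // i _; exact: CX.
pose ev (u : R) : {rmorphism {poly {poly S}} -> {poly R}} :=
  horner_eval u%:P \o map_poly (map_poly sg).
have evP u (v : {poly {poly S}}) K : (size v <= K)%N -> ev u v = \sum_(k < K) map_poly sg v`_k * (u ^+ k)%:P.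
  move=> vK; rewrite /ev /= /horner_eval (@horner_coef_wide _ K).
    by apply: eq_bigr => k _; rewrite coef_map polyC_exp.
  by rewrite (leq_trans (size_poly _ _)).
have evX u : ev u 'X = u%:P by rewrite /ev /= /horner_eval map_polyX hornerX.
have evC u c : ev u c%:P = map_poly sg c by rewrite /ev /= /horner_eval map_polyC hornerC.
have ev_td u x : ev u (tdiff x) = 'X * (u - sg x)%:P.
  by rewrite /tdiff rmorphM rmorphB evX !evC map_polyX map_polyC /= -polyCB.
pose io1 : {rmorphism rat -> {poly S}} := polyC \o ioS.
pose io2 : {rmorphism rat -> {poly {poly S}}} := polyC \o io1.
have ev_f u z : ev u (stodd io2 N z) = stodd io' N (ev u z).
  by apply: rmorph_pser => q; rewrite [io2 q]/= evC map_polyC /= [mmap _ _ _]sgio.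
pose G0 := stodd io2 N (- tdiff x0) * toddprod ioS N xs.
pose p := rootpoly (ptsC (x0 :: xs)).
have ev_p u : (u - b) * \prod_(h <- l) (u - h) = 0 -> ev u p = 0.
  move=> h; have evl x : ev u ('X - x%:P%:P) = (u - sg x)%:P.
    by rewrite rmorphB evX evC map_polyC /= -polyCB.
  rewrite /p /rootpoly /ptsC big_map big_cons rmorphM rmorph_prod evl sgX.
  under eq_bigr => x _ do rewrite evl.
  rewrite -rmorph_prod -rmorphM -(big_map sg xpredT (fun h => u - h)) sgxs.
  by rewrite [pt _]/= h rmorph0.
have evG u : ev u G0 = stodd io' N ('X * (b - u)%:P) * \prod_(h <- l) stodd io' N ('X * (u - h)%:P).
  rewrite /G0 rmorphM ev_f rmorphN ev_td sgX -mulrN -polyCN opprB [pt _]/=; congr (_ * _).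
  rewrite /toddprod rmorph_prod -[in RHS]sgxs [RHS]big_map; apply: eq_bigr => x _.
  by rewrite ev_f ev_td.
pose rem := rmodp G0 p.
have mp : p \is monic by apply: rootpoly_monic.
(* The coefficient of degree n of the remainder is the divided difference at the n + 1 generic
   points, which [divdiff_todd] makes 0 below t^(N-1). *)
have top : (rem`_n)`_m = 0.
  have [_ []] := divdiff_todd ioS N2 uxs; first by rewrite -size_eq0 sxs -lt0n.
  move=> c; rewrite add0r /divdiff [size _]/= size_map sxs -/p -/rem => ->.
  by rewrite coefXnM mN.
have srem : (size rem <= n.+1)%N.
  rewrite -ltnS (leq_trans (_ : _ <= size p)%N) ?ltn_rmodpN0 ?monic_neq0 //.
  by rewrite size_rootpoly /= size_map sxs.
have evr u : (u - b) * \prod_(h <- l) (u - h) = 0 -> ev u G0 = ev u rem.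
  by move=> h; rewrite (rdivp_eq mp G0) rmorphD rmorphM (ev_p u h) mulr0 add0r.
have -> : \prod_(h <- l) stodd io' N ('X * (b - h)%:P) = ev b G0.
  by rewrite evG subrr mulr0 stodd0 ?mul1r // ltnW.
rewrite -evG !evr //; last by rewrite subrr mul0r.
rewrite coefB !(evP _ _ _ srem) !coef_sum -sumrB big_ord_recr /=.
rewrite !coefMC coef_map /= [X in mmap _ _ X]top [mmap _ _ 0]rmorph0 !mul0r subrr addr0.
(* a^k - b^k is (a - b) times the sum of the a^(k-1-i) b^i, and k < n bounds the exponent of a by n
   - 2, as [Qa] demands. *)
elim/big_ind: _ => // k _; rewrite !coefMC -mulrBr subrXX mulrCA mulr_sumr mulr_sumr.
elim/big_ind: _ => // i _; rewrite coef_map /=.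
set c := mmap _ _ _.
have -> : (a - b) * (c * (a ^+ (k.-1 - i) * b ^+ i)) = (a - b) * a ^+ (k.-1 - i) * (c * b ^+ i).
  by ring.
apply: Qa.
  rewrite (leq_ltn_trans (leq_subr _ _)) // ltn_predRL prednK ?ltn_ord //.
  exact: leq_ltn_trans (ltn_ord i).
apply: CM; first exact: Csg.
by elim: (nat_of_ord i) => [|j IH]; rewrite ?expr0 -?(rmorph1 io) // exprS; apply: CM.
Qed.
End Specialize.

(** * Ranks in a matroid with a building set *)

Section MatroidRank.
Variables (E : finType) (M : loopless_matroid E).
Implicit Types (A B F H K L : {set E}).

Lemma rk_flat_lt L L' : flat M L -> L \proper L' -> (rk M L < rk M L')%N.
Proof.
move=> /eqP fL /properP[LL' [e eL' eL]].
have ne : rk M (e |: L) != rk M L by move: eL; rewrite -{1}fL inE.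
apply: (@leq_trans (rk M (e |: L))).
  by rewrite ltn_neqAle eq_sym ne rk_mono // subsetUr.
by apply: rk_mono; rewrite subUset sub1set eL' LL'.
Qed.

Lemma flatI A B : flat M A -> flat M B -> flat M (A :&: B).
Proof.
move=> fA fB; rewrite /flat eqEsubset subset_closure andbT subsetI.
by rewrite (closure_min fA) ?subsetIl ?(closure_min fB) ?subsetIr.
Qed.

Lemma rkU A B : (rk M (A :|: B) <= rk M A + rk M B)%N.
Proof. exact: leq_trans (leq_addr _ _) (rk_submod M A B). Qed.

Lemma flat_coatom L : flat M L -> L != set0 ->
  exists K, [/\ flat M K, K \proper L & (rk M L <= (rk M K).+1)%N].
Proof.
move=> fL L0.
have [K /maxsetP[/andP[fK KL] Kmax] _] :
    {K | maxset (fun X => flat M X && (X \proper L)) K & set0 \subset K}.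
  by apply: maxset_exists; rewrite flat0 properEneq eq_sym L0 sub0set.
exists K; split=> //.
have [sKL [e eL eK]] := properP KL.
have eKL : e |: K \subset L by rewrite subUset sub1set eL.
have : closure M (e |: K) = L.
  apply/eqP; rewrite eqEsubset closure_min //=; apply/negPn/negP => nL.
  suff eq : closure M (e |: K) = K.
    by move: eK; rewrite -eq (subsetP (subset_closure _ _)) // setU11.
  apply: Kmax; first by rewrite flat_closure properE closure_min.
  exact: subset_trans (subsetUr _ _) (subset_closure _ _).
move=> <-; rewrite rk_closure (leq_trans (rkU _ _)) //.
by rewrite rk_loopless add1n.
Qed.

Variable G : building_set M.

(** Lowering one component to a coatom of its interval costs the sum at most one. By the order
    embedding the join then drops strictly, so its rank drops by at least one; induction on the sum
    concludes. *)
Lemma rk_product_join F (a : {set E} -> {set E}) : flat M F -> F != set0 ->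
  in_product M G F a ->
  (\sum_(H in factors G F) rk M (a H) <= rk M (product_join M G F a))%N.
Proof.
move=> fF F0; have [emb _] := proj2 (bset_building G) F fF F0.
have [n] := ubnP (\sum_(H in factors G F) rk M (a H)); elim: n a => // n IH a.
rewrite ltnS => an pa.
have [/exists_inP[H0 hH0 aH0]|] := boolP [exists H in factors G F, a H != set0]; last first.
  rewrite negb_exists_in => /forall_inP z; rewrite big1 // => H hH.
  by rewrite (eqP (negPn (z H hH))) rk0.
have [fa0 sa0] := pa _ hH0.
have [K [fK Ka Kr]] := flat_coatom fa0 aH0.
pose a' H := if H == H0 then K else a H.
have pa' : in_product M G F a'.
  move=> H hH; rewrite /a'; case: eqP => [->|_]; last exact: pa.
  by split=> //; apply: subset_trans (proper_sub Ka) sa0.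
have rest : \sum_(H in factors G F | H != H0) rk M (a' H) =
    \sum_(H in factors G F | H != H0) rk M (a H).
  by apply: eq_bigr => H /andP[_ /negPf h]; rewrite /a' h.
have sa' : \sum_(H in factors G F) rk M (a' H) =
    (rk M K + \sum_(H in factors G F | H != H0) rk M (a H))%N.
  by rewrite (bigD1 H0) //= rest /a' eqxx.
have sa : \sum_(H in factors G F) rk M (a H) =
    (rk M (a H0) + \sum_(H in factors G F | H != H0) rk M (a H))%N by rewrite (bigD1 H0).
have lt : (\sum_(H in factors G F) rk M (a' H) < \sum_(H in factors G F) rk M (a H))%N.
  by rewrite sa' sa ltn_add2r rk_flat_lt.
have IHa := IH a' (leq_trans lt an) pa'.
have pr : product_join M G F a' \proper product_join M G F a.
  rewrite properE; apply/andP; split.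
    apply/(emb _ _ pa' pa) => H hH; rewrite /a'; case: eqP => [->|_] //.
    exact: proper_sub.
  apply/negP => /(emb _ _ pa pa')/(_ _ hH0); rewrite /a' eqxx => h.
  by move: Ka; rewrite properE h andbF.
apply: leq_trans (rk_flat_lt (flat_closure _ _) pr).
by rewrite sa (leq_trans _ (leq_ltn_trans IHa (ltnSn _))) // sa' -addSn leq_add2r.
Qed.

(** One inequality is subadditivity of the rank; the other is [rk_product_join] for the largest
    element of the product of intervals. *)
Lemma rk_factors F : flat M F -> F != set0 ->
  (\sum_(H in factors G F) rk M H)%N = rk M F.
Proof.
move=> fF F0.
have cF : \bigcup_(H in factors G F) H = F.
  apply/eqP; rewrite eqEsubset; apply/andP; split.
    by apply/bigcupsP => H /factorsP[].
  apply/subsetP => e /(factors_cover G fF)[H hH eH].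
  by apply/bigcupP; exists H.
apply/eqP; rewrite eqn_leq; apply/andP; split.
  have pid : in_product M G F id.
    by move=> H /factorsP[/bset_flat].
  have := rk_product_join fF F0 pid.
  by rewrite /product_join cF rk_closure.
rewrite -[X in (rk M X <= _)%N]cF.
elim/big_rec2: _ => [|H n X _ h]; first by rewrite rk0.
by apply: leq_trans (rkU _ _) _; rewrite leq_add2l.
Qed.

End MatroidRank.

(** * Vanishing of long monomials on an interval of flats *)

Section Chains.
Variable E : finType.
Implicit Types (S T : {set {set E}}) (A B L P : {set E}).

Definition chain T : Prop := {in T &, forall A B, (A \subset B) || (B \subset A)}.

Lemma chain_max T A : chain T -> A \in T -> exists2 P, P \in T & forall L, L \in T -> L \subset P.
Proof.
move=> cT AT; pose P := [arg max_(X > A in T) #|X|].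
have [PT Pmax] : P \in T /\ forall X, X \in T -> (#|X| <= #|P|)%N by rewrite /P; case: arg_maxnP.
exists P => // L LT; have /orP[//|PL] := cT _ _ LT PT.
by have /eqP -> : P == L by rewrite eqEcard PL Pmax.
Qed.

Lemma chain_min T A : chain T -> A \in T -> exists2 P, P \in T & forall L, L \in T -> P \subset L.
Proof.
move=> cT AT; pose P := [arg min_(X < A in T) #|X|].
have [PT Pmin] : P \in T /\ forall X, X \in T -> (#|P| <= #|X|)%N by rewrite /P; case: arg_minnP.
exists P => // L LT; have /orP[LP|//] := cT _ _ LT PT.
by have /eqP -> : L == P by rewrite eqEcard LP Pmin.
Qed.

Lemma chain_setU1 T A : chain T -> (forall L, L \in T -> (A \subset L) || (L \subset A)) ->
  chain (A |: T).
Proof.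
move=> cT h X Y; rewrite !inE => /orP[/eqP ->|XT] /orP[/eqP ->|YT]; rewrite ?subxx //.
- exact: h.
- by rewrite orbC h.
- exact: cT.
Qed.

Lemma chain_sub T T' : T' \subset T -> chain T -> chain T'.
Proof. by move=> /subsetP h cT A B /h AT /h BT; apply: cT. Qed.

End Chains.

Section IntervalNilpotency.
Variables (E : finType) (M : loopless_matroid E) (A B : {set E}).
Hypotheses (fA : flat M A) (AB : A \proper B).
Variables (R : comNzRingType) (c : R) (y : {set E} -> R).
Implicit Types (L : {set E}) (S : {set {set E}}).

Definition between L : bool := [&& flat M L, A \proper L & L \proper B].

Hypotheses (yout : forall L, ~~ between L -> c * y L = 0)
  (ysr : forall L L', ~~ (L \subset L') -> ~~ (L' \subset L) -> c * (y L * y L') = 0)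
  (ylin : forall i j, i \in B :\: A -> j \in B :\: A ->
     c * (\sum_(L : {set E} | i \in L) y L) = c * (\sum_(L : {set E} | j \in L) y L)).

Lemma chain_rank S : chain S -> (forall L, L \in S -> between L) ->
  (#|S| < rk M B - rk M A)%N.
Proof.
move=> cS vS.
have rAB : (rk M A < rk M B)%N by apply: rk_flat_lt.
suff : (#|S| <= (rk M B - rk M A).-1)%N.
  by move=> h; rewrite (leq_ltn_trans h) // prednK // subn_gt0.
rewrite cardE -(size_map (rk M)).
rewrite -[X in (_ <= X)%N](size_iota (rk M A).+1); apply: uniq_leq_size.
  rewrite map_inj_in_uniq ?enum_uniq // => X Y; rewrite !mem_enum => XS YS eXY.
  have [fX _ _] := and3P (vS _ XS); have [fY _ _] := and3P (vS _ YS).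
  apply/eqP/negPn/negP => nXY.
  have /orP[h|h] := cS _ _ XS YS.
    by have := @rk_flat_lt _ M X Y fX; rewrite properEneq nXY h eXY ltnn => /(_ isT).
  by have := @rk_flat_lt _ M Y X fY; rewrite properEneq eq_sym nXY h eXY ltnn => /(_ isT).
move=> _ /mapP[L + ->]; rewrite mem_enum => /vS/and3P[fL AL LB].
rewrite mem_iota rk_flat_lt //= addSn -addnS prednK ?subn_gt0 // subnKC ?(ltnW rAB) //.
exact: rk_flat_lt.
Qed.

(** Induction on the word, with distinct comparable letters collected in the chain [S]. A letter
    outside [S] either enlarges the chain or kills the product; a letter already in [S] is
    exchanged, by a linear relation, for letters outside [S]. A chain that long does not exist. *)
Lemma interval_nil_chain l S : chain S -> (forall L, L \in S -> between L) ->
  (rk M B - rk M A <= #|S| + size l)%N ->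
  c * ((\prod_(L in S) y L) * \prod_(L <- l) y L) = 0.
Proof.
elim: l S => [|L l IH] S cS vS.
  by rewrite addn0 leqNgt chain_rank.
rewrite /= addnS => hn.
(* A new letter either vanishes against S or extends the chain. *)
have new L' : L' \notin S -> c * ((\prod_(L in S) y L) * y L' * \prod_(L <- l) y L) = 0.
  move=> nS; have [vL'|/yout z] := boolP (between L'); last first.
    by rewrite (_ : c * _ = c * y L' * ((\prod_(L in S) y L) * \prod_(L <- l) y L));
      [rewrite z mul0r | ring].
  have [/exists_inP[X XS /norP[n1 n2]]|] :=
      boolP [exists X in S, ~~ ((L' \subset X) || (X \subset L'))].
    rewrite (bigD1 X) //=.
    set p := \prod_(_ in _ | _) _; set q := \prod_(_ <- _) _.
    rewrite (_ : c * _ = c * (y L' * y X) * (p * q)); last by ring.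
    by rewrite ysr // mul0r.
  rewrite negb_exists_in => /forall_inP cmp.
  have {}cmp X : X \in S -> (L' \subset X) || (X \subset L') by move=> /cmp/negPn.
  have := IH (L' |: S) (chain_setU1 cS cmp).
  rewrite big_setU1 //= cardsU1 nS add1n addSn => h.
  rewrite [_ * y L']mulrC; apply: h => // X; rewrite !inE => /orP[/eqP -> //|].
  exact: vS.
rewrite big_cons [X in c * X]mulrA; have [LS|] := boolP (L \in S); last exact: new.
have [fL AL LB] := and3P (vS _ LS).
(* i lies in L but neither in A nor in a smaller member of [S]; j, chosen next, lies outside L but
   in B and in every larger member. In the relation for i and j, the terms containing j alone are
   incomparable with L, and among those containing i alone L is the only member of [S]. *)
have [i [iL iA iS]] : exists i, [/\ i \in L, i \notin A &
    forall X, X \in S -> X \proper L -> i \notin X].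
  pose T := A |: [set X in S | X \proper L].
  have cT : chain T.
    apply: chain_setU1.
      by apply: chain_sub cS; apply/subsetP => X; rewrite inE => /andP[].
    by move=> X; rewrite inE => /andP[/vS/and3P[_ /proper_sub ->]].
  have [P PT Pm] := chain_max cT (setU11 _ _).
  have /properP[_ [i iL iP]] : P \proper L.
    by move: PT; rewrite !inE => /orP[/eqP ->|/andP[]].
  exists i; split=> //; first by apply: contra iP; apply/subsetP/Pm; rewrite setU11.
  by move=> X XS XL; apply: contra iP; apply/subsetP/Pm; rewrite !inE XS XL orbT.
have [j [jB jL jS]] : exists j, [/\ j \in B, j \notin L &
    forall X, X \in S -> L \proper X -> j \in X].
  pose T := B |: [set X in S | L \proper X].
  have cT : chain T.
    apply: chain_setU1.
      by apply: chain_sub cS; apply/subsetP => X; rewrite inE => /andP[].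
    by move=> X; rewrite inE => /andP[/vS/and3P[_ _ /proper_sub ->]]; rewrite orbT.
  have [P PT Pm] := chain_min cT (setU11 _ _).
  have /properP[_ [j jP jL]] : L \proper P.
    by move: PT; rewrite !inE => /orP[/eqP ->|/andP[]].
  exists j; split=> //; first by apply/(subsetP _ _ jP)/Pm; rewrite setU11.
  by move=> X XS LX; apply/(subsetP _ _ jP)/Pm; rewrite !inE XS LX orbT.
have iBA : i \in B :\: A by rewrite inE iA (subsetP (proper_sub LB)).
have jBA : j \in B :\: A by rewrite inE jB andbT; apply: contra jL; apply/subsetP/proper_sub.
have lin := ylin iBA jBA.
pose p := (\prod_(X in S) y X) * \prod_(X <- l) y X.
have e : c * (\prod_(X in S) y X * y L * \prod_(X <- l) y X) = c * y L * p by rewrite /p; ring.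
have pL : exists q, p = y L * q.
  by exists (\prod_(X in S | X != L) y X * \prod_(X <- l) y X); rewrite /p (bigD1 L) //= mulrA.
have newp X : X \notin S -> c * y X * p = 0.
  by move=> /new; set u := c * _; rewrite (_ : c * y X * p = u) // /u /p; ring.
rewrite e; move: lin; rewrite (bigID (fun X : {set E} => j \in X)) /=.
rewrite [in RHS](bigID (fun X : {set E} => i \in X)) /=.
have -> : \sum_(X : {set E} | (j \in X) && (i \in X)) y X =
    \sum_(X : {set E} | (i \in X) && (j \in X)) y X by apply: eq_bigl => X; rewrite andbC.
rewrite !mulrDr => /addrI/(congr1 ( *%R^~ p)).
have -> : c * (\sum_(X : {set E} | (j \in X) && (i \notin X)) y X) * p = 0.
  rewrite mulr_sumr mulr_suml big1 // => X /andP[jX iX].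
  have [q ->] := pL; rewrite mulrA -[c * y X * y L]mulrA ysr ?mul0r //.
    by apply: contra jL => /subsetP; apply.
  by apply: contra iX => /subsetP; apply.
rewrite (bigD1 L) /=; last by rewrite iL jL.
rewrite mulrDr mulrDl mulr_sumr mulr_suml big1 ?addr0 // => X /andP[/andP[iX jX] XL].
have [XS|/newp //] := boolP (X \in S).
have /orP[h|h] := cS _ _ XS LS.
  by move: (iS X XS); rewrite properEneq XL h iX => /(_ isT).
by move: (jS X XS); rewrite properEneq eq_sym XL h (negPf jX) => /(_ isT).
Qed.

(** The factor c admits relations that hold only on a divisor: c is x_F for the interval from F to
    E, and 1 for the intervals from the empty flat to E or to a factor H. *)
Lemma interval_nil l : (rk M B - rk M A <= size l)%N -> c * \prod_(L <- l) y L = 0.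
Proof.
move=> h; have := @interval_nil_chain l set0.
rewrite big_set0 mul1r cards0; apply=> // [X Y|X]; by rewrite inE.
Qed.

End IntervalNilpotency.

(** * The Chow ring *)

Section ChowDegree.
Variables (E : finType) (M : loopless_matroid E) (G : building_set M).
Local Notation A := (chow rat G).
Implicit Types (a b : A).

Definition chow_const (q : rat) : A := chow_class q%:MP.

Lemma chow_const_is_zmod_morphism : zmod_morphism chow_const.
Proof. by move=> p q; rewrite /chow_const !rmorphB. Qed.

Lemma chow_const_is_monoid_morphism : monoid_morphism chow_const.
Proof. by split=> [|p q]; rewrite /chow_const ?rmorph1 // !rmorphM. Qed.

HB.instance Definition _ := GRing.isZmodMorphism.Build rat A chow_const
  chow_const_is_zmod_morphism.
HB.instance Definition _ := GRing.isMonoidMorphism.Build rat A chow_const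
  chow_const_is_monoid_morphism.

Lemma chow_degree0 d : chow_degree d (0 : A).
Proof. by exists 0; rewrite ?dhomog0 ?rmorph0. Qed.

Lemma chow_degreeD d a b : chow_degree d a -> chow_degree d b -> chow_degree d (a + b).
Proof. by move=> [p hp <-] [q hq <-]; exists (p + q); rewrite ?rmorphD // dhomogD. Qed.

Lemma chow_degreeM d e a b : chow_degree d a -> chow_degree e b -> chow_degree (d + e) (a * b).
Proof. by move=> [p hp <-] [q hq <-]; exists (p * q); rewrite ?rmorphM // dhomogM. Qed.

Lemma chow_degree_const q : chow_degree 0 (chow_const q).
Proof. by exists q%:MP => //; rewrite -alg_mpolyC dhomogZ // dhomog1. Qed.

Lemma chow_degreeZ d q a : chow_degree d a -> chow_degree d (chow_const q * a).
Proof. by move=> h; rewrite -[d]add0n; apply: chow_degreeM => //; apply: chow_degree_const. Qed.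

Lemma chow_degreeN d a : chow_degree d a -> chow_degree d (- a).
Proof. by rewrite -mulN1r -(rmorphN1 chow_const); apply: chow_degreeZ. Qed.

Lemma chow_degreeB d a b : chow_degree d a -> chow_degree d b -> chow_degree d (a - b).
Proof. by move=> ha hb; apply: chow_degreeD => //; apply: chow_degreeN. Qed.

Lemma chow_degree_sum d (I : Type) (s : seq I) (P : pred I) (F : I -> A) :
  (forall i, P i -> chow_degree d (F i)) -> chow_degree d (\sum_(i <- s | P i) F i).
Proof. by move=> h; elim/big_ind: _ => //; [apply: chow_degree0 | apply: chow_degreeD]. Qed.

Lemma chow_degreeX d a n : chow_degree d a -> chow_degree (d * n) (a ^+ n).
Proof.
move=> h; elim: n => [|n IH].
  by rewrite muln0 expr0 -(rmorph1 chow_const); apply: chow_degree_const.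
by rewrite exprS mulnS; apply: chow_degreeM.
Qed.

Lemma chow_degree_prod (I : Type) (s : seq I) (F : I -> A) :
  (forall i, chow_degree 1 (F i)) -> chow_degree (size s) (\prod_(i <- s) F i).
Proof.
move=> h; elim: s => [|i s IH].
  by rewrite big_nil -(rmorph1 chow_const); apply: chow_degree_const.
rewrite big_cons (_ : size _ = (1 + size s)%N) //; apply: chow_degreeM => //; exact: h.
Qed.

(* The class of x_F, with value 0 when x_F is not a variable. *)
Definition xc (F : {set E}) : A := \sum_(j : 'I_(nrays G) | ray j == F) chow_class 'X_j.

Lemma ray_inj : injective (@ray E M G).
Proof. exact: enum_val_inj. Qed.

Lemma xc_ray (j : 'I_(nrays G)) : xc (ray j) = chow_class 'X_j.
Proof. by rewrite /xc (big_pred1 j) // => j'; rewrite (inj_eq ray_inj). Qed.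

Lemma sum_xc (P : pred {set E}) (F : {set E} -> A) :
  \sum_(L | P L) F L * xc L = \sum_(j : 'I_(nrays G) | P (ray j)) F (ray j) * chow_class 'X_j.
Proof.
rewrite [RHS](partition_big (@ray E M G) P) //=; apply: eq_bigr => L PL.
rewrite /xc mulr_sumr; apply: eq_big => j; last by move=> /eqP ->.
by case: eqP => [->|]; rewrite ?PL ?andbF.
Qed.

Lemma sum_xc1 (P : pred {set E}) :
  \sum_(L | P L) xc L = \sum_(j : 'I_(nrays G) | P (ray j)) chow_class 'X_j.
Proof.
transitivity (\sum_(L | P L) 1 * xc L); first by apply: eq_bigr => L _; rewrite mul1r.
by rewrite (sum_xc _ (fun=> 1)); apply: eq_bigr => L _; rewrite mul1r.
Qed.

Lemma chow_degree_xc F : chow_degree 1 (xc F).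
Proof.
apply: chow_degree_sum => j _; exists 'X_j => //.
by rewrite dhomogX; apply/eqP; exact: mdeg1.
Qed.

Lemma xc_lin i j : \sum_(L : {set E} | i \in L) xc L = \sum_(L : {set E} | j \in L) xc L.
Proof.
rewrite !sum_xc1 -!rmorph_sum; apply/eqP; rewrite -subr_eq0 -rmorphB; apply/eqP.
rewrite -(rmorph0 (@chow_class rat E M G)); apply/chow_class_eqP/asboolP; rewrite subr0.
by apply: chow_ideal_gen; constructor.
Qed.

Lemma chow_class_X (m : 'X_{1..nrays G}) :
  exists2 l : seq {set E}, size l = mdeg m & chow_class 'X_[m] = \prod_(L <- l) xc L.
Proof.
rewrite mpolyXE_id rmorph_prod mdegE.
elim/big_rec2: _ => [|j a n _ [l <- ->]]; first by exists [::] => //; rewrite big_nil.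
exists (nseq (m j) (ray j) ++ l); first by rewrite size_cat size_nseq.
by rewrite big_cat big_nseq rmorphXn iter_mulr_1 xc_ray.
Qed.

Lemma chow_word_ind (P : A -> Prop) : P 0 -> (forall a b, P a -> P b -> P (a + b)) ->
  (forall q l, P (chow_const q * \prod_(L <- l) xc L)) -> forall a, P a.
Proof.
move=> P0 PD PW a; rewrite -(chow_class_repr a) [repr a]mpolyE rmorph_sum.
elim/big_ind: _ => // m _; rewrite -mul_mpolyC rmorphM.
by have [l _ e] := chow_class_X m; rewrite [X in P (_ * X)]e; apply: PW.
Qed.

Lemma chow_degree_word_ind d (P : A -> Prop) : P 0 -> (forall a b, P a -> P b -> P (a + b)) ->
  (forall q l, size l = d -> P (chow_const q * \prod_(L <- l) xc L)) ->
  forall a, chow_degree d a -> P a.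
Proof.
move=> P0 PD PW _ [p /dhomogP hp <-]; rewrite [p]mpolyE rmorph_sum big_seq.
elim/big_ind: _ => // m /hp hm; rewrite -mul_mpolyC rmorphM.
by have [l hl e] := chow_class_X m; rewrite [X in P (_ * X)]e; apply: PW; rewrite hl.
Qed.

Lemma chow_class_poly_ind (P : A -> Prop) (p : {mpoly rat[nrays G]}) :
  (forall q, P (chow_const q)) -> (forall a b, P a -> P b -> P (a + b)) ->
  (forall a b, P a -> P b -> P (a * b)) -> (forall j : 'I_(nrays G), P (xc (ray j))) ->
  P (chow_class p).
Proof.
move=> PC PD PM PX.
have P1 : P 1 by rewrite -(rmorph1 chow_const).
rewrite [p]mpolyE rmorph_sum.
elim/big_ind: _ => //; first by rewrite -(rmorph0 chow_const).
move=> m _; rewrite -mul_mpolyC rmorphM; apply: (PM); first exact: PC.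
rewrite mpolyXE_id rmorph_prod; apply: (big_ind P P1 PM) => j _; rewrite rmorphXn /= -xc_ray.
by elim: (m j) => [|k IH]; rewrite ?expr0 // exprS; apply: PM.
Qed.

End ChowDegree.

Section ChowMax.
Variables (E : finType) (M : loopless_matroid E).
Local Notation A := (chow rat (gmax M)).
Local Notation r := (rk M [set: E]).
Local Notation x := (@xc E M (gmax M)).
Implicit Types (F H K L : {set E}).

Lemma ray_between (j : 'I_(nrays (gmax M))) : between M set0 [set: E] (ray j).
Proof.
have [] := rayP j; rewrite inE => /andP[fl n0] nT.
by rewrite /between fl properEneq eq_sym n0 sub0set properT.
Qed.

Lemma xc_out F : ~~ between M set0 [set: E] F -> x F = 0.
Proof.
move=> nF; rewrite /xc big_pred0 // => j; apply: contraNF nF => /eqP <-.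
exact: ray_between.
Qed.

Lemma xc_sr F K : ~~ (F \subset K) -> ~~ (K \subset F) -> x F * x K = 0.
Proof.
move=> FK KF; rewrite /xc mulr_suml big1 // => j /eqP jF.
rewrite mulr_sumr big1 // => j' /eqP jK; rewrite -rmorphM.
rewrite -(rmorph0 (@chow_class rat E M (gmax M))); apply/chow_class_eqP/asboolP; rewrite subr0.
have jj : j != j' by apply: contra FK => /eqP e; rewrite -jF e jK.
have -> : 'X_j * 'X_j' = \prod_(i in [set j; j']) 'X_i :> {mpoly rat[nrays (gmax M)]}.
  by rewrite big_setU1 ?inE // big_set1.
apply: chow_ideal_gen; constructor; apply/negP => nS.
have := gmax_chain nS (_ : F \in _) (_ : K \in _).
rewrite (negPf FK) (negPf KF) => /(_ _ _)/negP; apply=> //.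
  by apply/imsetP; exists j; rewrite ?inE ?eqxx.
by apply/imsetP; exists j'; rewrite ?inE ?eqxx ?orbT.
Qed.

Lemma setT_proper0 : set0 \proper [set: E].
Proof. by rewrite properEneq sub0set eq_sym setT_neq0 // M. Qed.

Lemma rkT_gt0 : (0 < r)%N.
Proof.
have /card_gt0P[e _] := ground_nonempty M.
by rewrite -(rk_loopless M e) rk_mono ?subsetT.
Qed.

Lemma xc_word_nil (l : seq {set E}) : (r <= size l)%N -> \prod_(L <- l) x L = 0.
Proof.
move=> h; rewrite -[LHS]mul1r.
apply: (@interval_nil _ M set0 [set: E]); rewrite ?rk0 ?subn0 //.
- exact: flat0.
- exact: setT_proper0.
- by move=> L /xc_out ->; rewrite mulr0.
- by move=> L L' h1 h2; rewrite xc_sr // mulr0.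
- by move=> i j _ _; rewrite (xc_lin _ i j).
Qed.

Lemma chow_degree_nil d (a : A) : (r <= d)%N -> chow_degree d a -> a = 0.
Proof.
move=> rd; apply: (chow_degree_word_ind (P := fun a => a = 0)) => // [b c -> ->|q l hl].
  by rewrite addr0.
by rewrite xc_word_nil ?mulr0 // hl.
Qed.

End ChowMax.

(** * Quotients of series under a shift by a divisor *)

Section SeriesRatio.
Variables (R : comNzRingType) (io : {rmorphism rat -> R}) (N : nat).
Implicit Types (g : nat -> rat) (x u v : R).

Lemma pser_mulB g x u v : x * u = x * v -> x * pser io N g u = x * pser io N g v.
Proof.
move=> h; rewrite /pser !mulr_sumr; apply: eq_bigr => m _.
rewrite mulrCA [RHS]mulrCA; congr (_ * _).
by elim: (nat_of_ord m) => [|k IH]; rewrite ?expr0 // !exprS mulrCA IH mulrCA mulrA h mulrA.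
Qed.

Lemma pser_shift g x u : exists w, pser io N g (u + x) = pser io N g u + x * w.
Proof.
rewrite /pser; elim/big_rec2: _ => [|m y z _ [w ->]]; first by exists 0; ring.
have [t ->] : exists t, (u + x) ^+ m = u ^+ m + x * t.
  elim: (nat_of_ord m) => [|k [t IH]]; first by exists 0; rewrite !expr0; ring.
  by exists (u ^+ k + (u + x) * t); rewrite !exprS IH; ring.
by exists (io (g m) * t + w); ring.
Qed.

(** For the series f, f(u + x) - f(u) is x times a polynomial in u and x; it depends on u only
    through x u, so it equals f(v + x) - f(v). Likewise x f(u) = x f(v). Geometrically, the quotient
    f(u + x) / f(u) sees only the restriction of u to the divisor x. *)
Lemma pser_ratio g x u v : x * u = x * v ->
  pser io N g (u + x) * pser io N g v = pser io N g (v + x) * pser io N g u.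
Proof.
move=> h; have h' : x * (u + x) = x * (v + x) by rewrite !mulrDr h.
have [w e] := pser_shift g x u; have [w' e'] := pser_shift g x v.
have d : x * w = x * w'.
  have t y z n : x * y = x * z -> (y + x) ^+ n - y ^+ n = (z + x) ^+ n - z ^+ n.
    move=> yz.
    have yzn k : x * (y ^+ k) = x * (z ^+ k).
      by elim: k => [|k IH]; rewrite ?expr0 // !exprS mulrCA IH mulrCA mulrA yz mulrA.
    elim: n => [|n IH]; first by rewrite !expr0 !subrr.
    have expand a : (a + x) ^+ n.+1 - a ^+ n.+1
        = (a + x) * ((a + x) ^+ n - a ^+ n) + x * a ^+ n by rewrite !exprS; ring.
    rewrite !expand yzn IH; congr (_ + _).
    suff [q ->] : exists q, (z + x) ^+ n - z ^+ n = x * q.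
      by rewrite !mulrDl !mulrA ![_ * x]mulrC yz.
    elim: n {IH expand} => [|n [q IH]]; first by exists 0; rewrite !expr0; ring.
    exists ((z + x) * q + z ^+ n); rewrite !exprS; move: IH.
    by move: ((z + x) ^+ n) (z ^+ n) => a b /eqP; rewrite subr_eq => /eqP ->; ring.
  have -> : x * w = pser io N g (u + x) - pser io N g u by rewrite e; ring.
  have -> : x * w' = pser io N g (v + x) - pser io N g v by rewrite e'; ring.
  by rewrite /pser -!sumrB; apply: eq_bigr => m _; rewrite -!mulrBr (t u v).
have k := pser_mulB g h.
rewrite e e' d; rewrite !mulrDl.
by rewrite (mulrC (pser io N g u)) -!mulrA ![w' * _]mulrC !mulrA k.
Qed.

Lemma inverse_ratio (p q s t q' t' : R) :
  p * t = s * q -> q * q' = 1 -> t * t' = 1 -> p * q' = s * t'.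
Proof.
move=> e qq tt; transitivity (p * t * q' * t'); last by rewrite e -[s * q * q']mulrA qq mulr1.
by rewrite -!mulrA [q' * t']mulrC [t * _]mulrA tt mul1r.
Qed.

End SeriesRatio.

(** * Exponential and Todd series in the Chow ring of X_{M,Gmax} *)

Section ChowSeries.
Variables (E : finType) (M : loopless_matroid E).
Local Notation A := (chow rat (gmax M)).
Local Notation r := (rk M [set: E]).
Local Notation deg1 := (@chow_degree rat E M (gmax M) 1).
Implicit Types (x y u v : A).

(** Truncation at r + 1 instead of r only adds a term that is 0 on classes of degree 1
    ([pser_chow]). It lets [todd_specialize], which reaches the coefficients below N - 1, cover all
    degrees below r. *)
Definition cexp := sexp (chow_const (gmax M)) r.+1.
Definition ctodd := stodd (chow_const (gmax M)) r.+1.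
Definition citodd := sitodd (chow_const (gmax M)) r.+1.

Lemma deg1_nil x y i j : deg1 x -> deg1 y -> (r <= i + j)%N -> x ^+ i * y ^+ j = 0.
Proof.
move=> hx hy rij; apply: (chow_degree_nil rij).
by have := chow_degreeM (chow_degreeX i hx) (chow_degreeX j hy); rewrite !mul1n.
Qed.

Lemma deg1_nilX x i : deg1 x -> (r <= i)%N -> x ^+ i = 0.
Proof. by move=> hx ri; rewrite -[LHS]mulr1 -(expr0 x) deg1_nil ?addn0. Qed.

Lemma eqm0 x y : eqm 0 x y -> x = y.
Proof. by move=> [c ->]; rewrite mul0r addr0. Qed.

Lemma eqm0_nil x : deg1 x -> eqm 0 (x ^+ r.+1) 0.
Proof. by move=> hx; rewrite deg1_nilX //; apply: eqm_refl. Qed.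

Lemma cexpD x y : deg1 x -> deg1 y -> cexp (x + y) = cexp x * cexp y.
Proof.
move=> hx hy; symmetry; apply: eqm0; apply: sexpD => i j ij.
by rewrite deg1_nil ?(ltnW ij) //; apply: eqm_refl.
Qed.

Lemma cexp0 : cexp 0 = 1.
Proof. exact: sexp0. Qed.

Lemma ctodd0 : ctodd 0 = 1.
Proof. exact: stodd0. Qed.

Lemma ctodd_citodd x : deg1 x -> ctodd x * citodd x = 1.
Proof. by move=> hx; apply: eqm0; apply: stodd_itodd => //; apply: eqm0_nil. Qed.

Lemma ctoddN x : deg1 x -> ctodd (- x) = ctodd x * cexp (- x).
Proof. by move=> hx; apply: eqm0; apply: stoddN => //; apply: eqm0_nil. Qed.

Lemma citoddN x : deg1 x -> citodd (- x) = citodd x * cexp x.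
Proof. by move=> hx; apply: eqm0; apply: sitoddN => //; apply: eqm0_nil. Qed.

Lemma citodd0 : citodd 0 = 1.
Proof. by have := ctodd_citodd (chow_degree0 (gmax M) 1); rewrite ctodd0 mul1r. Qed.

Lemma ctodd_ratio x u v : deg1 u -> deg1 v -> x * u = x * v ->
  ctodd (u + x) * citodd u = ctodd (v + x) * citodd v.
Proof.
move=> hu hv e; apply: inverse_ratio (ctodd_citodd hu) (ctodd_citodd hv).
exact: pser_ratio.
Qed.

Local Notation cls D := (div_class rat D).

Lemma deg1_div (D : divisor (gmax M)) : deg1 (cls D).
Proof.
exists (div_poly rat D) => //; rewrite /div_poly; apply: rpred_sum => j _.
by apply: dhomogZ; rewrite dhomogX; apply/eqP; exact: mdeg1.
Qed.

Lemma pser_chow (g : nat -> rat) (p : {mpoly rat[nrays (gmax M)]}) : deg1 (chow_class p) ->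
  chow_class (\sum_(m < r) g m *: p ^+ m) = pser (chow_const (gmax M)) r.+1 g (chow_class p).
Proof.
move=> hp; rewrite /pser big_ord_recr /= deg1_nilX // mulr0 addr0 rmorph_sum.
by apply: eq_bigr => m _; rewrite -mul_mpolyC rmorphM rmorphXn.
Qed.

Lemma inv_todd_lineE (D : divisor (gmax M)) : inv_todd_line D = citodd (cls D).
Proof. by apply: (pser_chow itoddc); apply: deg1_div. Qed.

Lemma todd_lineE (D : divisor (gmax M)) : todd_line D = ctodd (cls D).
Proof.
rewrite /todd_line inv_todd_lineE; set x := cls D.
have hx : deg1 x by apply: deg1_div.
(* 1 - [citodd x] is divisible by the nilpotent x, so the geometric sum inverts [citodd x]; inverses
   are unique. *)
have [w hw] : exists w, 1 - citodd x = x * w.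
  exists (- \sum_(m < r) chow_const (gmax M) (itoddc m.+1) * x ^+ m).
  rewrite /citodd /sitodd /pser big_ord_recl /= expr0 mulr1 /itoddc expr0 divr1 rmorph1.
  rewrite opprD addrA subrr add0r mulrN mulr_sumr; congr (- _).
  by apply: eq_bigr => m _; rewrite [x ^+ _.+1]exprS mulrCA.
rewrite /unipotent_inv; set s := \sum_(_ < _) _.
have e : citodd x * s = 1.
  have -> : citodd x * s = - ((1 - citodd x - 1) * s) by ring.
  by rewrite /s -subrX1 hw exprMn deg1_nilX // mul0r sub0r opprK.
by rewrite -[s]mul1r -(ctodd_citodd hx) -mulrA e mulr1.
Qed.

End ChowSeries.

(** * The tangent class *)

Section FreegBig.
Variables (K : choiceType) (X : Type) (idx : X) (op : Monoid.com_law idx).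
Variable w : K -> int -> X.
Hypotheses (w0 : forall D, w D 0 = idx) (wD : forall D m n, w D (m + n) = op (w D m) (w D n)).
Implicit Types (T : {freeg K}).

(** Different terms of [tangent] can be the same divisor: theta_F + x_F is alpha when F is maximal.
    Since a sum over the support only sees merged coefficients, the weight must be additive in the
    coefficient for a termwise evaluation. Both the product [todd] and the sum [c1] have this
    form. *)
Definition freeg_big T : X := \big[op/idx]_(D <- dom T) w D (coeff D T).

Lemma freeg_big_sub T s : uniq s -> {subset dom T <= s} ->
  freeg_big T = \big[op/idx]_(D <- s) w D (coeff D T).
Proof.
move=> us sub; rewrite [RHS](bigID (mem (dom T))) /= [X in op _ X]big1; last first.
  by move=> D nD; rewrite coeff_outdom.
rewrite Monoid.mulm1 -big_filter; apply: perm_big; apply: uniq_perm.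
- exact: uniq_dom.
- exact: filter_uniq.
move=> D; rewrite mem_filter /=; case: (boolP (D \in dom T)) => [h|_] //=.
by rewrite sub.
Qed.

Lemma freeg_bigD T T' : freeg_big (T + T') = op (freeg_big T) (freeg_big T').
Proof.
pose s := undup (dom T ++ dom T'); have us : uniq s := undup_uniq _.
have sT : {subset dom T <= s} by move=> D h; rewrite mem_undup mem_cat h.
have sT' : {subset dom T' <= s} by move=> D h; rewrite mem_undup mem_cat h orbT.
have sTT' : {subset dom (T + T') <= s}.
  move=> D; rewrite mem_undup mem_cat !mem_dom coeffD => h.
  by apply: contraR h; rewrite negb_or !negbK => /andP[/eqP -> /eqP ->].
rewrite (freeg_big_sub us sT) (freeg_big_sub us sT') (freeg_big_sub us sTT').
by rewrite -big_split; apply: eq_bigr => D _; rewrite coeffD wD.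
Qed.

Lemma freeg_big0 : freeg_big 0 = idx.
Proof. by rewrite /freeg_big dom0 big_nil. Qed.

Lemma freeg_bigU D : freeg_big << D >> = w D 1.
Proof. by rewrite /freeg_big domU1 big_seq1 coeffU eqxx. Qed.

Lemma freeg_bigNU D : freeg_big (- << D >>) = w D (-1).
Proof.
rewrite (@freeg_big_sub _ [:: D]) // ?big_seq1 ?coeffN ?coeffU ?eqxx //.
by move=> D'; rewrite domN domU1.
Qed.

Lemma freeg_big_sum (I : Type) (s : seq I) (F : I -> {freeg K}) :
  freeg_big (\sum_(i <- s) F i) = \big[op/idx]_(i <- s) freeg_big (F i).
Proof.
elim: s => [|i s IH]; first by rewrite !big_nil freeg_big0.
by rewrite !big_cons freeg_bigD IH.
Qed.

Lemma freeg_bigZ (k : nat) T : freeg_big (k%:Z *: T) = iter k (op (freeg_big T)) idx.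
Proof.
elim: k => [|k IH]; first by rewrite scale0r freeg_big0.
by rewrite intS scalerDl scale1r freeg_bigD IH.
Qed.

End FreegBig.

Section IntPower.
Variables (R : comNzRingType) (u v : R).
Hypothesis uv : u * v = 1.

Definition ipower (n : int) : R := if 0 <= n then u ^+ `|n|%N else v ^+ `|n|%N.

Lemma ipowerS n : ipower (n + 1) = ipower n * u.
Proof.
case: n => [n|[|n]] //=.
- by rewrite /ipower /= addn1 exprSr.
- by rewrite /ipower /= expr1 mulrC uv.
- rewrite (_ : Negz n.+1 + 1 = Negz n); last by rewrite !NegzE -addn1 PoszD opprD addrNK.
  by rewrite /ipower /= [in RHS]exprSr -mulrA [v * u]mulrC uv mulr1.
Qed.

Lemma ipowerD m n : ipower (m + n) = ipower m * ipower n.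
Proof.
have pos (a : int) (k : nat) : ipower (a + k%:Z) = ipower a * u ^+ k.
  elim: k => [|k IH]; first by rewrite addr0 expr0 mulr1.
  by rewrite -addn1 PoszD addrA ipowerS IH exprD expr1 mulrA.
case: n => n; first by rewrite pos.
have := pos (m + Negz n) n.+1; rewrite NegzE subrK => ->.
by rewrite /ipower -NegzE /= -mulrA -exprMn uv expr1n mulr1.
Qed.

End IntPower.

Section Tangent.
Variables (E : finType) (M : loopless_matroid E).
Local Notation A := (chow rat (gmax M)).
Local Notation r := (rk M [set: E]).
Local Notation cls D := (div_class rat D).

Lemma todd_tangent i :
  todd (tangent (gmax M) i) =
  ctodd (cls (alpha (gmax M) i)) ^+ r *
  \prod_j (ctodd (cls (xdiv j)) *
    (ctodd (cls (theta i j)) * citodd (cls (theta i j + xdiv j))) ^+ rk M (ray j)).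
Proof.
have uv (D : divisor (gmax M)) : todd_line D * inv_todd_line D = 1.
  by rewrite todd_lineE inv_todd_lineE ctodd_citodd //; apply: deg1_div.
pose w (D : divisor (gmax M)) n := ipower (todd_line D) (inv_todd_line D) n.
have w0 D : w D 0 = 1 by [].
have wD D m n : w D (m + n) = w D m * w D n by apply: ipowerD.
have w1 D : w D 1 = ctodd (cls D) by rewrite -todd_lineE.
have wN D : w D (-1) = citodd (cls D) by rewrite -inv_todd_lineE.
have c0 : cls (0 : divisor (gmax M)) = 0.
  by rewrite /div_class /div_poly big1 ?rmorph0 // => j _; rewrite ffunE scale0r.
have it (k : nat) (a : A) : iter k ( *%R a) 1 = a ^+ k by elim: k => //= k ->; rewrite exprS.
rewrite (_ : todd _ = freeg_big ( *%R : Monoid.com_law (1 : A)) w (tangent (gmax M) i)) // /tangent !(freeg_bigD w0 wD) freeg_big_sum // freeg_bigZ //.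
rewrite freeg_bigU // w1 freeg_bigNU // wN c0 citodd0 /= mulr1; congr (_ * _).
  exact: it.
apply: eq_bigr => j _; rewrite !(freeg_bigD w0 wD) freeg_bigZ // freeg_bigU // w1.
rewrite freeg_bigNU // wN c0 citodd0 /= mulr1 !(freeg_bigD w0 wD) freeg_bigU // w1.
by rewrite freeg_bigNU // wN; congr (_ * _); apply: it.
Qed.

Lemma c1_tangent (G : building_set M) i :
  c1 (tangent G i) = alpha G i *+ r + \sum_j (xdiv j - xdiv j *+ rk M (ray j)).
Proof.
pose w (D : divisor G) n := D *~ n.
have w0 D : w D 0 = 0 by [].
have wD D m n : w D (m + n) = w D m + w D n by apply: mulrzDr.
have it (k : nat) (a : divisor G) : iter k (+%R a) 0 = a *+ k.
  by elim: k => //= k ->; rewrite mulrS.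
rewrite (_ : c1 _ = freeg_big (+%R : Monoid.com_law (0 : divisor G)) w (tangent G i)) // /tangent !(freeg_bigD w0 wD).
rewrite freeg_big_sum // freeg_bigZ // freeg_bigU // freeg_bigNU // /w /= mul0rz addr0.
congr (_ + _); first by rewrite it mulr1z.
apply: eq_bigr => j _; rewrite !(freeg_bigD w0 wD) freeg_bigZ // freeg_bigU // freeg_bigNU //.
rewrite !(freeg_bigD w0 wD) freeg_bigU // freeg_bigNU // /w /= it !mulr1z !mulrN1z oppr0 addr0.
by rewrite opprD addNKr mulNrn.
Qed.

End Tangent.

(** * One blowup *)

Section Alpha.
Variables (E : finType) (M : loopless_matroid E) (i : E).
Local Notation A := (chow rat (gmax M)).
Local Notation r := (rk M [set: E]).
Local Notation x := (@xc E M (gmax M)).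
Local Notation deg1 := (@chow_degree rat E M (gmax M) 1).
Local Notation cst := (chow_const (gmax M)).
Implicit Types (F H K L : {set E}) (G V W : {set {set E}}).

Definition aclass : A := \sum_(L : {set E} | i \in L) x L.

(* The nef class theta_K of the flat K; it equals alpha for K = E. *)
Definition hclass K : A := aclass - \sum_(L : {set E} | K \subset L) x L.

Lemma aclassE j : aclass = \sum_(L : {set E} | j \in L) x L.
Proof. exact: xc_lin. Qed.

Lemma deg1_sum (P : pred {set E}) : deg1 (\sum_(L | P L) x L).
Proof. by apply: chow_degree_sum => L _; apply: chow_degree_xc. Qed.

Lemma deg1_a : deg1 aclass. Proof. exact: deg1_sum. Qed.

Lemma deg1_h K : deg1 (hclass K).
Proof. by apply: chow_degreeB; apply: deg1_sum. Qed.

Lemma hclassE K e : e \in K ->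
  hclass K = \sum_(L : {set E} | (e \in L) && ~~ (K \subset L)) x L.
Proof.
move=> eK; rewrite /hclass (aclassE e) (bigID (fun L => K \subset L)) /=.
have -> : \sum_(L : {set E} | (e \in L) && (K \subset L)) x L = \sum_(L : {set E} | K \subset L) x L.
  by apply: eq_bigl => L; case: (boolP (K \subset L)) => [/subsetP ->|]; rewrite ?andbF.
by rewrite addrAC subrr add0r.
Qed.

(** Multiplication by x_F kills x_L unless L is comparable to F, so only such flats have to be
    compared. Restrictions to D_F are computed in this way. *)
Lemma mul_xc_eq F (P Q : pred {set E}) :
  (forall L, between M set0 [set: E] L -> (L \subset F) || (F \subset L) -> P L = Q L) ->
  x F * (\sum_(L | P L) x L) = x F * (\sum_(L | Q L) x L).
Proof.
move=> h; rewrite !mulr_sumr big_mkcond [RHS]big_mkcond; apply: eq_bigr => L _.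
have [bL|/xc_out ->] := boolP (between M set0 [set: E] L); last by rewrite mulr0 !if_same.
have [c|/norP[c1 c2]] := boolP ((L \subset F) || (F \subset L)); first by rewrite h.
by rewrite xc_sr // !if_same.
Qed.

End Alpha.

Section Blowup.
Variables (E : finType) (M : loopless_matroid E) (i : E) (G : building_set M).
Local Notation A := (chow rat (gmax M)).
Local Notation r := (rk M [set: E]).
Local Notation x := (@xc E M (gmax M)).
Local Notation deg1 := (@chow_degree rat E M (gmax M) 1).
Local Notation cst := (chow_const (gmax M)).
Local Notation h := (hclass M i).
Local Notation al := (aclass M i).
Implicit Types (F H K L : {set E}) (V W : {set {set E}}).

(* The maximal elements of the building set V below F, when V arises from G by
   adjoining an upper set of flats. *)
Definition wfac V F : {set {set E}} := if F \in V then [set F] else factors G F.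

(* The pullback of the divisor x_H of X_{M,V} to X_{M,Gmax}. *)
Definition wclass V H : A := \sum_(L | H \in wfac V L) x L.

Definition wtodd_factor V H : A :=
  ctodd (wclass V H) * (ctodd (h H) * citodd (h H + wclass V H)) ^+ rk M H.

(* The pullback of the Todd class of T_{M,V}. *)
Definition wtodd V : A :=
  ctodd al ^+ r * \prod_(H in V :\ [set: E]) wtodd_factor V H.

(** The intermediate stages are G together with an upper set of flats. They are never shown to be
    building sets: [wfac] and [wclass] make sense for any V, and all classes live on X_{M,Gmax}. *)
Definition upper_over V : Prop :=
  forall K, K \in V -> K \in bset G \/ forall L, flat M L -> K \subset L -> L \in V.

Lemma deg1_wclass V H : deg1 (wclass V H).
Proof. exact: deg1_sum. Qed.

Lemma wfac_sub V F H : H \in wfac V F -> H \subset F.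
Proof. by rewrite /wfac; case: ifP => _; [rewrite inE => /eqP -> | case/factorsP]. Qed.

Section Center.
Variable F : {set E}.
Hypotheses (bF : between M set0 [set: E] F) (FG : F \notin bset G).
Local Notation Phi := (factors G F).

Let fF : flat M F. Proof. by case/and3P: bF. Qed.
Let F0 : F != set0.
Proof. by case/and3P: bF => _ + _; rewrite properEneq eq_sym => /andP[]. Qed.
Let FT : F != [set: E].
Proof. by case/and3P: bF => _ _; rewrite properT. Qed.

Lemma factor_proper H : H \in Phi -> H \proper F.
Proof.
move=> /factorsP[HG HF _]; rewrite properEneq HF andbT.
by apply: contraNneq FG => <-.
Qed.

Lemma factor_uniq H H' K : H \in Phi -> H' \in Phi -> K != set0 ->
  K \subset H -> K \subset H' -> H = H'.
Proof.
move=> hH hH' /set0Pn[e eK] /subsetP/(_ e eK) eH /subsetP/(_ e eK) eH'.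
exact: (factors_disjoint fF hH hH' eH eH').
Qed.

(* The classes pulled back from the center of the blowup of D_F are polynomials
   in the following letters: K is either a flat above F or a flat below one of
   the factors of F. *)
Definition low H K : A :=
  if (K != set0) && (K \proper H) then \sum_(L : {set E} | L :&: H == K) x L else 0.

Definition letter K : A := if F \proper K then x K else \sum_(H in Phi) low H K.

Lemma letter_low H K : H \in Phi -> K != set0 -> K \proper H -> letter K = low H K.
Proof.
move=> hH K0 KH; have /negPf nFK : ~~ (F \proper K).
  apply/negP => FK; have := proper_trans FK (proper_trans KH (factor_proper hH)).
  by rewrite properxx.
rewrite /letter nFK (bigD1 H) //= big1 ?addr0 // => H' /andP[hH' ne].
rewrite /low; case: ifP => // /andP[_ KH'].
by move: ne; rewrite (factor_uniq hH' hH K0 (proper_sub KH') (proper_sub KH)) eqxx.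
Qed.

(** Only the product with x_F is constrained: the restriction of b to D_F is to be a polynomial in
    the letters, that is, to come from the product of the varieties of the intervals [0, H], H a
    factor of F, and [F, E]. *)
Definition base (b : A) : Prop := exists s : seq (rat * seq {set E}),
  x F * b = x F * \sum_(c <- s) cst c.1 * \prod_(K <- c.2) letter K.

Lemma base_eq a b : x F * a = x F * b -> base b -> base a.
Proof. by move=> e [s hs]; exists s; rewrite e. Qed.

Lemma base_const q : base (cst q).
Proof. by exists [:: (q, [::])]; rewrite big_seq1 big_nil mulr1. Qed.

Lemma baseD a b : base a -> base b -> base (a + b).
Proof.
by move=> [s hs] [t ht]; exists (s ++ t); rewrite big_cat mulrDr hs ht -mulrDr.
Qed.

Lemma baseM a b : base a -> base b -> base (a * b).
Proof.
move=> [s hs] [t ht].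
exists [seq (c.1 * d.1, c.2 ++ d.2) | c <- s, d <- t].
rewrite mulrA hs mulrAC ht mulrAC -mulrA; congr (_ * _).
rewrite big_allpairs_dep mulr_suml; apply: eq_bigr => c _; rewrite mulr_sumr.
by apply: eq_bigr => d _ /=; rewrite big_cat rmorphM mulrACA.
Qed.

Lemma base0 : base 0. Proof. by rewrite -(rmorph0 cst); apply: base_const. Qed.
Lemma base1 : base 1. Proof. by rewrite -(rmorph1 cst); apply: base_const. Qed.

Lemma baseN a : base a -> base (- a).
Proof. by move=> ha; rewrite -mulN1r -(rmorphN1 cst); apply: baseM => //; apply: base_const. Qed.

Lemma baseB a b : base a -> base b -> base (a - b).
Proof. by move=> ha hb; apply: baseD => //; apply: baseN. Qed.

Lemma baseX a n : base a -> base (a ^+ n).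
Proof. by move=> ha; elim: n => [|n IH]; [rewrite expr0; apply: base1 | rewrite exprS; apply: baseM]. Qed.

Lemma base_pser g N a : base a -> base (pser cst N g a).
Proof.
move=> ha; rewrite /pser; elim/big_ind: _ => [||m _]; [exact: base0 | exact: baseD |].
by apply: baseM; [apply: base_const | apply: baseX].
Qed.

Lemma base_prod (I : finType) (P : pred I) (f : I -> A) :
  (forall j, P j -> base (f j)) -> base (\prod_(j | P j) f j).
Proof. by move=> hf; elim/big_ind: _ => //; [exact: base1 | exact: baseM]. Qed.

Lemma base_letter K : base (letter K).
Proof. by exists [:: (1, [:: K])]; rewrite !big_seq1 /= rmorph1 mul1r. Qed.

Lemma base_letters (P : pred {set E}) : base (\sum_(K | P K) letter K).
Proof. by elim/big_ind: _ => [||K _]; [exact: base0 | exact: baseD | exact: base_letter]. Qed.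

Lemma base_upper (P : pred {set E}) :
  (forall L, between M set0 [set: E] L -> (L \subset F) || (F \subset L) -> P L -> F \proper L) ->
  base (\sum_(L | P L) x L).
Proof.
move=> hP; apply: base_eq (base_letters (fun K => P K && (F \proper K))).
have -> : \sum_(K | P K && (F \proper K)) letter K = \sum_(K | P K && (F \proper K)) x K.
  by apply: eq_bigr => K /andP[_ FK]; rewrite /letter FK.
apply: mul_xc_eq => L bL cL; case: (boolP (P L)) => // PL.
by rewrite (hP L).
Qed.

(** Intersection with the factor H projects [0, F] onto [0, H]. Flats above F meet H in H itself, so
    they enter no letter of this kind. *)
Lemma base_lower H (P Q : pred {set E}) : H \in Phi ->
  (forall K, Q K -> (K != set0) && (K \proper H)) ->
  (forall L, between M set0 [set: E] L -> (L \subset F) || (F \subset L) -> P L = Q (L :&: H)) ->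
  base (\sum_(L | P L) x L).
Proof.
move=> hH hQ hP; apply: base_eq (base_letters Q).
rewrite (mul_xc_eq hP) (partition_big (fun L => L :&: H) Q) //=; congr (_ * _).
apply: eq_bigr => K QK; have /andP[K0 KH] := hQ K QK.
rewrite (letter_low hH K0 KH) /low K0 KH; apply: eq_bigl => L.
by case: eqP => [->|]; rewrite ?QK ?andbF.
Qed.

Lemma base_alpha : base al.
Proof.
have [j jF] : exists j, j \notin F.
  by apply/existsP; rewrite -negb_forall; apply: contra FT => /forallP a; apply/eqP/setP => e; rewrite inE a.
rewrite (aclassE _ _ j); apply: base_upper => L _ /orP[LF|FL] jL.
  by move: jF; rewrite (subsetP LF).
by rewrite properE FL; apply: contra jF => /subsetP; apply.
Qed.

(** This is theta_F + x_F ([bclassE]), written so that, with alpha taken at an element outside F,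
    only flats strictly above F survive on D_F. *)
Definition bclass : A := al - \sum_(L : {set E} | F \proper L) x L.

Lemma bclassE : bclass = h F + x F.
Proof.
rewrite /bclass /hclass [in RHS](bigD1 F) //= opprD addrA addrAC subrK; congr (_ - _).
by apply: eq_bigl => L; rewrite properEneq eq_sym andbC.
Qed.

Lemma deg1_b : deg1 bclass.
Proof. by apply: chow_degreeB; apply: deg1_sum. Qed.

Lemma base_b : base bclass.
Proof. by apply: baseB; [exact: base_alpha | apply: base_upper]. Qed.

Section Filter.
Variable V : {set {set E}}.
Hypotheses (GV : bset G \subset V) (FV : F \notin V) (uV : upper_over V).

Lemma below_center K : K \in V -> K \subset F -> K \in bset G.
Proof. by move=> /uV[//|up] KF; move: FV; rewrite up. Qed.

Lemma wfac_below L : L \subset F -> wfac V L = factors G L.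
Proof.
move=> LF; rewrite /wfac; case: ifP => // LV.
by rewrite factorsT // below_center.
Qed.

Lemma base_h H : H \in V -> base (h H).
Proof.
move=> HV; have [HF|nHF] := boolP (H \subset F).
  have HG := below_center HV HF.
  have [H1 hH1 HH1] := factors_ex HG HF.
  have /set0Pn[e eH] := bset_neq0 HG.
  rewrite (hclassE M i eH).
  apply: (base_lower (Q := fun K => [&& e \in K, ~~ (H \subset K), K != set0 & K \proper H1]) hH1).
    by move=> K /and4P[_ _ -> ->].
  move=> L _ _; rewrite inE (subsetP HH1 _ eH) andbT subsetI HH1 andbT.
  case: (boolP (e \in L)) => //= eL; case: (boolP (H \subset L)) => //= HL.
  apply/esym/andP; split; first by apply/set0Pn; exists e; rewrite inE eL (subsetP HH1).
  rewrite properE subsetIr /= subsetI subxx andbT.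
  by apply: contra HL; apply: subset_trans.
apply: baseB; first exact: base_alpha.
apply: base_upper => L _ /orP[LF|FL] HL; first by move: nHF; rewrite (subset_trans HL).
by rewrite properE FL; apply: contra nHF; apply: subset_trans.
Qed.

Lemma base_wclass H : H \in V -> base (wclass V H).
Proof.
move=> HV; have [HF|nHF] := boolP (H \subset F); last first.
  apply: base_upper => L _ /orP[LF|FL] /wfac_sub HL; first by move: nHF; rewrite (subset_trans HL).
  by rewrite properE FL; apply: contra nHF; apply: subset_trans.
have HG := below_center HV HF.
rewrite /wclass (bigID (fun L => F \proper L)) /=; apply: baseD.
  by apply: base_upper => L _ _ /andP[].
(* By maximality, a factor H of F is a factor of every flat between H and F. On D_F the remaining
   sum thus runs over all flats that contain H and do not strictly contain F. *)
have [hH|nH] := boolP (H \in Phi).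
  apply: (@base_eq _ (al - h H - \sum_(L : {set E} | F \proper L) x L)); last first.
    apply: baseB; last exact: base_upper.
    by apply: baseB; [exact: base_alpha | exact: base_h].
  have -> : al - h H - \sum_(L : {set E} | F \proper L) x L =
      \sum_(L : {set E} | (H \subset L) && ~~ (F \proper L)) x L.
    rewrite /hclass subKr (bigID (fun L => F \proper L)) /= addrC.
    have -> : \sum_(L : {set E} | (H \subset L) && (F \proper L)) x L =
        \sum_(L : {set E} | F \proper L) x L.
      apply: eq_bigl => L; case: (boolP (F \proper L)); rewrite ?andbF // => /proper_sub.
      by move=> /(subset_trans HF) ->.
    by rewrite addrK.
  apply: mul_xc_eq => L _ cL; case: (boolP (F \proper L)) => [_|nFL]; rewrite ?andbF ?andbT //.
  have LF : L \subset F.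
    by move: cL nFL => /orP[//|FL]; rewrite properE FL /= negbK.
  rewrite wfac_below //; apply/idP/idP => [/factorsP[]//|HL].
  have [_ _ mH] := factorsP _ _ _ hH; apply/factorsP; split=> // H' H'G HH' H'L.
  by apply: mH => //; apply: subset_trans LF.
(* Here H lies strictly inside a factor H1 of F. For L below F, the members of G between H and L lie
   in H1, so whether H is a factor of L can be read off from the intersection of L with H1. *)
have [H1 hH1 HH1] := factors_ex HG HF.
have ne : H != H1 by apply: contraNneq nH => ->.
have pH1 : H \proper H1 by rewrite properEneq ne.
apply: (base_lower (Q := fun K => [&& K != set0, K \proper H1 & H \in factors G K]) hH1).
  by move=> K /and3P[-> ->].
move=> L bL cL; have [FL|nFL] /= := boolP (F \proper L).
  rewrite andbF; have -> : L :&: H1 = H1.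
    apply/setIidPr; apply: subset_trans (proper_sub FL); apply: proper_sub.
    exact: factor_proper.
  by rewrite properxx andbF.
have LF : L \subset F.
  by move: cL nFL => /orP[//|FL]; rewrite properE FL /= negbK.
rewrite andbT wfac_below //; have fL : flat M L by case/and3P: bL.
apply/idP/and3P => [/factorsP[_ HL mH]|[_ LH1 /factorsP[_ + mH]]].
  have HLH : H \subset L :&: H1 by rewrite subsetI HL.
  have n1 : L :&: H1 != set0.
    by have /set0Pn[e eH] := bset_neq0 HG; apply/set0Pn; exists e; apply: (subsetP HLH).
  split=> //.
    rewrite properEneq subsetIr andbT; apply/eqP => eLH.
    have [H1G _ _] := factorsP _ _ _ hH1.
    by move: ne; rewrite -(mH H1) ?eqxx // -eLH subsetIl.
  apply/factorsP; split=> // H' H'G HH' H'L; apply: mH => //.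
  exact: subset_trans H'L (subsetIl _ _).
rewrite subsetI => /andP[HL _]; apply/factorsP; split=> // H' H'G HH' H'L.
apply: mH => //; rewrite subsetI H'L /=.
have [H2 hH2 H'H2] := factors_ex H'G (subset_trans H'L LF).
suff -> : H1 = H2 by [].
exact: (factor_uniq hH1 hH2 (bset_neq0 HG) HH1 (subset_trans HH' H'H2)).
Qed.

(** The left factor is alpha minus the x_L for which L contains H without having H as a factor.
    Among the flats comparable to F these are exactly the flats strictly above F, which belong to V
    and so are their own only factor. *)
Lemma mul_bclass H : (forall L, flat M L -> F \proper L -> L \in V) -> H \in Phi ->
  x F * (h H + wclass V H) = x F * bclass.
Proof.
move=> up hH; have [_ HF mH] := factorsP _ _ _ hH.
pose P L := (H \subset L) && (H \notin wfac V L).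
have -> : h H + wclass V H = al - \sum_(L | P L) x L.
  rewrite /hclass (bigID (fun L => H \in wfac V L)) /=.
  have -> : \sum_(L : {set E} | (H \subset L) && (H \in wfac V L)) x L = wclass V H.
    by apply: eq_bigl => L; case: (boolP (H \in wfac V L)) => [/wfac_sub ->|]; rewrite ?andbF.
  by rewrite opprD addrA addrAC subrK.
rewrite /bclass !mulrBr; congr (_ - _); apply: mul_xc_eq => L bL cL; rewrite /P.
have fL : flat M L by case/and3P: bL.
have [FL|nFL] := boolP (F \proper L).
  rewrite (subset_trans HF (proper_sub FL)) /wfac up //= inE.
  apply/eqP => e; move: FL; rewrite -e => FH.
  by have := proper_sub_trans FH HF; rewrite properxx.
have LF : L \subset F.
  by move: cL nFL => /orP[//|FL]; rewrite properE FL /= negbK.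
rewrite wfac_below //; apply/negP => /andP[HL /negP]; apply.
have [HG _ _] := factorsP _ _ _ hH; apply/factorsP; split=> // H' H'G HH' H'L.
by apply: mH => //; apply: subset_trans LF.
Qed.

End Filter.

Section Step.
Variable V : {set {set E}}.
Hypotheses (GV : bset G \subset V) (FV : F \notin V) (uV : upper_over V).
Hypothesis up : forall L, flat M L -> F \proper L -> L \in V.
Let V' := F |: V.

Lemma wclass_setU1 H : H \in V -> wclass V' H = wclass V H - (if H \in Phi then x F else 0).
Proof.
move=> HV; have HF : H != F by apply: contraNneq FV => <-.
rewrite /wclass big_mkcond [X in _ = X - _]big_mkcond (bigD1 F) //= [X in _ = X - _](bigD1 F) //=.
rewrite {1 3}/wfac setU11 inE (negPf HF) (negPf FV) add0r addrAC subrr add0r.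
by apply: eq_bigr => L LF; rewrite /wfac !inE (negPf LF).
Qed.

Lemma wclass_center : wclass V' F = x F.
Proof.
rewrite /wclass (bigD1 F) /=; last by rewrite /wfac setU11 inE.
rewrite big1 ?addr0 // => L /andP[+ LF]; rewrite /wfac !inE (negPf LF) /=.
case: ifP => [_|_ /factorsP[]]; first by rewrite inE eq_sym (negPf LF).
by rewrite (negPf FG).
Qed.

Definition step_ratio H : A :=
  ctodd (h F - h H) * citodd (bclass - h H) * (ctodd bclass * citodd (h F)) ^+ rk M H.

(** Adjoining F subtracts x_F from the class of each factor H. By [ctodd_ratio] the resulting
    quotients depend only on restrictions to D_F, where [mul_bclass] replaces [h H + wclass V H] by
    [bclass]. *)
Lemma wtodd_factor_setU1 H : H \in V ->
  wtodd_factor V' H = wtodd_factor V H * (if H \in Phi then step_ratio H else 1).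
Proof.
move=> HV; rewrite /wtodd_factor wclass_setU1 //.
case: ifP => hH; last by rewrite subr0 mulr1.
set X := wclass V H; have dX : deg1 X by apply: deg1_wclass.
have dh := deg1_h M i; have db := deg1_b.
have mb := mul_bclass FV uV up hH; rewrite -/X in mb.
have e1 : ctodd (X - x F) * citodd X = ctodd (h F - h H) * citodd (bclass - h H).
  have -> : h F - h H = bclass - h H + - x F by rewrite bclassE; ring.
  apply: ctodd_ratio => //; first exact: chow_degreeB.
  by rewrite !mulNr mulrBr -mb mulrDr; ring.
have e2 : ctodd (h H + X - x F) * citodd (h H + X) = ctodd (h F) * citodd bclass.
  have -> : h F = bclass + - x F by rewrite bclassE addrK.
  apply: ctodd_ratio => //; first exact: chow_degreeD.
  by rewrite !mulNr mb.
rewrite [h H + (_ - _)]addrA.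
have dU : deg1 (h H + X) by apply: chow_degreeD.
have dUx : deg1 (h H + X - x F) by apply: chow_degreeB => //; apply: chow_degree_xc.
rewrite /step_ratio -e1.
have := (ctodd_citodd dX, ctodd_citodd dU, ctodd_citodd dUx, ctodd_citodd (dh F), ctodd_citodd db).
move: e2 => {e1}.
move: (ctodd X) (citodd X) (ctodd (X - x F)) (ctodd (h H)) (ctodd (h H + X)) (citodd (h H + X)).
move: (ctodd (h H + X - x F)) (citodd (h H + X - x F)) (ctodd (h F)) (citodd (h F)).
move: (ctodd bclass) (citodd bclass) => t t' p p' s s' f f' fx g q q' e2 [[[[ff qq] pp] ss] tt].
have -> : t * s' = p' * q.
  transitivity (q * q' * (p * p') * (t * s')); first by rewrite qq pp !mul1r.
  transitivity (p' * q * (p * q') * (t * s')); first by ring.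
  rewrite e2; transitivity (p' * q * (s * s') * (t * t')); first by ring.
  by rewrite ss tt !mulr1.
transitivity (fx * (f * f') * ((g * q') ^+ rk M H * (p' * q) ^+ rk M H)); last by ring.
have e3 : g * q' * (p' * q) = g * p' * (q * q') by ring.
by rewrite ff mulr1 -exprMn e3 qq mulr1.
Qed.

(** The new factor for F contains td(theta_F) / td(b) to the power rk F, and the ratios for the H
    contain its inverse to the powers rk H. These cancel because the ranks of the factors add up to
    rk F. *)
Lemma wtodd_setU1 : wtodd V' =
  wtodd V * (ctodd (bclass - h F) * \prod_(H <- enum Phi) ctodd (h F - h H) *
             \prod_(H <- enum Phi) citodd (bclass - h H)).
Proof.
have PhiV H : H \in Phi -> H \in V :\ [set: E].
  move=> hH; have [HG _ _] := factorsP _ _ _ hH; rewrite in_setD1 (subsetP GV) // andbT.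
  by have := factor_proper hH; apply: contraTneq => ->; rewrite properE subsetT andbF.
rewrite /wtodd (_ : V' :\ [set: E] = F |: (V :\ [set: E])); last first.
  apply/setP => L; rewrite /V' in_setD1 !in_setU1 in_setD1.
  by have [->|] := eqVneq L F; rewrite ?FT ?andbT ?orbF /=.
rewrite big_setU1 /=; last by rewrite inE negb_and FV orbT.
have -> : \prod_(H in V :\ [set: E]) wtodd_factor V' H =
    (\prod_(H in V :\ [set: E]) wtodd_factor V H) * \prod_(H in Phi) step_ratio H.
  rewrite (eq_bigr (fun H => wtodd_factor V H * (if H \in Phi then step_ratio H else 1))).
    rewrite big_split -big_mkcondr; congr (_ * _); apply: eq_bigl => H.
    by case: (boolP (H \in Phi)) => [/PhiV ->|]; rewrite ?andbF.
  by move=> H; rewrite inE => /andP[_ HV]; apply: wtodd_factor_setU1.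
have -> : \prod_(H in Phi) step_ratio H =
    (\prod_(H <- enum Phi) ctodd (h F - h H)) * (\prod_(H <- enum Phi) citodd (bclass - h H)) *
    (ctodd bclass * citodd (h F)) ^+ rk M F.
  by rewrite !big_enum /step_ratio !big_split -(rk_factors G fF F0) expr_sum.
rewrite /wtodd_factor wclass_center -bclassE.
have -> : bclass - h F = x F by rewrite bclassE addrAC subrr add0r.
have cf := ctodd_citodd (deg1_h M i F); have cb := ctodd_citodd deg1_b.
move: (\prod_(H <- enum Phi) _) (\prod_(H <- enum Phi) _) => P2 P1.
move: (\prod_(H in V :\ [set: E]) _) (ctodd al ^+ r) (ctodd (x F)) => P3 t y.
move: cf cb; move: (ctodd (h F)) (citodd (h F)) (ctodd bclass) (citodd bclass) => a a' b b' aa bb.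
transitivity (t * P3 * (y * P1 * P2) * ((a * b') ^+ rk M F * (b * a') ^+ rk M F)); first by ring.
have e3 : a * b' * (b * a') = a * a' * (b * b') by ring.
by rewrite -exprMn e3 aa bb mulr1 expr1n mulr1.
Qed.

Lemma base_wtodd : base (wtodd V).
Proof.
rewrite /wtodd; apply: baseM; first by apply: baseX; apply: base_pser; apply: base_alpha.
apply: base_prod => H; rewrite inE => /andP[_ HV].
have bX := base_wclass FV uV HV; have bh := base_h FV uV HV.
apply: baseM; first exact: base_pser.
by apply: baseX; apply: baseM; apply: base_pser => //; apply: baseD.
Qed.

End Step.

Lemma mul_prod_eq (I : eqType) (s : seq I) (u v : I -> A) :
  (forall j, j \in s -> x F * u j = x F * v j) -> x F * \prod_(j <- s) u j = x F * \prod_(j <- s) v j.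
Proof.
elim: s => [|j s IH] e; first by rewrite !big_nil.
rewrite !big_cons mulrCA IH; last by move=> k ks; apply: e; rewrite inE ks orbT.
by rewrite mulrCA mulrA e ?mem_head // mulrA.
Qed.

(* The divisors h F - h H, for H a factor of F, have no common point on D_F. *)
Lemma center_root : x F * \prod_(H <- enum Phi) (h F - h H) = 0.
Proof.
pose D H := \sum_(L : {set E} | (H \subset L) && (L \proper F)) x L.
have -> : x F * \prod_(H <- enum Phi) (h F - h H) = x F * \prod_(H <- enum Phi) D H.
  apply: mul_prod_eq => H; rewrite mem_enum => /factorsP[_ HF _].
  have -> : h F - h H = \sum_(L : {set E} | (H \subset L) && ~~ (F \subset L)) x L.
    rewrite /hclass opprB addrC addrA subrK [X in X - _](bigID (fun L => F \subset L)) /=.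
    have -> : \sum_(L : {set E} | (H \subset L) && (F \subset L)) x L =
        \sum_(L : {set E} | F \subset L) x L.
      apply: eq_bigl => L; case: (boolP (F \subset L)); rewrite ?andbF // => FL.
      by rewrite (subset_trans HF FL).
    by rewrite addrAC subrr add0r.
  apply: mul_xc_eq => L _; rewrite properE => /orP[->|FL] //.
  by rewrite FL !andbF.
(* The ideal generated by the x_L with L above B and strictly below F. As products of incomparable
   x_L vanish, the product of the [D H] lies in [I] of the union of all factors; that union contains
   F, so no such L exists. *)
pose I (B : {set E}) (v : A) := exists c : {set E} -> A,
  v = \sum_(L : {set E} | (B \subset L) && (L \proper F)) x L * c L.
have I0 B : I B 0 by exists (fun=> 0); rewrite big1 // => L _; rewrite mulr0.
have ID B v w : I B v -> I B w -> I B (v + w).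
  move=> [c ->] [d ->]; exists (fun L => c L + d L); rewrite -big_split.
  by apply: eq_bigr => L _; rewrite mulrDr.
have Ix (B L : {set E}) v : B \subset L -> L \proper F -> I B (x L * v).
  move=> BL LF; exists (fun L' => if L' == L then v else 0).
  rewrite (bigD1 L) ?BL //= eqxx big1 ?addr0 // => L' /andP[_ /negPf ->].
  by rewrite mulr0.
have IM H B v : I B v -> I (H :|: B) (D H * v).
  move=> [c ->]; rewrite mulr_suml; elim/big_ind: _ => [||L /andP[HL LF]].
  - exact: I0.
  - exact: ID.
  rewrite mulr_sumr; elim/big_ind: _ => [||L' /andP[BL' L'F]].
  - exact: I0.
  - exact: ID.
  have [LL'|n1] := boolP (L \subset L').
    by rewrite mulrCA; apply: Ix => //; rewrite subUset (subset_trans HL).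
  have [L'L|n2] := boolP (L' \subset L).
    by apply: Ix => //; rewrite subUset HL (subset_trans BL').
  by rewrite mulrA xc_sr // mul0r.
have IP H s : I (\bigcup_(K <- H :: s) K) (\prod_(K <- H :: s) D K).
  elim: s H => [|H' s IH] H; last by rewrite big_cons [X in I _ X]big_cons; apply: IM.
  rewrite !big_seq1; exists (fun=> 1); apply: eq_big => L; last by rewrite mulr1.
  by [].
have cov : F \subset \bigcup_(K <- enum Phi) K.
  rewrite big_enum; apply/subsetP => e /(factors_cover G fF)[H hH eH].
  by apply/bigcupP; exists H.
case: (enum Phi) cov => [|H s] cov.
  by move: cov; rewrite big_nil subset0 (negPf F0).
move: cov (IP H s); move: (\bigcup_(K <- H :: s) K) => B cov [c ->].
rewrite big_pred0 ?mulr0 // => L.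
apply/negP => /andP[/(subset_trans cov) FL LF].
by move: LF; rewrite properE FL andbF.
Qed.

(** By [interval_nil], a nonzero word has fewer than r - rk F letters above F and fewer than rk H
    letters below each factor H. As the rk H add up to rk F, it has at most r - 1 - #|Phi| letters,
    the dimension of the center. *)
Lemma mul_word_nil l : (r - #|Phi| <= size l)%N -> x F * \prod_(K <- l) letter K = 0.
Proof.
move=> hl.
pose up K := F \proper K; pose lo H K := (K != set0) && (K \proper H).
have lo_in H K : H \in Phi -> lo H K -> letter K = low H K.
  by move=> hH /andP[K0 KH]; apply: letter_low.
have [/hasP[K Kl nK]|] := boolP (has (fun K => ~~ up K && [forall H in Phi, ~~ lo H K]) l).
  have /andP[/negPf nu /forall_inP nl] := nK.
  rewrite (big_rem K) //= (_ : letter K = 0) ?mul0r ?mulr0 //.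
  rewrite /letter (nu : (F \proper K) = false) big1 // => H /nl.
  by rewrite /low /lo => /negPf ->.
rewrite -all_predC => /allP cl.
have cnt : (size l <= count up l + \sum_(H in Phi) count (lo H) l)%N.
  elim: l {hl} cl => //= K l IH cl; have {}IH : (size l <= count up l + \sum_(H in Phi) count (lo H) l)%N.
    by apply: IH => K' K'l; apply: cl; rewrite inE K'l orbT.
  rewrite big_split /= addnACA -add1n leq_add //.
  have := cl K (mem_head _ _); rewrite /= negb_and negbK => /orP[->|] //.
  rewrite negb_forall_in => /exists_inP[H hH /negPn lK].
  by rewrite (bigD1 H) //= lK addnCA.
have split_l (P : pred {set E}) : \prod_(K <- l) letter K =
    (\prod_(K <- filter P l) letter K) * \prod_(K <- filter (predC P) l) letter K.
  by rewrite !big_filter (bigID P).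
have [cu|cu] := leqP (r - rk M F) (count up l).
  pose y L := if up L then x L else 0.
  rewrite (split_l up) mulrA (_ : x F * \prod_(K <- filter up l) letter K = 0) ?mul0r //.
  have -> : \prod_(K <- filter up l) letter K = \prod_(K <- filter up l) y K.
    rewrite !big_filter; apply: eq_bigr => K; rewrite /y /letter => uK.
    by rewrite uK [F \proper K]uK.
  apply: (@interval_nil _ M F [set: E]); rewrite ?properT ?size_filter //.
  - move=> L; rewrite /between /y properT /up; case: ifP => [FL|]; last by rewrite mulr0.
    move=> n; rewrite (@xc_out _ M L) ?mulr0 //; apply: contra n => /and3P[-> _] /=.
    by rewrite properT => ->.
  - move=> L L' n1 n2; rewrite /y; case: ifP => _; last by rewrite mul0r mulr0.
    by case: ifP => _; rewrite ?mulr0 // xc_sr // mulr0.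
  have e k : k \in [set: E] :\: F ->
      x F * \sum_(L : {set E} | k \in L) y L = x F * \sum_(L : {set E} | k \in L) x L.
    rewrite inE => /andP[kF _].
    rewrite -big_mkcondr; apply: mul_xc_eq => L _ /orP[LF|FL].
      by case: (boolP (k \in L)) => // kL; move: kF; rewrite (subsetP LF).
    case: (boolP (k \in L)) => //= kL; rewrite /up properE FL.
    by apply: contra kF => /subsetP; apply.
  by move=> k k' hk hk'; rewrite !e // (xc_lin _ k k').
have [/exists_inP[H hH cH]|] := boolP [exists H in Phi, (rk M H <= count (lo H) l)%N].
  have [HG HF _] := factorsP _ _ _ hH; have fH := bset_flat HG.
  rewrite (split_l (lo H)) (_ : \prod_(K <- filter (lo H) l) letter K = 0) ?mul0r ?mulr0 //.
  have -> : \prod_(K <- filter (lo H) l) letter K = \prod_(K <- filter (lo H) l) low H K.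
    by rewrite !big_filter; apply: eq_bigr => K; apply: lo_in.
  rewrite -[LHS]mul1r.
  apply: (@interval_nil _ M set0 H); rewrite ?rk0 ?subn0 ?size_filter //.
  - exact: flat0.
  - by rewrite properEneq sub0set eq_sym (bset_neq0 HG).
  - move=> K; rewrite /between mul1r /low [set0 \proper K]properEneq sub0set andbT [set0 == K]eq_sym.
    case: ifP => [_|] //; rewrite andbT => nfK.
    apply: big1 => L /eqP eK; apply: xc_out; apply: contra nfK => /and3P[fL _ _].
    by rewrite -eK flatI.
  - move=> K K' n1 n2; rewrite mul1r /low; case: ifP => _; last by rewrite mul0r.
    case: ifP => _; last by rewrite mulr0.
    rewrite mulr_suml big1 // => L /eqP eL; rewrite mulr_sumr big1 // => L' /eqP eL'.
    rewrite xc_sr // -?eL -?eL'.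
      by apply: contra n1 => LL'; rewrite -eL -eL' setSI.
    by apply: contra n2 => LL'; rewrite -eL -eL' setSI.
  (* The linear relations among the letters below H: summing over the flats through k gives theta_H,
     whatever k is. *)
  have e k : k \in H :\: set0 -> \sum_(K : {set E} | k \in K) low H K = h H.
    rewrite setD0 => kH; rewrite (hclassE M i kH).
    rewrite [RHS](partition_big (fun L => L :&: H) (fun K => (k \in K) && lo H K)) /=.
      rewrite [RHS]big_mkcondr; apply: eq_bigr => K kK; rewrite /low /lo; case: ifP => // /andP[_ KH].
      apply: eq_bigl => L; case: eqP => [eK|]; rewrite ?andbF // andbT.
      move: kK; rewrite -eK inE kH andbT => -> /=; apply/esym; apply/negP => HL.
      by move: KH; rewrite -eK (setIidPr HL) properxx.
    move=> L /andP[kL HL]; rewrite inE kL kH /lo /=; apply/andP; split.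
      by apply/set0Pn; exists k; rewrite inE kL.
    by rewrite properE subsetIr /= subsetI subxx andbT.
  by move=> k k' hk hk'; rewrite !e.
rewrite negb_exists_in => /forall_inP clo.
suff : (size l + #|Phi| < r)%N by rewrite ltnNge addnC -leq_subLR hl.
have sPhi : (\sum_(H in Phi) count (lo H) l + #|Phi| <= rk M F)%N.
  rewrite -(rk_factors G fF F0) -sum1_card -big_split; apply: leq_sum => H hH /=.
  by rewrite addn1 ltnNge clo.
move: cu; rewrite ltn_subRL => /(leq_ltn_trans _); apply.
rewrite [(rk M F + _)%N]addnC; apply: (@leq_trans (count up l + \sum_(H in Phi) count (lo H) l + #|Phi|)).
  by rewrite leq_add2r.
by rewrite -addnA leq_add2l.
Qed.

Lemma deg1_low H K : deg1 (low H K).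
Proof. by rewrite /low; case: ifP => _; [apply: deg1_sum | apply: chow_degree0]. Qed.

Lemma deg1_letter K : deg1 (letter K).
Proof.
rewrite /letter; case: ifP => _; first exact: chow_degree_xc.
by apply: chow_degree_sum => H _; apply: deg1_low.
Qed.

(** * Invariance of degrees under one blowup *)

Section Degree.
Variable deg : A -> rat.
Hypotheses (degD : forall a b, deg (a + b) = deg a + deg b)
  (degZ : forall q a, deg (cst q * a) = q * deg a)
  (deg_homog : forall m a, m <> r.-1 -> chow_degree m a -> deg a = 0).

Lemma deg_lin0 : deg 0 = 0.
Proof. by have := degZ 0 0; rewrite mul0r mulr0. Qed.

Lemma deg_linN a : deg (- a) = - deg a.
Proof. by rewrite -mulN1r -(rmorphN1 cst) degZ mulN1r. Qed.

(** In the only degree that counts, r - 1, the words of b have r - 2 - k letters; k < #|Phi| - 1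
    makes this at least r - #|Phi|. *)
Lemma deg_base_vanish k b : (k < #|Phi|.-1)%N -> base b -> deg (x F * h F ^+ k * b) = 0.
Proof.
move=> hk [s hs].
rewrite mulrAC hs mulrAC mulr_sumr; elim/big_ind: _ => [||c _].
- exact: deg_lin0.
- by move=> a c ha hc; rewrite degD ha hc addr0.
rewrite mulrCA degZ.
have [hsz|hsz] := eqVneq (1 + k + size c.2)%N r.-1; last first.
  rewrite (deg_homog (m := (1 + k + size c.2)%N)) ?mulr0 //; first exact/eqP.
  apply: chow_degreeM; last by apply: chow_degree_prod => K; apply: deg1_letter.
  apply: chow_degreeM; first exact: chow_degree_xc.
  by have := chow_degreeX k (deg1_h M i F); rewrite mul1n.
rewrite mulrAC mul_word_nil ?mul0r ?deg_lin0 ?mulr0 //.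
have r0 := rkT_gt0 M; rewrite leq_subLR -(prednK r0) -hsz add1n.
by rewrite -addSn leq_add2r -ltn_predRL.
Qed.

Lemma deg_blowup u : base u ->
  deg (u * (ctodd (bclass - h F) * \prod_(H <- enum Phi) ctodd (h F - h H)
     - \prod_(H <- enum Phi) ctodd (bclass - h H))) = 0.
Proof.
move=> bu; have r0 := rkT_gt0 M.
pose io' : {rmorphism rat -> {poly A}} := polyC \o cst.
have [f fE] : exists f : A -> {poly A}, forall y, f y = stodd io' r.+1 ('X * y%:P) by eexists.
pose l := [seq h H | H <- enum Phi].
(* The same difference with every argument scaled by t. The coefficient of t^m is homogeneous of
   degree m ([grv]), so it vanishes from m = r on, and [todd_specialize] treats the others one by
   one. *)
pose v := f (bclass - h F) * \prod_(H <- enum Phi) f (h F - h H)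
  - \prod_(H <- enum Phi) f (bclass - h H).
have f1 y : (f y).[1] = ctodd y.
  have e : horner_eval 1 ('X * y%:P) = y.
    by rewrite /horner_eval hornerM hornerX hornerC mul1r.
  rewrite fE -[in RHS]e; apply: (@rmorph_pser _ _ io' cst (horner_eval 1)) => q.
  by rewrite /io' /= /horner_eval hornerC.
have f1p (s : seq {set E}) (y : {set E} -> A) :
    (\prod_(H <- s) f (y H)).[1] = \prod_(H <- s) ctodd (y H).
  elim: s => [|H s IH]; first by rewrite !big_nil hornerC.
  by rewrite !big_cons hornerM f1 IH.
have -> : ctodd (bclass - h F) * \prod_(H <- enum Phi) ctodd (h F - h H)
     - \prod_(H <- enum Phi) ctodd (bclass - h H) = v.[1].
  by rewrite /v hornerD hornerN hornerM f1 !f1p.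
pose gr (p : {poly A}) := forall m, chow_degree m p`_m.
have grM p q : gr p -> gr q -> gr (p * q).
  move=> hp hq m; rewrite coefM; apply: chow_degree_sum => j _.
  by have := chow_degreeM (hp j) (hq (m - j)%N); rewrite subnKC // -ltnS.
have grf y : deg1 y -> gr (f y).
  move=> hy m; have -> : f y = \poly_(k < r.+1) (cst (toddc k) * y ^+ k).
    rewrite fE poly_def; apply: eq_bigr => k _; rewrite exprMn -polyC_exp mulrCA -polyCM.
    by rewrite mulrC mul_polyC.
  rewrite coef_poly; case: ifP => _; last exact: chow_degree0.
  by apply: chow_degreeZ; have := chow_degreeX m hy; rewrite mul1n.
have gr_prod (s : seq {set E}) (F' : {set E} -> {poly A}) :
    (forall H, gr (F' H)) -> gr (\prod_(H <- s) F' H).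
  move=> hF'; elim: s => [|H s IH]; last by rewrite big_cons; apply: grM.
  move=> m; rewrite big_nil coef1; case: m => [|m]; last exact: chow_degree0.
  by rewrite -(rmorph1 cst); apply: chow_degree_const.
have grv : gr v.
  have hh H H' : deg1 (h H - h H') by apply: chow_degreeB; apply: deg1_h.
  have hb H : deg1 (bclass - h H) by apply: chow_degreeB; [exact: deg1_b | exact: deg1_h].
  move=> m; rewrite coefB; apply: chow_degreeB; last by apply: gr_prod => H; apply: grf.
  by apply: grM; [apply: grf | apply: gr_prod => H; apply: grf].
rewrite horner_coef mulr_sumr; elim/big_ind: _ => [||m _].
- exact: deg_lin0.
- by move=> a c ha hc; rewrite degD ha hc addr0.
rewrite expr1n mulr1; move: (nat_of_ord m) => {}m; have [rm|mr] := leqP r m.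
  by rewrite (chow_degree_nil rm (grv m)) mulr0 deg_lin0.
have sl : size l = #|Phi| by rewrite size_map -cardE.
have fl (y : A -> A) : \prod_(H <- enum Phi) f (y (h H)) =
    \prod_(z <- l) stodd io' r.+1 ('X * (y z)%:P).
  by rewrite /l [RHS]big_map; apply: eq_bigr => H _; rewrite fE.
have -> : v = stodd io' r.+1 ('X * (bclass - h F)%:P) *
      (\prod_(z <- l) stodd io' r.+1 ('X * (h F - z)%:P)) -
    \prod_(z <- l) stodd io' r.+1 ('X * (bclass - z)%:P).
  by rewrite /v (fl (fun z => h F - z)) (fl (fun z => bclass - z)) fE.
(* [Q] is the orthogonal of the base classes under the degree pairing. Since a - b is -x_F, the root
   hypothesis is [center_root] and [Qa] is [deg_base_vanish]. *)
apply: (@todd_specialize A cst r.+1 _ (h F) bclass l _ _ base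
  (fun c => forall w, base w -> deg (w * c) = 0)) => //.
- by rewrite sl; have /set0Pn[e /(factors_cover G fF)[H hH _]] := F0; apply/card_gt0P; exists H.
- rewrite big_map bclassE opprD addNKr mulNr center_root oppr0 //.
- exact: base_const.
- exact: baseD.
- exact: baseM.
- exact: base_b.
- move=> y /mapP[H]; rewrite mem_enum => /factorsP[HG _ _] ->.
  by apply: (@base_h (bset G)) => // K KG; left.
- by move=> w _; rewrite mulr0 deg_lin0.
- by move=> a c ha hc w bw; rewrite mulrDr degD ha ?hc ?addr0.
- move=> k c; rewrite size_map -cardE => hk bc w bw.
  rewrite bclassE opprD addNKr.
  have -> : w * (- x F * h F ^+ k * c) = - (x F * h F ^+ k * (w * c)) by ring.
  by rewrite deg_linN deg_base_vanish ?oppr0 //; apply: baseM.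
Qed.

(** The blowup factor minus 1 is the difference in [deg_blowup] divided by the product of the td(b -
    theta_H). The inverse of that product is itself a base class and is absorbed into the
    multiplier. *)
Lemma deg_wtodd_setU1 V u : bset G \subset V -> F \notin V -> upper_over V ->
  (forall L, flat M L -> F \proper L -> L \in V) -> base u ->
  deg (u * wtodd (F |: V)) = deg (u * wtodd V).
Proof.
move=> GV FV uV up bu; rewrite wtodd_setU1 //.
set P := \prod_(H <- enum Phi) citodd _; set Q := \prod_(H <- enum Phi) ctodd (h F - h H).
have bP : base P.
  rewrite /P big_enum; apply: base_prod => H /factorsP[HG _ _].
  apply: base_pser; apply: baseB; first exact: base_b.
  by apply: (@base_h (bset G)) => // K KG; left.
have := deg_blowup (baseM (baseM bu (base_wtodd FV uV)) bP); rewrite -/Q.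
set R := \prod_(H <- enum Phi) ctodd _.
have RP : R * P = 1.
  rewrite /R /P -big_split big1 // => H _; apply: ctodd_citodd.
  by apply: chow_degreeB; [exact: deg1_b | exact: deg1_h].
have -> : u * wtodd V * P * (ctodd (bclass - h F) * Q - R) =
    u * (wtodd V * (ctodd (bclass - h F) * Q * P)) - u * wtodd V * (R * P) by ring.
by rewrite RP mulr1 degD deg_linN => /eqP; rewrite subr_eq0 => /eqP.
Qed.

End Degree.
End Center.
End Blowup.

(** * Pullback and duality *)

Section PullDual.
Variables (E : finType) (M : loopless_matroid E) (G : building_set M).

Lemma chow_dual_is_zmod_morphism : zmod_morphism (@chow_dual rat E M G).
Proof.
move=> a b; rewrite -(chow_class_repr a) -(chow_class_repr b) -rmorphB !chow_dualE.
by rewrite !rmorphB.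
Qed.

Lemma chow_dual_is_monoid_morphism : monoid_morphism (@chow_dual rat E M G).
Proof.
split=> [|a b]; first by rewrite -(rmorph1 (@chow_class rat E M G)) chow_dualE !rmorph1.
rewrite -(chow_class_repr a) -(chow_class_repr b) -rmorphM !chow_dualE.
by rewrite !rmorphM.
Qed.

HB.instance Definition _ := GRing.isZmodMorphism.Build (chow rat G) (chow rat G)
  (@chow_dual rat E M G) chow_dual_is_zmod_morphism.
HB.instance Definition _ := GRing.isMonoidMorphism.Build (chow rat G) (chow rat G)
  (@chow_dual rat E M G) chow_dual_is_monoid_morphism.

Lemma chow_pull_is_zmod_morphism : zmod_morphism (@chow_pull rat E M G).
Proof.
move=> a b; rewrite -(chow_class_repr a) -(chow_class_repr b) -rmorphB !chow_pullE.
by rewrite !rmorphB.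
Qed.

Lemma chow_pull_is_monoid_morphism : monoid_morphism (@chow_pull rat E M G).
Proof.
split=> [|a b]; first by rewrite -(rmorph1 (@chow_class rat E M G)) chow_pullE !rmorph1.
rewrite -(chow_class_repr a) -(chow_class_repr b) -rmorphM !chow_pullE.
by rewrite !rmorphM.
Qed.

HB.instance Definition _ := GRing.isZmodMorphism.Build (chow rat G) (chow rat (gmax M))
  (@chow_pull rat E M G) chow_pull_is_zmod_morphism.
HB.instance Definition _ := GRing.isMonoidMorphism.Build (chow rat G) (chow rat (gmax M))
  (@chow_pull rat E M G) chow_pull_is_monoid_morphism.

Lemma chow_dual_const q : chow_dual (chow_const G q) = chow_const G q.
Proof. by rewrite [LHS]chow_dualE comp_mpolyC. Qed.

Lemma chow_pull_const q : chow_pull (chow_const G q) = chow_const (gmax M) q.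
Proof. by rewrite [LHS]chow_pullE comp_mpolyC. Qed.

Lemma chow_dual_ray (j : 'I_(nrays G)) : chow_dual (xc G (ray j)) = - xc G (ray j).
Proof.
by rewrite xc_ray [LHS]chow_dualE comp_mpolyXU -tnth_nth tnth_mktuple rmorphN.
Qed.

Lemma chow_dual_xc L : chow_dual (xc G L) = - xc G L.
Proof.
rewrite /xc rmorph_sum -sumrN; apply: eq_bigr => j _ /=.
by rewrite -xc_ray chow_dual_ray.
Qed.

Lemma chow_pull_ray (j : 'I_(nrays G)) :
  chow_pull (xc G (ray j)) = wclass G (bset G) (ray j).
Proof.
rewrite xc_ray [LHS]chow_pullE comp_mpolyXU -tnth_nth tnth_mktuple rmorph_sum.
rewrite /wclass sum_xc1; apply: eq_bigl => f /=.
by rewrite /wfac; case: ifP => // fG; rewrite factorsT.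
Qed.

End PullDual.

Section Duality.
Variables (E : finType) (M : loopless_matroid E) (G : building_set M) (i : E).
Local Notation A := (chow rat (gmax M)).
Local Notation r := (rk M [set: E]).
Local Notation x := (@xc E M (gmax M)).
Local Notation deg1 := (@chow_degree rat E M (gmax M) 1).
Local Notation cst := (chow_const (gmax M)).
Local Notation h := (hclass M i).
Local Notation al := (aclass M i).

Lemma chow_pull_dual (a : chow rat G) : chow_pull (chow_dual a) = chow_dual (chow_pull a).
Proof.
rewrite -(chow_class_repr a); apply: (chow_class_poly_ind
  (P := fun a => chow_pull (chow_dual a) = chow_dual (chow_pull a))).
- by move=> q; rewrite chow_dual_const !chow_pull_const chow_dual_const.
- by move=> b c hb hc; rewrite !rmorphD /= hb hc.
- by move=> b c hb hc; rewrite !rmorphM /= hb hc.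
move=> j; rewrite chow_dual_ray rmorphN /= chow_pull_ray rmorph_sum /= -sumrN.
by apply: eq_bigr => L _; rewrite chow_dual_xc.
Qed.

Lemma base_pull F (a : chow rat G) : between M set0 [set: E] F -> F \notin bset G ->
  base G F (chow_pull a).
Proof.
move=> bF FG; rewrite -(chow_class_repr a).
apply: (chow_class_poly_ind (P := fun a => base G F (chow_pull a))).
- by move=> q; rewrite chow_pull_const; apply: base_const.
- by move=> b c; rewrite rmorphD; apply: baseD.
- by move=> b c; rewrite rmorphM; apply: baseM.
move=> j; rewrite chow_pull_ray; apply: (@base_wclass _ _ i) => //.
  by move=> K; left.
by have [] := rayP j.
Qed.

Lemma chow_dual_deg1 (a : A) : deg1 a -> chow_dual a = - a.
Proof.
apply: (chow_degree_word_ind (P := fun a => chow_dual a = - a)).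
- by rewrite rmorph0 oppr0.
- by move=> b c hb hc; rewrite rmorphD /= hb hc opprD.
- move=> q [|L [|]] // _; rewrite big_seq1 rmorphM /= chow_dual_const chow_dual_xc.
  by rewrite mulrN.
Qed.

Lemma chow_dual_ctodd (a : A) : deg1 a -> chow_dual (ctodd a) = ctodd a * cexp (- a).
Proof.
move=> ha; rewrite -ctoddN // -(chow_dual_deg1 ha).
by apply: rmorph_pser => q; apply: chow_dual_const.
Qed.

Lemma chow_dual_citodd (a : A) : deg1 a -> chow_dual (citodd a) = citodd a * cexp a.
Proof.
move=> ha; rewrite -citoddN // -(chow_dual_deg1 ha).
by apply: rmorph_pser => q; apply: chow_dual_const.
Qed.

Lemma chow_degreeMn (a : A) n : deg1 a -> deg1 (a *+ n).
Proof. by move=> ha; rewrite -mulr_natl -(rmorph_nat cst); apply: chow_degreeZ. Qed.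

Lemma cexpMn (a : A) n : deg1 a -> cexp (a *+ n) = cexp a ^+ n.
Proof.
move=> ha; elim: n => [|n IH]; first exact: cexp0.
by rewrite mulrS cexpD ?IH ?exprS //; apply: chow_degreeMn.
Qed.

Lemma cexp_sum (I : finType) (P : pred I) (F : I -> A) :
  (forall k, P k -> deg1 (F k)) -> cexp (\sum_(k | P k) F k) = \prod_(k | P k) cexp (F k).
Proof.
move=> hF; suff [] : deg1 (\sum_(k | P k) F k) /\
    cexp (\sum_(k | P k) F k) = \prod_(k | P k) cexp (F k) by [].
elim/big_rec2: _ => [|k a b Pk [hb eb]].
  by split; [exact: chow_degree0 | exact: cexp0].
by split; [apply: chow_degreeD => //; apply: hF | rewrite cexpD ?eb //; apply: hF].
Qed.

Lemma cexpNK (a : A) : deg1 a -> cexp (- a) * cexp a = 1.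
Proof.
by move=> ha; rewrite -cexpD ?addNr ?cexp0 //; apply: chow_degreeN.
Qed.

(* The pullback of c_1(T_{M,V}). *)
Definition wc1 (V : {set {set E}}) : A :=
  al *+ r + \sum_(H in V :\ [set: E]) (wclass G V H - wclass G V H *+ rk M H).

(** Each td(D) contributes exp(-D) and each inverse exp(D). In the quotients the theta_H cancel, so
    the exponents add up to minus the first Chern class. *)
Lemma chow_dual_wtodd V : chow_dual (wtodd i G V) = wtodd i G V * cexp (- wc1 V).
Proof.
have da := deg1_a M i; have dX := @deg1_wclass _ _ G V; have dh := deg1_h M i.
have dW H : deg1 (wclass G V H - wclass G V H *+ rk M H).
  by apply: chow_degreeB => //; apply: chow_degreeMn.
rewrite /wtodd /wc1 opprD -sumrN cexpD; last 2 first.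
- by apply: chow_degreeN; apply: chow_degreeMn.
- by apply: chow_degree_sum => H _; apply: chow_degreeN.
rewrite cexp_sum; last by move=> H _; apply: chow_degreeN.
rewrite mulrACA -big_split -mulNrn cexpMn; last exact: chow_degreeN.
rewrite -exprMn -chow_dual_ctodd // rmorphM rmorphXn rmorph_prod; congr (_ * _).
apply: eq_bigr => H _; rewrite /wtodd_factor rmorphM rmorphXn rmorphM /=.
rewrite !chow_dual_ctodd // chow_dual_citodd; last exact: chow_degreeD.
have -> : cexp (- (wclass G V H - wclass G V H *+ rk M H)) =
    cexp (- wclass G V H) * cexp (wclass G V H) ^+ rk M H.
  rewrite -cexpMn // -cexpD ?opprB 1?addrC //; first exact: chow_degreeN.
  exact: chow_degreeMn.
rewrite cexpD //; have := cexpNK (dh H).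
move: (cexp (- h H)) (cexp (h H)) (ctodd (h H)) (citodd (h H + _)) => n e a b ne.
move: (ctodd _) (cexp _) (cexp _) => c f d.
have -> : a * n * (b * (e * f)) = a * b * f * (n * e) by ring.
rewrite ne mulr1 [(a * b * f) ^+ _]exprMn.
by ring.
Qed.

Section Degree.
Variable deg : A -> rat.
Hypotheses (degD : forall a b, deg (a + b) = deg a + deg b)
  (degZ : forall q a, deg (cst q * a) = q * deg a)
  (deg_homog : forall m a, m <> r.-1 -> chow_degree m a -> deg a = 0).

Lemma deg_dual a : deg (chow_dual a) = (-1) ^+ r.-1 * deg a.
Proof.
apply: (chow_word_ind (P := fun a => deg (chow_dual a) = (-1) ^+ r.-1 * deg a)).
- by rewrite rmorph0 (deg_lin0 degZ) mulr0.
- by move=> b c hb hc; rewrite rmorphD /= !degD hb hc mulrDr.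
move=> q l; rewrite rmorphM /= chow_dual_const !degZ mulrCA; congr (_ * _).
have -> : chow_dual (\prod_(L <- l) x L) = cst ((-1) ^+ size l) * \prod_(L <- l) x L.
  rewrite rmorph_prod /=; elim: l => [|L l IH]; first by rewrite !big_nil rmorph1 mul1r.
  rewrite !big_cons IH chow_dual_xc /= exprS rmorphM rmorphN1 /=; ring.
rewrite degZ; have [->//|/eqP ne] := eqVneq (size l) r.-1.
rewrite (deg_homog ne) ?mulr0 //; apply: chow_degree_prod => L.
exact: chow_degree_xc.
Qed.

(** Induction on the size of V minus G, removing from it a flat F of least cardinality. Minimality
    preserves [upper_over]; as F is outside G, [upper_over] also places every flat strictly above F
    in V. *)
Lemma deg_wtodd (V : {set {set E}}) (a : chow rat G) : bset G \subset V -> V \subset bset (gmax M) ->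
  upper_over G V ->
  deg (chow_pull a * wtodd i G V) = deg (chow_pull a * wtodd i G (bset G)).
Proof.
suff main n (V' : {set {set E}}) : (#|V' :\: bset G| < n)%N -> bset G \subset V' ->
    V' \subset bset (gmax M) -> upper_over G V' ->
    deg (chow_pull a * wtodd i G V') = deg (chow_pull a * wtodd i G (bset G)).
  exact: (main _ V (ltnSn _)).
elim: n V' => // n IH {}V; rewrite ltnS => Vn GV VM uV.
have [/eqP|[F0 F0V]] := set_0Vmem (V :\: bset G).
  rewrite setD_eq0 => VG; suff -> : V = bset G by [].
  by apply/eqP; rewrite eqEsubset VG.
pose F := [arg min_(X < F0 in V :\: bset G) #|X|].
have [FVG Fmin] : F \in V :\: bset G /\ forall X, X \in V :\: bset G -> (#|F| <= #|X|)%N.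
  by rewrite /F; case: arg_minnP.
have [FG FV] : F \notin bset G /\ F \in V by move: FVG; rewrite inE => /andP[].
have bF : between M set0 [set: E] F.
  have := subsetP VM F FV; rewrite inE => /andP[fF F0'].
  rewrite /between fF properEneq eq_sym F0' sub0set properT.
  by apply: contraNneq FG => ->; apply: bset_full.
have VE : V = F |: (V :\ F) by rewrite setD1K.
have nF : F \notin V :\ F by rewrite !inE eqxx.
have GV0 : bset G \subset V :\ F.
  apply/subsetP => K KG; rewrite !inE (subsetP GV) // andbT.
  by apply: contraNneq FG => <-.
have uV0 : upper_over G (V :\ F).
  move=> K; rewrite inE => /andP[KF KV]; have [KG|KG] := boolP (K \in bset G); first by left.
  right=> L fL KL; rewrite !inE; have [/idP KG'|up] := uV K KV; first by rewrite KG' in KG.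
  rewrite up // andbT; apply: contraNneq KF => eL.
  have KVG : K \in V :\: bset G by rewrite inE KG.
  by rewrite inE eqEcard -{1}eL KL Fmin.
have up L : flat M L -> F \proper L -> L \in V :\ F.
  move=> fL FL; rewrite !inE; have [/idP FG'|u] := uV F FV; first by rewrite FG' in FG.
  by rewrite u ?proper_sub // andbT; apply: contraTneq FL => ->; rewrite properxx.
have : deg (chow_pull a * wtodd i G (F |: (V :\ F))) = deg (chow_pull a * wtodd i G (V :\ F)).
  by apply: deg_wtodd_setU1 => //; exact: base_pull.
rewrite -VE => ->; apply: IH => //; last exact: subset_trans (subsetDl _ _) VM.
apply: leq_trans Vn; apply: proper_card; rewrite properE; apply/andP; split.
  by apply: setSD; apply: subsetDl.
by apply/subsetPn; exists F => //; rewrite !inE eqxx andbF.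
Qed.

End Degree.
End Duality.

Section DivisorClass.
Variables (E : finType) (M : loopless_matroid E) (G : building_set M).
Local Notation cls := (@div_class rat E M G).

Lemma div_classE (D : divisor G) : cls D = \sum_j chow_const G (D j)%:~R * xc G (ray j).
Proof.
rewrite /div_class rmorph_sum; apply: eq_bigr => j _.
by rewrite -mul_mpolyC rmorphM xc_ray.
Qed.

Lemma div_class_is_zmod_morphism : zmod_morphism cls.
Proof.
move=> D D'; rewrite !div_classE -sumrB; apply: eq_bigr => j _.
by rewrite -mulrBl -rmorphB -rmorphB !ffunE.
Qed.

HB.instance Definition _ := GRing.isZmodMorphism.Build (divisor G) (chow rat G) cls
  div_class_is_zmod_morphism.

Lemma div_class_xdiv (j : 'I_(nrays G)) : cls (xdiv j) = xc G (ray j).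
Proof.
rewrite div_classE (bigD1 j) //= ffunE eqxx rmorph1 mul1r big1 ?addr0 // => j' /negPf ne.
by rewrite ffunE ne rmorph0 mul0r.
Qed.

Lemma div_class_alpha e : cls (alpha G e) = \sum_(j : 'I_(nrays G) | e \in ray j) xc G (ray j).
Proof.
rewrite div_classE [RHS]big_mkcond; apply: eq_bigr => j _; rewrite ffunE.
by case: ifP; rewrite ?rmorph1 ?rmorph0 ?mul1r ?mul0r.
Qed.

End DivisorClass.

(** * Identification of the Todd, Chern and alpha classes with their pulled-back forms *)

Section Euler.
Variables (E : finType) (M : loopless_matroid E) (G : building_set M) (i : E).
Local Notation A := (chow rat (gmax M)).
Local Notation r := (rk M [set: E]).
Local Notation x := (@xc E M (gmax M)).
Local Notation deg1 := (@chow_degree rat E M (gmax M) 1).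
Local Notation al := (aclass M i).

Lemma wclass_gmax H : H \in bset (gmax M) -> wclass G (bset (gmax M)) H = x H.
Proof.
move=> HM; rewrite /wclass (bigD1 H) /=; last by rewrite /wfac HM inE.
rewrite big1 ?addr0 // => L /andP[+ LH]; rewrite /wfac; case: ifP => [_|LM _].
  by rewrite inE eq_sym (negPf LH).
apply: xc_out; apply: contraFN LM => /and3P[fL L0 _].
by rewrite inE fL; move: L0; rewrite properEneq eq_sym => /andP[].
Qed.

Lemma todd_gmax : todd (tangent (gmax M) i) = wtodd i G (bset (gmax M)).
Proof.
have alE : div_class rat (alpha (gmax M) i) = al.
  rewrite div_class_alpha /aclass sum_xc1; apply: eq_bigr => j _.
  by rewrite xc_ray.
rewrite todd_tangent /wtodd alE; congr (_ * _).
rewrite [RHS]big_enum_val; apply: eq_bigr => j _.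
rewrite -[enum_val j]/(ray j) /wtodd_factor wclass_gmax; last by have [] := rayP j.
have thE : div_class rat (theta i j) = hclass M i (ray j).
  rewrite /theta raddfB raddf_sum /= alE /hclass sum_xc1; congr (_ - _).
  by apply: eq_bigr => k _; rewrite div_class_xdiv xc_ray.
by rewrite thE raddfD /= div_class_xdiv thE.
Qed.

(** The factors of a flat are disjoint and cover it, so a flat through i has exactly one factor
    through i. *)
Lemma pull_alpha : chow_pull (div_class rat (alpha G i)) = al.
Proof.
rewrite div_class_alpha rmorph_sum /=.
transitivity (\sum_(H in bset G :\ [set: E] | i \in H) wclass G (bset G) H).
  rewrite [RHS]big_mkcondr [RHS]big_enum_val [LHS]big_mkcond.
  apply: eq_bigr => j _; rewrite -[enum_val j]/(ray j); case: ifP => // _.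
  exact: chow_pull_ray.
rewrite /wclass (exchange_big_dep (fun L : {set E} => i \in L)) /=; last first.
  by move=> H L /andP[_ iH] /wfac_sub/subsetP; apply.
apply: eq_bigr => L iL; have [/and3P[fL L0 LT]|/xc_out ->] := boolP (between M set0 [set: E] L);
  last by rewrite big1.
have [H hH iH] := factors_cover G fL iL.
have wE : wfac G (bset G) L = factors G L by rewrite /wfac; case: ifP => // LG; rewrite factorsT.
rewrite wE (big_pred1 H) // => H' /=; rewrite in_setD1.
apply/idP/eqP => [/andP[/andP[_ iH'] hH']|->].
  exact: (factors_disjoint fL hH' hH iH' iH).
have [HG HL _] := factorsP _ _ _ hH; rewrite HG hH iH !andbT.
by apply: contraTneq LT => <-; rewrite properE (subset_trans _ HL) ?andbF // subsetT.
Qed.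

Lemma pull_c1 : chow_pull (div_class rat (c1 (tangent G i))) = wc1 G i (bset G).
Proof.
rewrite c1_tangent raddfD raddfMn raddf_sum /= rmorphD rmorphMn rmorph_sum /= pull_alpha; congr (_ + _).
rewrite [RHS]big_enum_val; apply: eq_bigr => j _.
by rewrite -[enum_val j]/(ray j) raddfB raddfMn /= rmorphB rmorphMn /= div_class_xdiv chow_pull_ray.
Qed.

Lemma deg1_pull (D : divisor G) : deg1 (chow_pull (div_class rat D)).
Proof.
rewrite div_classE rmorph_sum; apply: chow_degree_sum => j _ /=.
rewrite rmorphM /= chow_pull_const chow_pull_ray; apply: chow_degreeZ.
exact: deg1_wclass.
Qed.

Lemma pull_chern (D : divisor G) : chow_pull (chern_line D) = cexp (chow_pull (div_class rat D)).
Proof.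
rewrite /cexp /sexp /pser big_ord_recr /= (deg1_nilX (deg1_pull D)) // mulr0 addr0.
rewrite /chern_line !rmorph_sum; apply: eq_bigr => m _ /=.
by rewrite -mul_mpolyC !rmorphM !rmorphXn /= -(chow_pull_const G).
Qed.

End Euler.

Theorem corollary4p14 (k : fieldType) (E : finType) (M : loopless_matroid E)
    (G : building_set M) (i : E)
    (ch : forall H : building_set M, kgroup k H -> chow rat H)
    (hch : is_chern_character ch)
    (deg : chow rat (gmax M) -> rat) (hdeg : is_degree_map i deg)
    (xi : kgroup k G) :
  euler ch i deg xi =
  (-1) ^+ (rk M [set: E]).-1 * euler ch i deg (ktensor (kdual xi) (omega k i G)).
Proof.
have [_ chM chV chP chL] := hch.
have [degD degZ deg_homog _ _] := hdeg.
have GM : bset G \subset bset (gmax M).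
  by apply/subsetP => H HG; rewrite inE (bset_flat HG) (bset_neq0 HG).
have uM : upper_over G (bset (gmax M)).
  move=> K; rewrite inE => /andP[_ K0]; right=> L fL KL; rewrite inE fL.
  by apply: contraNneq K0 => L0; rewrite -subset0 -L0.
(* Riemann-Roch for G: against pulled-back classes, the Todd class of X_{M,Gmax} may be replaced by
   the pullback of that of T_{M,G}. *)
have hrr (a : chow rat G) : deg (chow_pull a * todd (tangent (gmax M) i)) =
    deg (chow_pull a * wtodd i G (bset G)).
  rewrite (todd_gmax G).
  exact: (@deg_wtodd E M G i deg degD degZ deg_homog (bset (gmax M)) a GM (subxx _) uM).
have eu b : euler ch i deg b = deg (chow_pull (ch G b) * wtodd i G (bset G)).
  by rewrite -hrr; congr (deg (_ * _)); apply: chP.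
rewrite !eu chM chV chL; set w := wtodd i G (bset G).
have dw : chow_dual w = w * cexp (- wc1 G i (bset G)) by apply: chow_dual_wtodd.
(* exp(-c_1) times the Todd class is the dual of the Todd class, so this integrand is the dual of
   the one for xi, and [deg_dual] supplies the sign. *)
have -> : chow_pull (chow_dual (ch G xi) * chern_line (- c1 (tangent G i))) * w =
    chow_dual (chow_pull (ch G xi) * w).
  move: w dw => w dw; rewrite !rmorphM /= dw chow_pull_dual pull_chern raddfN rmorphN /= pull_c1.
  by rewrite -mulrA [cexp _ * _]mulrC.
by rewrite (deg_dual degD degZ deg_homog) mulrA -exprMn mulrNN mulr1 expr1n mul1r.
Qed.
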